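(* Let $T>0$, $d\in\mathbb N$, $\ell=(\ell_1,\dots,\ell_d)\in(-1,\infty)^d$, $c\in\mathbb C^d$, $g\in\mathbb C$, and consider the Fourier-transformed anisotropic wave equation $$\text{(K)}\quad\partial_t^2\hat\phi+(\mathfrak H^2+\imath\mathfrak C)\hat\phi+gt^{-1}\partial_t\hat\phi=0\quad\text{on }(0,T]_t\times\mathbb R^d_\xi,\qquad\mathfrak H^2=\sum_{i=1}^dt^{2\ell_i}\xi_i^2,\quad\mathfrak C=\sum_{i=1}^dc_it^{\ell_i-1}\xi_i.$$ Let $m_P\in\mathbb N_0$ be sufficiently large and $\rho_0$ sufficiently small, and let $\hat\varphi_\pm$ be the quantities on $Z_P$ associated with $\hat\phi$ defined in the context. (Asymptotics) Given $\hat\phi_0,\hat\phi_1:\mathbb R^d\to\mathbb C$, there is a unique solution $\hat\phi$ of (K) with $(\hat\phi,\partial_t\hat\phi)(T,\cdot)=(\hat\phi_0,\hat\phi_1)$. Moreover, the following limits exist and are finite for all $\xi\in\mathbb R^d$: $$\hat\varphi_{+,0}(\xi):=\lim_{\tau\searrow0}\hat\varphi_+(\tau,\xi),\quad\hat\varphi_{-,0}(\xi):=\lim_{\tau\searrow0}\hat\varphi_-(\tau,\xi)\qquad\text{if }g\ne1,$$ $$\hat\varphi_{+,0}(\xi):=\lim_{\tau\searrow0}[\hat\varphi_+-(\log z)\hat\varphi_-](\tau,\xi),\quad\hat\varphi_{-,0}(\xi):=\lim_{\tau\searrow0}\hat\varphi_-(\tau,\xi)\qquad\text{if }g=1.$$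 In addition, for all $\xi\in\mathbb R^d$, $$\langle\langle\xi\rangle\rangle^{\frac{1-\operatorname{Re}g}2}|\hat\varphi_{+,0}(\xi)|+\langle\langle\xi\rangle\rangle^{\frac{\operatorname{Re}g-1}2}|\hat\varphi_{-,0}(\xi)|\lesssim\langle\langle\xi\rangle\rangle^{\frac{|c|}2}\big[\langle\xi\rangle^{\frac12}|\hat\phi(T,\xi)|+\langle\xi\rangle^{-\frac12}|\partial_t\hat\phi(T,\xi)|\big].$$ (Scattering) Given $\hat\varphi_{\pm,0}:\mathbb R^d\to\mathbb C$, there is a unique solution $\hat\phi$ of (K) such that for all $\xi\in\mathbb R^d$: $\lim_{\tau\searrow0}\hat\varphi_\pm(\tau,\xi)=\hat\varphi_{\pm,0}(\xi)$ if $g\ne1$; respectively $\lim_{\tau\searrow0}[\hat\varphi_+-(\log z)\hat\varphi_-](\tau,\xi)=\hat\varphi_{+,0}(\xi)$ and $\lim_{\tau\searrow0}\hat\varphi_-(\tau,\xi)=\hat\varphi_{-,0}(\xi)$ if $g=1$. In addition, for all $\xi\in\mathbb R^d$, $$\langle\xi\rangle^{\frac12}|\hat\phi(T,\xi)|+\langle\xi\rangle^{-\frac12}|\partial_t\hat\phi(T,\xi)|\lesssim\langle\langle\xi\rangle\rangle^{\frac{|c|}2}\big[\langle\langle\xi\rangle\rangle^{\frac{1-\operatorname{Re}g}2}|\hat\varphi_{+,0}(\xi)|+\langle\langle\xi\rangle\rangle^{\frac{\operatorname{Re}g-1}2}|\hat\varphi_{-,0}(\xi)|\big].$$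
   Context: $\mathbb N=\{1,2,\dots\}$, $\mathbb N_0=\mathbb N\cup\{0\}$, $\imath=\sqrt{-1}$, $\langle\eta\rangle=(1+|\eta|^2)^{1/2}$. $A\lesssim B$ means $A\le CB$ with $C$ independent of $\xi$ and of the solution. (K) is the spatial Fourier transform of $\partial_t^2\phi-\sum_it^{2\ell_i}\partial_{x_i}^2\phi+\sum_ic_it^{\ell_i-1}\partial_{x_i}\phi+gt^{-1}\partial_t\phi=0$; for each $\xi$ it is an ODE in $t$, and solutions satisfy $\hat\phi(\cdot,\xi)\in C^2((0,T];\mathbb C)$. $\ell_*=\min_i\ell_i$, $\langle\langle\xi\rangle\rangle=\max_i\langle\xi_i\rangle^{1/(\ell_i+1)}$, $z=\langle\langle\xi\rangle\rangle t$, $\partial_z=\langle\langle\xi\rangle\rangle^{-1}\partial_t$, $Z_P=\{(t,\xi)\in(0,T]\times\mathbb R^d:z\le\rho_0\}$ with $\rho_0\in(0,1)$ small. Case $g=1$: on $Z_P$, $\hat\varphi_+:=\hat\phi$ and $\hat\varphi_-:=t\partial_t\hat\phi$ (here $m_P$ plays no role). Case $g\ne1$: $\mathcal S_*^q(Z_P)$ is the set of continuous $f:Z_P\to\mathbb C^2\otimes\mathbb C^2$ ($2\times2$ matrices), smooth in $t$ for each $\xi$, such that for some $p\in\mathbb N_0$ and all $k\in\mathbb N_0$, $|(z\partial_z)^kf|\le C_kz^q(1+|\log z|)^p$. Let $$\mathcal A_P=\begin{bmatrix}-t^{-1}&t^{-1}\\-t\mathfrak H^2-\imath t\mathfrak C&-gt^{-1}\end{bmatrix},\quad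 M_P=\begin{bmatrix}g-1&1\\0&1\end{bmatrix},\quad B_P=\begin{bmatrix}-1&0\\0&-g\end{bmatrix},$$ $R_P=\langle\langle\xi\rangle\rangle^{-1}(M_P\mathcal A_PM_P^{-1}-t^{-1}B_P)$, $a_P=\ell_*$. Fix sequences, $m\in\mathbb N$: $D_P^{(m)}\in\mathcal S_*^{m(a_P+1)-1}(Z_P)$ diagonal, $N_P^{(m)}\in\mathcal S_*^{m(a_P+1)}(Z_P)$, $R_P^{(m)}\in\mathcal S_*^{m(a_P+1)+a_P}(Z_P)$ such that, with $Q_P^{(m)}=I_2+\sum_{k=1}^mN_P^{(k)}$, $$R_P^{(m)}=\sum_{k=1}^m\partial_zN_P^{(k)}+Q_P^{(m)}(z^{-1}B_P+R_P)-\Big(z^{-1}B_P+\sum_{k=1}^mD_P^{(k)}\Big)Q_P^{(m)};\qquad Q_P^{(0)}=I_2.$$ (Objects for smaller $\rho_0$ are restrictions of those for larger $\rho_0$.) Then on $Z_P$ $$\begin{bmatrix}\hat\varphi_+\\\hat\varphi_-\end{bmatrix}:=\begin{bmatrix}t&0\\0&t^g\end{bmatrix}Q_P^{(m_P)}\begin{bmatrix}\frac{g-1}t\hat\phi+\partial_t\hat\phi\\\partial_t\hat\phi\end{bmatrix}.$$ *)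

(* Defs.v *)
From Stdlib Require Import Reals.
From mathcomp Require Import all_boot.
From Coquelicot Require Import Coquelicot.

Set Implicit Arguments.
Unset Strict Implicit.
Unset Printing Implicit Defensive.

Open Scope R_scope.

(* R^d.  As a function type it carries Coquelicot's [fct_UniformSpace]
   structure, i.e. the sup-norm topology. *)
Notation vec d := ('I_d -> R).

(* 2x2 complex matrices; the product is Coquelicot's [Mmult]. *)
Notation mat2 := (@matrix C 2 2).

Definition jbr (x : R) : R := sqrt (1 + x ^ 2).

Definition vjbr d (xi : vec d) : R := sqrt (1 + \big[Rplus/0]_(i < d) xi i ^ 2).

Definition cvnorm d (c : 'I_d -> C) : R :=
  sqrt (\big[Rplus/0]_(i < d) Cmod (c i) ^ 2).

(* <<xi>>; every term is at least 1 when l i > -1, so the default value 0 of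
   the iterated maximum is immaterial. *)
Definition djbr d (l : 'I_d -> R) (xi : vec d) : R :=
  \big[Rmax/0]_(i < d) Rpower (jbr (xi i)) (/ (l i + 1)).

Definition lmin d (l : 'I_d.+1 -> R) : R := \big[Rmin/l ord0]_(i < d.+1) l i.

Definition zvar d (l : 'I_d -> R) (t : R) (xi : vec d) : R := djbr l xi * t.

Definition ZP d (T : R) (l : 'I_d -> R) (rho : R) (t : R) (xi : vec d) : Prop :=
  0 < t <= T /\ zvar l t xi <= rho.

(* t^g = exp (g log t), for t > 0. *)
Definition Rcpow (t : R) (g : C) : C :=
  (Rpower t (Re g) * cos (Im g * ln t), Rpower t (Re g) * sin (Im g * ln t)).

(* [f] has derivative [v] at [t] relative to [D]: two-sided at interior points
   of [D], one-sided at the endpoints of an interval. *)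
Definition is_derive_within (D : R -> Prop) (f : R -> C) (t : R) (v : C) : Prop :=
  filterlim (fun s : R => (RtoC (/ (s - t)) * (f s - f t))%C)
    (within (fun s => D s /\ s <> t) (locally t)) (locally v).

Definition continuous_within (D : R -> Prop) (f : R -> C) (t : R) : Prop :=
  filterlim f (within D (locally t)) (locally (f t)).

Definition Hsq d (l : 'I_d -> R) (t : R) (xi : vec d) : R :=
  \big[Rplus/0]_(i < d) (Rpower t (2 * l i) * xi i ^ 2).

Definition Cfr d (l : 'I_d -> R) (c : 'I_d -> C) (t : R) (xi : vec d) : C :=
  \big[Cplus/RtoC 0]_(i < d) (c i * RtoC (Rpower t (l i - 1) * xi i))%C.

(* [phi] is a solution of (K), with [dphi] its time derivative: for each [xi],
   [phi] is of class C^2 on (0,T].  Only values on (0,T] matter. *)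
Definition K_solution d (T : R) (l : 'I_d -> R) (c : 'I_d -> C) (g : C)
    (phi dphi : R -> vec d -> C) : Prop :=
  forall xi : vec d, exists ddphi : R -> C, forall t : R, 0 < t <= T ->
    let I := fun s => 0 < s <= T in
    is_derive_within I (fun s => phi s xi) t (dphi t xi) /\
    is_derive_within I (fun s => dphi s xi) t (ddphi t) /\
    continuous_within I ddphi t /\
    (ddphi t + (RtoC (Hsq l t xi) + Ci * Cfr l c t xi) * phi t xi
      + g * RtoC (/ t) * dphi t xi)%C = RtoC 0.

Definition ent m n (A : @matrix C m n) (i j : nat) : C := coeff_mat (RtoC 0) A i j.

Definition mk22 (a b c d : C) : mat2 :=
  mk_matrix 2 2 (fun i j =>
    match i, j with 0%N, 0%N => a | 0%N, _ => b | _, 0%N => c | _, _ => d end).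

Definition mk21 (a b : C) : @matrix C 2 1 :=
  mk_matrix 2 1 (fun i _ => match i with 0%N => a | _ => b end).

Definition mscal (a : C) (A : mat2) : mat2 :=
  mk_matrix 2 2 (fun i j => (a * ent A i j)%C).

Definition mdet (A : mat2) : C := (ent A 0 0 * ent A 1 1 - ent A 0 1 * ent A 1 0)%C.

(* The inverse matrix, when mdet A <> 0. *)
Definition minv (A : mat2) : mat2 :=
  mscal (/ mdet A)%C (mk22 (ent A 1 1) (- ent A 0 1)%C (- ent A 1 0)%C (ent A 0 0)).

Declare Scope mat_scope.
Delimit Scope mat_scope with M.
Notation "A + B" := (@Mplus C_AbelianGroup 2 2 A B) : mat_scope.
Notation "A - B" :=
  (@Mplus C_AbelianGroup 2 2 A (@Mopp C_AbelianGroup 2 2 B)) : mat_scope.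
Notation "A * B" := (@Mmult C_Ring 2 2 2 A B) : mat_scope.

(* F 1 + ... + F m *)
Definition msum (F : nat -> mat2) (m : nat) : mat2 :=
  \big[@Mplus C_AbelianGroup 2 2/@Mzero C_AbelianGroup 2 2]_(1 <= k < m.+1) F k.

Definition mnorm (A : mat2) : R :=
  Rmax (Rmax (Cmod (ent A 0 0)) (Cmod (ent A 0 1)))
       (Rmax (Cmod (ent A 1 0)) (Cmod (ent A 1 1))).

(* V is the value at (t,xi), relative to Z_P, of d_z F, where
   d_z = <<xi>>^{-1} d_t at fixed xi. *)
Definition is_dz d (T : R) (l : 'I_d -> R) (rho : R)
    (F : R -> vec d -> mat2) (t : R) (xi : vec d) (V : mat2) : Prop :=
  forall i j : nat, (i < 2)%N -> (j < 2)%N ->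
    is_derive_within (fun s => ZP T l rho s xi) (fun s => ent (F s xi) i j) t
      (RtoC (djbr l xi) * ent V i j)%C.

Definition continuous_on_ZP d (T : R) (l : 'I_d -> R) (rho : R)
    (f : R -> vec d -> mat2) : Prop :=
  forall t xi, ZP T l rho t xi ->
  forall i j : nat, (i < 2)%N -> (j < 2)%N ->
    filterlim (fun p : R * vec d => ent (f p.1 p.2) i j)
      (within (fun p : R * vec d => ZP T l rho p.1 p.2) (locally (t, xi)))
      (locally (ent (f t xi) i j)).

(* The class S_*^q(Z_P).  [F k] is (z d_z)^k f; its existence for all k is the
   smoothness of f in t, as z d_z = t d_t at fixed xi and t > 0. *)
Definition symbol d (T : R) (l : 'I_d -> R) (rho q : R)
    (f : R -> vec d -> mat2) : Prop :=
  continuous_on_ZP T l rho f /\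
  exists F : nat -> R -> vec d -> mat2, exists p : nat,
    (forall t xi, ZP T l rho t xi -> F 0%N t xi = f t xi) /\
    (forall k t xi, ZP T l rho t xi ->
       exists V : mat2, is_dz T l rho (F k) t xi V /\
         F k.+1 t xi = mscal (RtoC (zvar l t xi)) V) /\
    (forall k, exists Ck : R, forall t xi, ZP T l rho t xi ->
       mnorm (F k t xi) <=
         Ck * Rpower (zvar l t xi) q * (1 + Rabs (ln (zvar l t xi))) ^ p).

Definition A_P d (l : 'I_d -> R) (c : 'I_d -> C) (g : C) (t : R) (xi : vec d) : mat2 :=
  mk22 (RtoC (- / t)) (RtoC (/ t))
       (- (RtoC (t * Hsq l t xi)) - Ci * RtoC t * Cfr l c t xi)%C
       (- g * RtoC (/ t))%C.

Definition M_P (g : C) : mat2 := mk22 (g - RtoC 1)%C (RtoC 1) (RtoC 0) (RtoC 1).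

Definition B_P (g : C) : mat2 := mk22 (RtoC (-1)) (RtoC 0) (RtoC 0) (- g)%C.

Definition R_P d (l : 'I_d -> R) (c : 'I_d -> C) (g : C) (t : R) (xi : vec d) : mat2 :=
  mscal (RtoC (/ djbr l xi))
    (M_P g * A_P l c g t xi * minv (M_P g) - mscal (RtoC (/ t)) (B_P g))%M.

Definition Q_P d (N : nat -> R -> vec d -> mat2) (m : nat) (t : R) (xi : vec d) : mat2 :=
  (@Mone C_Ring 2 + msum (fun k => N k t xi) m)%M.

(* The sequences N_P^(m), D_P^(m), R_P^(m), m >= 1, on Z_P; their values at
   m = 0 are not used. *)
Definition diagonalizer d (T : R) (l : 'I_d.+1 -> R) (c : 'I_d.+1 -> C) (g : C)
    (rho : R) (N D Rem : nat -> R -> vec d.+1 -> mat2) : Prop :=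
  forall m : nat, (1 <= m)%N ->
    let a := lmin l in
    symbol T l rho (INR m * (a + 1) - 1) (D m) /\
    (forall t xi, ZP T l rho t xi ->
       ent (D m t xi) 0 1 = RtoC 0 /\ ent (D m t xi) 1 0 = RtoC 0) /\
    symbol T l rho (INR m * (a + 1)) (N m) /\
    symbol T l rho (INR m * (a + 1) + a) (Rem m) /\
    forall t xi, ZP T l rho t xi ->
      let zB := mscal (RtoC (/ zvar l t xi)) (B_P g) in
      let Q := Q_P N m t xi in
      exists dN : nat -> mat2,
        (forall k, (1 <= k <= m)%N -> is_dz T l rho (N k) t xi (dN k)) /\
        Rem m t xi =
          (msum dN m + Q * (zB + R_P l c g t xi)
             - (zB + msum (fun k => D k t xi) m) * Q)%M.

(* The column vector defining (phi_+, phi_-) when g <> 1. *)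
Definition varphi_col d (g : C) (N : nat -> R -> vec d -> mat2) (mP : nat)
    (phi dphi : R -> vec d -> C) (t : R) (xi : vec d) : @matrix C 2 1 :=
  @Mmult C_Ring 2 2 1
    (mk22 (RtoC t) (RtoC 0) (RtoC 0) (Rcpow t g) * Q_P N mP t xi)%M
    (mk21 ((g - RtoC 1) * RtoC (/ t) * phi t xi + dphi t xi)%C (dphi t xi)).

Definition varphi_p d (g : C) (N : nat -> R -> vec d -> mat2) (mP : nat)
    (phi dphi : R -> vec d -> C) (t : R) (xi : vec d) : C :=
  if Ceq_dec g (RtoC 1) then phi t xi
  else ent (varphi_col g N mP phi dphi t xi) 0 0.

Definition varphi_m d (g : C) (N : nat -> R -> vec d -> mat2) (mP : nat)
    (phi dphi : R -> vec d -> C) (t : R) (xi : vec d) : C :=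
  if Ceq_dec g (RtoC 1) then (RtoC t * dphi t xi)%C
  else ent (varphi_col g N mP phi dphi t xi) 1 0.

(* [php0] and [phm0] are the asymptotic data of the solution at t = 0; the
   limits tau -> 0+ are taken within Z_P at fixed xi. *)
Definition asymptotic_data d (T : R) (l : 'I_d -> R) (g : C) (rho0 : R)
    (N : nat -> R -> vec d -> mat2) (mP : nat)
    (phi dphi : R -> vec d -> C) (php0 phm0 : vec d -> C) : Prop :=
  forall xi : vec d,
    let near0 := within (fun tau => ZP T l rho0 tau xi) (at_right 0) in
    let php tau := varphi_p g N mP phi dphi tau xi in
    let phm tau := varphi_m g N mP phi dphi tau xi in
    (g <> RtoC 1 -> filterlim php near0 (locally (php0 xi))) /\
    (g = RtoC 1 ->
       filterlim (fun tau => php tau - RtoC (ln (zvar l tau xi)) * phm tau)%C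
         near0 (locally (php0 xi))) /\
    filterlim phm near0 (locally (phm0 xi)).

Definition norm_at_T d (xi : vec d) (u v : C) : R :=
  Rpower (vjbr xi) (1 / 2) * Cmod u + Rpower (vjbr xi) (- (1 / 2)) * Cmod v.

Definition norm_at_0 d (l : 'I_d -> R) (g : C) (xi : vec d) (u v : C) : R :=
  Rpower (djbr l xi) ((1 - Re g) / 2) * Cmod u
  + Rpower (djbr l xi) ((Re g - 1) / 2) * Cmod v.

Definition loss d (l : 'I_d -> R) (c : 'I_d -> C) (xi : vec d) : R :=
  Rpower (djbr l xi) (cvnorm c / 2).

(* Main.v *)
Require Import Defs.
From Stdlib Require Import Reals Lra Psatz ClassicalEpsilon.
From mathcomp Require Import all_boot.
From Coquelicot Require Import Coquelicot.

(** In the scaled time [z = <<xi>> t] the equation (K) keeps its form while the covector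
    becomes [eta_i = <<xi>> ^ (- (l_i + 1)) xi_i], a point of the unit cube.  With
    [s = ln z], [Y1 = phi] and [Y2 = t dphi/dt] it reads
    [Y1' = Y2], [Y2' = (1 - g) Y2 - q Y1], where [q] is a sum of exponentials
    [exp (2 (l_i + 1) s)], [exp ((l_i + 1) s)] with coefficients bounded in terms of [eta].
    Everything is compared, uniformly in [xi], with the Cauchy data at one fixed time
    [s = ln rho2].

    Towards minus infinity ([integrable_limits]): the pair [psi] formed by [phi_+] and
    [<<xi>> ^ (g - 1) phi_-] (for [g = 1], by [Y1 - s Y2] and [Y2]) satisfies
    [|psi'| <= K exp (del s) |psi|] with [del > 0].  Hence its norm varies by a bounded
    factor and it converges.  For [g <> 1] this is the purpose of the diagonalization: the
    remainder of order [m] beats the relative growth [z ^ (+- (Re g - 1))] of the two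
    components once [m (l_* + 1) >= |Re g - 1|] ([asymptotic_map_nonresonant],
    [diagonalizer_asymptotic_map]).

    Towards the final time [s = ln <<xi>> + ln T] ([energy_estimate], [final_time]): with
    [k ^ 2 = t ^ 2 H ^ 2], the energy
    [exp ((Re g - 1) s) (k |Y1|^2 + |Y2|^2 / k + ((kap + Re g - 1) / k) Re (Y1 conj Y2))],
    where [kap = k' / k], has logarithmic derivative at most [|c| + O (1 / k)] in absolute
    value: Cauchy-Schwarz gives [t^2 |C| <= |c| k], and the cross term cancels the remaining
    contributions of order one.  As [k] grows exponentially, [1 / k] is integrable, and
    over a length [ln <<xi>>] the squared norms lose the factor [<<xi>> ^ |c|].

    Both comparisons hold in the two directions, so they give both estimates of the
    theorem.  They also show that the linear map from the Cauchy data at [ln rho2] to the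
    asymptotic data is injective, hence bijective on a two-dimensional space; this yields
    existence and uniqueness in the scattering problem ([scattering_exists],
    [scattering_unique]).  Solutions exist globally because the system in [s] is linear
    with continuous coefficients on the whole line ([linear_ode_exists]). *)

Open Scope R_scope.

(** * Gronwall inequalities *)

Lemma Rderive_ext (f g : R -> R) (t v : R) :
  (forall s, f s = g s) -> is_derive f t v -> is_derive g t v.
Proof. exact: is_derive_ext. Qed.

Lemma Rderive_eq (f : R -> R) (t v w : R) : is_derive f t v -> v = w -> is_derive f t w.
Proof. by move=> h <-. Qed.

Lemma Rexp_le (x y : R) : x <= y -> exp x <= exp y.
Proof. by move=> [h|->]; [exact/Rlt_le/exp_increasing | exact: Rle_refl]. Qed.

Lemma nondecreasing_of_derive (f df : R -> R) (a b : R) :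
  a <= b -> (forall s, a <= s <= b -> is_derive f s (df s)) ->
  (forall s, a <= s <= b -> 0 <= df s) -> f a <= f b.
Proof.
move=> hab hf hdf.
have [|x hx|c [hc E]] := @MVT_gen f a b df.
- move=> x; rewrite Rmin_left // Rmax_right // => hx; apply: hf; lra.
- move: hx; rewrite Rmin_left // Rmax_right // => hx.
  apply/continuity_pt_filterlim/ex_derive_continuous.
  by exists (df x); apply: hf.
- move: hc; rewrite Rmin_left // Rmax_right // => hc.
  have := hdf c hc; nra.
Qed.

(** Both Gronwall inequalities take the weight [w] through its derivative rather than
    as an integral: in every use below an explicit antiderivative is at hand. *)
Lemma gronwall_le (f df w dw : R -> R) (a b : R) :
  a <= b -> (forall s, a <= s <= b -> is_derive f s (df s)) ->
  (forall s, a <= s <= b -> is_derive w s (dw s)) ->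
  (forall s, a <= s <= b -> df s <= dw s * f s) ->
  f b <= exp (w b - w a) * f a.
Proof.
move=> hab hf hw hle.
have key : - (f a * exp (- w a)) <= - (f b * exp (- w b)).
  apply: (nondecreasing_of_derive (fun s => - (f s * exp (- w s)))
    (fun s => exp (- w s) * (dw s * f s - df s))) => // s hs.
    auto_derive.
      by repeat split; [exists (df s); exact: hf | exists (dw s); exact: hw].
    rewrite (is_derive_unique _ _ _ (hf s hs)) (is_derive_unique _ _ _ (hw s hs)).
    ring.
  have := exp_pos (- w s); have := hle s hs; nra.
have e1 : exp (w b) * exp (- w b) = 1 by rewrite -exp_plus Rplus_opp_r exp_0.
have -> : exp (w b - w a) = exp (w b) * exp (- w a) by rewrite -exp_plus.
have -> : f b = exp (w b) * (f b * exp (- w b)).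
  by rewrite (Rmult_comm (f b)) -Rmult_assoc e1 Rmult_1_l.
rewrite Rmult_assoc (Rmult_comm _ (f a)).
apply: Rmult_le_compat_l; [exact/Rlt_le/exp_pos | lra].
Qed.

Lemma gronwall_ge (f df w dw : R -> R) (a b : R) :
  a <= b -> (forall s, a <= s <= b -> is_derive f s (df s)) ->
  (forall s, a <= s <= b -> is_derive w s (dw s)) ->
  (forall s, a <= s <= b -> - (dw s * f s) <= df s) ->
  f a <= exp (w b - w a) * f b.
Proof.
move=> hab hf hw hle.
have := gronwall_le (fun s => - f s) (fun s => - df s) (fun s => - w s)
  (fun s => - dw s) a b hab.
have -> : - w b - - w a = - (w b - w a) by ring.
move=> H.
have {}H : - f b <= exp (- (w b - w a)) * - f a.
  apply: H => s hs.
  - exact/(@is_derive_opp R_AbsRing R_NormedModule)/hf.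
  - exact/(@is_derive_opp R_AbsRing R_NormedModule)/hw.
  - have := hle s hs; lra.
have e1 : exp (w b - w a) * exp (- (w b - w a)) = 1.
  by rewrite -exp_plus Rplus_opp_r exp_0.
have := Rmult_le_compat_l _ _ _ (Rlt_le _ _ (exp_pos (w b - w a))) H.
rewrite -Rmult_assoc e1; lra.
Qed.

Lemma variation_le (f df G dG : R -> R) (a b : R) :
  a <= b -> (forall s, a <= s <= b -> is_derive f s (df s)) ->
  (forall s, a <= s <= b -> is_derive G s (dG s)) ->
  (forall s, a <= s <= b -> Rabs (df s) <= dG s) ->
  Rabs (f b - f a) <= G b - G a.
Proof.
move=> hab hf hG hle.
have h1 : G a - f a <= G b - f b.
  apply: (nondecreasing_of_derive (fun s => G s - f s) (fun s => dG s - df s)) => // s hs.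
    exact: (@is_derive_minus R_AbsRing R_NormedModule _ _ _ _ _ (hG s hs) (hf s hs)).
  have := Rle_abs (df s); have := hle s hs; lra.
have h2 : G a + f a <= G b + f b.
  apply: (nondecreasing_of_derive (fun s => G s + f s) (fun s => dG s + df s)) => // s hs.
    exact: (@is_derive_plus R_AbsRing R_NormedModule _ _ _ _ _ (hG s hs) (hf s hs)).
  have := Rle_abs (- df s); rewrite Rabs_Ropp; have := hle s hs; lra.
apply: Rabs_le; lra.
Qed.

(** * Complex-valued functions of a real variable *)

(** Encoded by components, so that the calculus of real functions applies; unlike
    [is_derive_within] it is two-sided. *)
Definition Cder (f : R -> C) (t : R) (v : C) : Prop :=
  is_derive (fun s => Re (f s)) t (Re v) /\ is_derive (fun s => Im (f s)) t (Im v).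

Lemma Cder_eq f t v w : Cder f t v -> v = w -> Cder f t w.
Proof. by move=> h <-. Qed.

Lemma Cder_ext f g t v : (forall s, f s = g s) -> Cder f t v -> Cder g t v.
Proof.
by move=> e [h1 h2]; split; [move: h1|move: h2]; apply: is_derive_ext => s; rewrite e.
Qed.

Lemma Cder_const z t : Cder (fun _ => z) t (RtoC 0).
Proof. by split; exact: is_derive_const. Qed.

Lemma Cder_RtoC f t v : is_derive f t v -> Cder (fun s => RtoC (f s)) t (RtoC v).
Proof. by move=> h; split=> //; exact: is_derive_const. Qed.

Lemma Cder_plus f g t v w :
  Cder f t v -> Cder g t w -> Cder (fun s => f s + g s)%C t (v + w)%C.
Proof.
move=> [f1 f2] [g1 g2]; split.
  exact: (@is_derive_plus R_AbsRing R_NormedModule _ _ _ _ _ f1 g1).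
exact: (@is_derive_plus R_AbsRing R_NormedModule _ _ _ _ _ f2 g2).
Qed.

Lemma Rderive_mult f g t v w :
  is_derive f t v -> is_derive g t w ->
  is_derive (fun s => f s * g s) t (v * g t + f t * w).
Proof. by move=> hf hg; exact: (is_derive_mult f g t v w hf hg Rmult_comm). Qed.

Lemma Cder_mult f g t v w :
  Cder f t v -> Cder g t w ->
  Cder (fun s => f s * g s)%C t (v * g t + f t * w)%C.
Proof.
move=> [f1 f2] [g1 g2]; split.
  have h := @is_derive_minus R_AbsRing R_NormedModule _ _ _ _ _
    (Rderive_mult _ _ _ _ _ f1 g1) (Rderive_mult _ _ _ _ _ f2 g2).
  have -> : Re (v * g t + f t * w)%C = minus (Re v * Re (g t) + Re (f t) * Re w)
      (Im v * Im (g t) + Im (f t) * Im w).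
    by rewrite /minus /plus /opp /Re /Im /=; ring.
  exact: h.
have h := @is_derive_plus R_AbsRing R_NormedModule _ _ _ _ _
  (Rderive_mult _ _ _ _ _ f1 g2) (Rderive_mult _ _ _ _ _ f2 g1).
have -> : Im (v * g t + f t * w)%C = plus (Re v * Im (g t) + Re (f t) * Im w)
    (Im v * Re (g t) + Im (f t) * Re w).
  by rewrite /plus /Re /Im /=; ring.
exact: h.
Qed.

Lemma Cder_scal z f t v : Cder f t v -> Cder (fun s => z * f s)%C t (z * v)%C.
Proof.
by move=> h; apply: (Cder_eq _ _ _ _ (Cder_mult _ _ _ _ _ (Cder_const z t) h)); ring.
Qed.

Lemma Cder_opp f t v : Cder f t v -> Cder (fun s => - f s)%C t (- v)%C.
Proof.
by move=> [h1 h2]; split; [exact: (is_derive_opp _ _ _ h1)|exact: (is_derive_opp _ _ _ h2)].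
Qed.

Lemma Cder_comp f g t v w :
  Cder f (g t) v -> is_derive g t w -> Cder (fun s => f (g s)) t (RtoC w * v)%C.
Proof.
move=> [f1 f2] hg; split.
  have -> : Re (RtoC w * v)%C = scal w (Re v).
    by change (w * Re v - 0 * Im v = w * Re v); ring.
  exact: (is_derive_comp _ _ _ _ _ f1 hg).
have -> : Im (RtoC w * v)%C = scal w (Im v).
  by change (w * Im v + 0 * Re v = w * Im v); ring.
exact: (is_derive_comp _ _ _ _ _ f2 hg).
Qed.

Lemma Cder_continuous f t v : Cder f t v -> filterlim f (locally t) (locally (f t)).
Proof.
move=> [h1 h2].
have c1 : filterlim (fun s => Re (f s)) (locally t) (locally (Re (f t))).
  by apply: ex_derive_continuous; exists (Re v).
have c2 : filterlim (fun s => Im (f s)) (locally t) (locally (Im (f t))).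
  by apply: ex_derive_continuous; exists (Im v).
apply/filterlim_locally => eps.
move/filterlim_locally/(_ eps): c1 => c1; move/filterlim_locally/(_ eps): c2 => c2.
by apply: filter_imp (filter_and _ _ c1 c2) => s [] ? ?; split.
Qed.

Lemma Cder_nsq f t v : Cder f t v ->
  is_derive (fun s => Cmod (f s) ^ 2) t (2 * (Re (f t) * Re v + Im (f t) * Im v)).
Proof.
move=> [h1 h2].
apply: (Rderive_ext (fun s => Re (f s) * Re (f s) + Im (f s) * Im (f s))).
  by move=> s; rewrite Cmod2_alt; ring.
have h := @is_derive_plus R_AbsRing R_NormedModule _ _ _ _ _
  (Rderive_mult _ _ _ _ _ h1 h1) (Rderive_mult _ _ _ _ _ h2 h2).
have -> : 2 * (Re (f t) * Re v + Im (f t) * Im v) =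
   plus (Re v * Re (f t) + Re (f t) * Re v) (Im v * Im (f t) + Im (f t) * Im v).
  by rewrite /plus /Re /Im /=; ring.
exact: h.
Qed.

Lemma Re_inner_le (z w : C) : Rabs (Re z * Re w + Im z * Im w) <= Cmod z * Cmod w.
Proof.
have -> : Re z * Re w + Im z * Im w = Re (z * Cconj w)%C.
  by rewrite /Re /Im /=; ring.
by apply: Rle_trans (re_le_Cmod _) _; rewrite Cmod_mult Cmod_conj; lra.
Qed.

Lemma Cvariation_le (f df : R -> C) (G dG : R -> R) (a b : R) :
  a <= b -> (forall s, a <= s <= b -> Cder f s (df s)) ->
  (forall s, a <= s <= b -> is_derive G s (dG s)) ->
  (forall s, a <= s <= b -> Cmod (df s) <= dG s) ->
  Rabs (Re (f b) - Re (f a)) <= G b - G a /\ Rabs (Im (f b) - Im (f a)) <= G b - G a.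
Proof.
move=> hab hf hG hle; split.
  apply: (variation_le (fun s => Re (f s)) (fun s => Re (df s)) G dG) => // s hs.
    by have [] := hf s hs.
  by apply: Rle_trans (re_le_Cmod _) (hle s hs).
apply: (variation_le (fun s => Im (f s)) (fun s => Im (df s)) G dG) => // s hs.
  by have [] := hf s hs.
apply: Rle_trans (hle s hs).
by apply: Rle_trans (Rmax_Cmod (df s)); exact: Rmax_r.
Qed.

(** * Finite sums and maxima of reals *)

Lemma Rsum_le (I : finType) (F G : I -> R) :
  (forall i, F i <= G i) -> \big[Rplus/0]_i F i <= \big[Rplus/0]_i G i.
Proof.
move=> h; apply: (big_ind2 Rle) => //; first exact: Rle_refl.
by move=> *; apply: Rplus_le_compat.
Qed.

Lemma Rsum_ge0 (I : finType) (F : I -> R) :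
  (forall i, 0 <= F i) -> 0 <= \big[Rplus/0]_i F i.
Proof.
move=> h; apply: (big_ind (Rle 0)) => //; first exact: Rle_refl.
by move=> *; apply: Rplus_le_le_0_compat.
Qed.

Lemma Rsum_scal (I : finType) (F : I -> R) (a : R) :
  \big[Rplus/0]_i (a * F i) = a * \big[Rplus/0]_i F i.
Proof.
rewrite (big_morph (Rmult a) (id1 := 0) (op1 := Rplus)) //.
  by move=> x y; rewrite Rmult_plus_distr_l.
by rewrite Rmult_0_r.
Qed.

Lemma Rsum_minus (I : finType) (F G : I -> R) :
  \big[Rplus/0]_i F i - \big[Rplus/0]_i G i = \big[Rplus/0]_i (F i - G i).
Proof.
apply: (big_rec3 (fun x y z => x - y = z)); first by lra.
by move=> i x y z _ <-; ring.
Qed.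

Lemma Rsum_abs (I : finType) (F : I -> R) :
  Rabs (\big[Rplus/0]_i F i) <= \big[Rplus/0]_i Rabs (F i).
Proof.
apply: (big_ind2 (fun x y => Rabs x <= y)).
- by rewrite Rabs_R0; exact: Rle_refl.
- by move=> x y u v h1 h2; apply: Rle_trans (Rabs_triang _ _) _; lra.
- by move=> i _; exact: Rle_refl.
Qed.

Lemma Rsum_term_le (I : finType) (F : I -> R) (i : I) :
  (forall j, 0 <= F j) -> F i <= \big[Rplus/0]_j F j.
Proof.
move=> h; have : i \in index_enum I by rewrite mem_index_enum.
elim: (index_enum I) => [//|k r IH]; rewrite big_cons in_cons => /orP [/eqP <-|hi].
  suff : 0 <= \big[Rplus/0]_(j <- r) F j by lra.
  apply: (big_ind (Rle 0)) => //; first exact: Rle_refl.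
  by move=> *; apply: Rplus_le_le_0_compat.
by have := h k; have := IH hi; lra.
Qed.

Lemma Rmax_term_le (I : finType) (F : I -> R) (i : I) :
  F i <= \big[Rmax/0]_j F j.
Proof.
have : i \in index_enum I by rewrite mem_index_enum.
elim: (index_enum I) => [//|k r IH]; rewrite big_cons in_cons => /orP [/eqP <-|hi].
  exact: Rmax_l.
by apply: Rle_trans (IH hi) (Rmax_r _ _).
Qed.

Lemma choose_function (A B : Type) (P : A -> B -> Prop) :
  (forall x, exists y, P x y) -> exists f, forall x, P x (f x).
Proof.
move=> h; exists (fun x => proj1_sig (constructive_indefinite_description _ (h x))) => x.
exact: proj2_sig (constructive_indefinite_description _ (h x)).
Qed.

Lemma finite_bound (I : finType) (P : I -> R -> Prop) :
  (forall i x y, x <= y -> P i x -> P i y) -> (forall i, exists x, P i x) ->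
  exists x, 0 < x /\ forall i, P i x.
Proof.
move=> mono ex.
have [F hF] := choose_function _ _ _ ex.
exists (Rmax 1 (\big[Rmax/0]_i F i)); split.
  by apply: Rlt_le_trans (Rmax_l _ _); lra.
move=> i; apply: mono (hF i).
exact: Rle_trans (Rmax_term_le _ F i) (Rmax_r _ _).
Qed.

Lemma Rsum_derive (I : finType) (F dF : I -> R -> R) (s : R) :
  (forall i, is_derive (F i) s (dF i s)) ->
  is_derive (fun x => \big[Rplus/0]_i F i x) s (\big[Rplus/0]_i dF i s).
Proof.
move=> h; elim: (index_enum I) => [|k r IH].
  rewrite big_nil; apply: (Rderive_ext (fun _ => 0)) => [x|]; first by rewrite big_nil.
  exact: is_derive_const.
rewrite big_cons.
apply: (Rderive_ext (fun x => F k x + \big[Rplus/0]_(i <- r) F i x)) => [x|].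
  by rewrite big_cons.
exact: (@is_derive_plus R_AbsRing R_NormedModule _ _ _ _ _ (h k) IH).
Qed.

Lemma Rsum_continuous (I : finType) (F : I -> R -> R) (s : R) :
  (forall i, continuous (F i) s) ->
  continuous (fun x => \big[Rplus/0]_i F i x) s.
Proof.
move=> h; elim: (index_enum I) => [|k r IH].
  apply: (continuous_ext (fun _ => 0)) => [x|]; first by rewrite big_nil.
  exact: continuous_const.
apply: (continuous_ext (fun x => F k x + \big[Rplus/0]_(i <- r) F i x)) => [x|].
  by rewrite big_cons.
exact: (@continuous_plus R_UniformSpace R_AbsRing R_NormedModule).
Qed.

Lemma Rsum_lim_seq (I : finType) (u : I -> nat -> R) (v : I -> R) :
  (forall i, is_lim_seq (u i) (v i)) ->
  is_lim_seq (fun n => \big[Rplus/0]_i u i n) (\big[Rplus/0]_i v i).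
Proof.
move=> h; elim: (index_enum I) => [|k r IH].
  rewrite big_nil; apply: (is_lim_seq_ext (fun _ => 0)) => [n|]; first by rewrite big_nil.
  exact: is_lim_seq_const.
rewrite big_cons.
apply: (is_lim_seq_ext (fun n => u k n + \big[Rplus/0]_(i <- r) u i n)) => [n|].
  by rewrite big_cons.
exact: is_lim_seq_plus' (h k) IH.
Qed.

Lemma continuous_bounded (f : R -> R) (a b : R) :
  a <= b -> (forall s, continuous f s) ->
  exists M, forall s, a <= s <= b -> Rabs (f s) <= M.
Proof.
move=> hab hf.
have [|x [hx _]] := continuity_ab_maj (fun s => Rabs (f s)) a b hab.
  move=> c _; apply/continuity_pt_filterlim.
  by apply: (continuous_comp f Rabs); [exact: hf | exact: continuous_Rabs].
by exists (Rabs (f x)).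
Qed.

(** * Global existence for linear systems *)

Lemma geometric_cauchy (u : nat -> R) (M : R) (m k : nat) :
  (forall n, Rabs (u n.+1 - u n) <= M * (/ 2) ^ n) ->
  Rabs (u (m + k)%N - u m) <= 2 * M * (/ 2) ^ m.
Proof.
move=> h.
have h2 n : 0 < (/ 2) ^ n by apply: pow_lt; lra.
have hM : 0 <= M by have := h 0%N; have := Rabs_pos (u 1%N - u 0%N); simpl; lra.
suff : Rabs (u (m + k)%N - u m) <= 2 * M * ((/ 2) ^ m - (/ 2) ^ (m + k)).
  by have := h2 (m + k)%N; nra.
elim: k => [|k IH]; first by rewrite addn0 !Rminus_diag Rabs_R0; lra.
rewrite addnS.
have -> : u (m + k).+1 - u m = (u (m + k).+1 - u (m + k)%N) + (u (m + k)%N - u m) by ring.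
apply: Rle_trans (Rabs_triang _ _) _.
have := h (m + k)%N; simpl; lra.
Qed.

Lemma geometric_CVU (f : nat -> R -> R) (D : R -> Prop) (M : R) :
  (forall n x, D x -> Rabs (f n.+1 x - f n x) <= M * (/ 2) ^ n) ->
  CVU_dom f D.
Proof.
move=> h; apply/CVU_dom_cauchy => eps.
have [hM|hM] := Rle_lt_dec M 0.
  exists 0%N => n m x hx _ _.
  have z j : f j x = f 0%N x.
    elim: j => [//|j <-]; have := h j x hx.
    have : 0 < (/ 2) ^ j by apply: pow_lt; lra.
    have := Rabs_pos (f j.+1 x - f j x) => h1 h2 h3.
    have : Rabs (f j.+1 x - f j x) <= 0 by nra.
    by move/Rabs_le_between => ?; lra.
  by rewrite (z n) (z m) Rminus_diag Rabs_R0; case: eps.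
have [] := pow_lt_1_zero (/ 2) _ (eps / (4 * M)).
- by rewrite Rabs_pos_eq; lra.
- by apply: Rdiv_lt_0_compat; [case: eps | lra].
move=> n0 hn0; exists n0 => n m x hx hn hm.
have key j : (n0 <= j)%coq_nat -> Rabs (f j x - f n0 x) <= 2 * M * (/ 2) ^ n0.
  move=> hj; have -> : j = (n0 + (j - n0))%N by rewrite subnKC //; apply/leP.
  by apply: (geometric_cauchy (fun k => f k x)) => k; exact: h.
have := hn0 n0 (le_n _); rewrite Rabs_pos_eq; last by apply: pow_le; lra.
move/(Rmult_lt_compat_r (4 * M) _ _ ltac:(lra)).
have -> : eps / (4 * M) * (4 * M) = eps by field; lra.
have -> : f n x - f m x = (f n x - f n0 x) - (f m x - f n0 x) by ring.
have := key n hn; have := key m hm; move=> /Rabs_le_between ? /Rabs_le_between ? ?.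
apply: Rabs_def1; lra.
Qed.

Lemma CVU_dom_lim_seq (f : nat -> R -> R) (D : R -> Prop) (x : R) :
  CVU_dom f D -> D x -> is_lim_seq (fun n => f n x) (real (Lim_seq (fun n => f n x))).
Proof.
move=> h hx; apply/is_lim_seq_spec => eps.
by have [n0 hn0] := h eps; exists n0 => n hn; exact: hn0.
Qed.

(** The iteration starts from [0] instead of the constant [y0], so that the first
    increment is [y0] itself and obeys the same geometric bound as the others. *)
Fixpoint picard (n : nat) (A : 'I_n -> 'I_n -> R -> R) (y0 : 'I_n -> R) (s0 : R)
    (m : nat) (i : 'I_n) (s : R) : R :=
  if m is m'.+1 then
    y0 i + RInt (fun x => \big[Rplus/0]_j (A i j x * picard n A y0 s0 m' j x)) s0 s
  else 0.

Lemma picard_derive (n : nat) (A : 'I_n -> 'I_n -> R -> R) (y0 : 'I_n -> R) (s0 : R) :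
  (forall i j s, continuous (A i j) s) -> forall m i s,
  is_derive (picard n A y0 s0 m.+1 i) s
    (\big[Rplus/0]_j (A i j s * picard n A y0 s0 m j s)).
Proof.
move=> hA.
have step m : (forall j s, continuous (picard n A y0 s0 m j) s) -> forall i s,
    is_derive (picard n A y0 s0 m.+1 i) s
      (\big[Rplus/0]_j (A i j s * picard n A y0 s0 m j s)).
  move=> hc i s.
  have hcc x : continuous (fun x => \big[Rplus/0]_j (A i j x * picard n A y0 s0 m j x)) x.
    apply: Rsum_continuous => j.
    exact: (@continuous_mult R_UniformSpace R_AbsRing _ _ _ (hA i j x) (hc j x)).
  have := @is_derive_plus R_AbsRing R_NormedModule (fun _ => y0 i) _ s _ _
    (is_derive_const _ _)
    (@is_derive_RInt R_NormedModule _ (RInt _ s0) s0 s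
      (filter_forall _ (fun b => RInt_correct _ _ _ (ex_RInt_continuous _ _ _ (fun z _ => hcc z))))
      (hcc s)).
  by rewrite plus_zero_l => H; apply: H; exact: locally_filter.
move=> m; apply: (step m); elim: m => [|m IH] j s.
  exact: continuous_const.
by apply: ex_derive_continuous; eexists; exact: step IH j s.
Qed.

Lemma picard_init (n : nat) (A : 'I_n -> 'I_n -> R -> R) (y0 : 'I_n -> R) (s0 : R) m i :
  picard n A y0 s0 m.+1 i s0 = y0 i.
Proof. by rewrite /= RInt_point /zero /= Rplus_0_r. Qed.

(** The even weight [exp (2 K x) + exp (- 2 K x)] has an antiderivative bounded by
    [1 / (2 K)] times itself, so each Picard step halves the distance between
    successive iterates on both sides of the initial time. *)
Lemma picard_contract (n : nat) (A : 'I_n -> 'I_n -> R -> R) (y0 : 'I_n -> R) (s0 r : R) :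
  (forall i j s, continuous (A i j) s) -> 0 < r ->
  exists M K : R, 0 < K /\
    (forall i s, Rabs (s - s0) <= r -> \big[Rplus/0]_j Rabs (A i j s) <= K) /\
    forall m i s, Rabs (s - s0) <= r ->
      Rabs (picard n A y0 s0 m.+1 i s - picard n A y0 s0 m i s) <= M * (/ 2) ^ m.
Proof.
move=> hA hr.
have [K [hK bK]] : exists K, 0 < K /\ forall i s, Rabs (s - s0) <= r ->
    \big[Rplus/0]_j Rabs (A i j s) <= K.
  apply: (finite_bound _ (fun i K => forall s, Rabs (s - s0) <= r ->
    \big[Rplus/0]_j Rabs (A i j s) <= K)).
    by move=> i x y hxy h s hs; apply: Rle_trans hxy; exact: h.
  move=> i.
  have [||M hM] := continuous_bounded (fun s => \big[Rplus/0]_j Rabs (A i j s))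
    (s0 - r) (s0 + r); first by lra.
    move=> s; apply: Rsum_continuous => j.
    by apply: (continuous_comp (A i j) Rabs); [exact: hA | exact: continuous_Rabs].
  exists M => s /Rabs_le_between hs.
  by apply: Rle_trans (Rle_abs _) (hM s _); lra.
have [Y [hY bY]] : exists Y, 0 < Y /\ forall i, Rabs (y0 i) <= Y.
  apply: (finite_bound _ (fun i Y => Rabs (y0 i) <= Y)).
    by move=> i x y hxy h; lra.
  by move=> i; exists (Rabs (y0 i)); lra.
pose W x := exp (2 * K * (x - s0)) + exp (- (2 * K * (x - s0))).
pose V x := (exp (2 * K * (x - s0)) - exp (- (2 * K * (x - s0)))) / (2 * K).
have hV x : is_derive V x (W x).
  by rewrite /V /W /Rminus; auto_derive => //; field; lra.
have V0 : V s0 = 0 by rewrite /V Rminus_diag Rmult_0_r Ropp_0 Rminus_diag /Rdiv Rmult_0_l.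
have hVW x : Rabs (V x) <= W x / (2 * K).
  have h1 := exp_pos (2 * K * (x - s0)); have h2 := exp_pos (- (2 * K * (x - s0))).
  rewrite /V /W /Rdiv Rabs_mult (Rabs_pos_eq (/ (2 * K))); last first.
    by apply/Rlt_le/Rinv_0_lt_compat; lra.
  apply: Rmult_le_compat_r; first by apply/Rlt_le/Rinv_0_lt_compat; lra.
  by apply: Rabs_le; lra.
have hW1 x : 1 <= W x.
  rewrite /W; have h1 := exp_ineq1_le (2 * K * (x - s0)).
  have h2 := exp_ineq1_le (- (2 * K * (x - s0))); lra.
have key m i s : Rabs (s - s0) <= r ->
   Rabs (picard n A y0 s0 m.+1 i s - picard n A y0 s0 m i s) <= Y * (/ 2) ^ m * W s.
  elim: m i s => [|m IH] i s hs.
    have -> : picard n A y0 s0 1 i s - picard n A y0 s0 0 i s = y0 i.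
      rewrite /= (RInt_ext _ (fun _ => 0)); last first.
        move=> x _; apply: (big_ind (fun z => z = 0)) => [//|? ? -> ->|j _].
          exact: Rplus_0_r.
        exact: Rmult_0_r.
      rewrite RInt_const /scal /= /mult /=; ring.
    have := bY i; have := hW1 s; simpl; nra.
  pose f x := picard n A y0 s0 m.+2 i x - picard n A y0 s0 m.+1 i x.
  pose df x := \big[Rplus/0]_j (A i j x *
    (picard n A y0 s0 m.+1 j x - picard n A y0 s0 m j x)).
  have hf x : is_derive f x (df x).
    have -> : df x = \big[Rplus/0]_j (A i j x * picard n A y0 s0 m.+1 j x)
        - \big[Rplus/0]_j (A i j x * picard n A y0 s0 m j x).
      by rewrite Rsum_minus; apply: eq_bigr => j _; ring.
    exact: (@is_derive_minus R_AbsRing R_NormedModule _ _ _ _ _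
      (picard_derive n A y0 s0 hA m.+1 i x) (picard_derive n A y0 s0 hA m i x)).
  have hdf x : Rabs (x - s0) <= r -> Rabs (df x) <= K * (Y * (/ 2) ^ m) * W x.
    move=> hx; apply: Rle_trans (Rsum_abs _ _) _.
    have hm : 0 < (/ 2) ^ m by apply: pow_lt; lra.
    apply: Rle_trans (Rsum_le _ _ (fun j => (Y * (/ 2) ^ m * W x) * Rabs (A i j x)) _) _.
      move=> j; rewrite Rabs_mult Rmult_comm.
      by apply: Rmult_le_compat_r; [exact: Rabs_pos | exact: IH].
    rewrite Rsum_scal; have := bK i x hx; have := hW1 x => h1 h2.
    have : 0 <= Y * (/ 2) ^ m * W x.
      by apply: Rmult_le_pos; [nra | lra].
    nra.
  have f0 : f s0 = 0 by rewrite /f !picard_init; ring.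
  have hG x : is_derive (fun x => K * (Y * (/ 2) ^ m) * V x) x (K * (Y * (/ 2) ^ m) * W x).
    exact: is_derive_scal.
  have hm : 0 < (/ 2) ^ m by apply: pow_lt; lra.
  have hc : 0 <= K * (Y * (/ 2) ^ m) by apply: Rmult_le_pos; nra.
  have hfs : Rabs (f s) <= K * (Y * (/ 2) ^ m) * Rabs (V s).
    move/Rabs_le_between: hs => hs.
    have [h|h] := Rle_lt_dec s0 s.
      have [] := Rabs_le_between (f s) (K * (Y * (/ 2) ^ m) * V s) => _ _.
      have := variation_le f df _ _ s0 s h (fun x _ => hf x) (fun x _ => hG x).
      rewrite f0 V0 Rminus_0_r => H.
      apply: Rle_trans (H _) _.
        by move=> x hx; apply: hdf; apply: Rabs_le; lra.
      by have := Rle_abs (V s); nra.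
    have := variation_le f df _ _ s s0 (Rlt_le _ _ h) (fun x _ => hf x) (fun x _ => hG x).
    rewrite f0 V0 Rminus_0_l Rabs_Ropp => H.
    apply: Rle_trans (H _) _.
      by move=> x hx; apply: hdf; apply: Rabs_le; lra.
    have := Rle_abs (- V s); rewrite Rabs_Ropp; nra.
  apply: Rle_trans hfs _.
  apply: Rle_trans (Rmult_le_compat_l _ _ _ hc (hVW s)) _.
  by right; rewrite /=; field; lra.
exists (Y * (2 * exp (2 * K * r))), K; split=> //; split=> // m i s hs.
apply: Rle_trans (key m i s hs) _.
have -> : Y * (2 * exp (2 * K * r)) * (/ 2) ^ m = Y * (/ 2) ^ m * (2 * exp (2 * K * r)).
  by ring.
apply: Rmult_le_compat_l.
  by apply: Rmult_le_pos; [lra | apply: pow_le; lra].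
move/Rabs_le_between: hs => hs.
have h1 : exp (2 * K * (s - s0)) <= exp (2 * K * r) by apply: Rexp_le; nra.
have h2 : exp (- (2 * K * (s - s0))) <= exp (2 * K * r) by apply: Rexp_le; nra.
by rewrite /W; lra.
Qed.

(** On each bounded interval the iterates and their derivatives converge uniformly, so
    the pointwise limit, which does not depend on the interval, solves the system. *)
Lemma linear_ode_exists (n : nat) (A : 'I_n -> 'I_n -> R -> R) (y0 : 'I_n -> R) (s0 : R) :
  (forall i j s, continuous (A i j) s) ->
  exists y : 'I_n -> R -> R, (forall i, y i s0 = y0 i) /\
    forall i s, is_derive (y i) s (\big[Rplus/0]_j (A i j s * y j s)).
Proof.
move=> hA.
pose P := picard n A y0 s0.
have hP m i s : is_derive (P m.+1 i) s (\big[Rplus/0]_j (A i j s * P m j s)).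
  exact: picard_derive.
exists (fun i s => real (Lim_seq (fun m => P m.+1 i s))); split=> [i|i s].
  rewrite (Lim_seq_ext _ (fun _ => y0 i)) ?Lim_seq_const // => m.
  exact: picard_init.
have [|M [K [hK [bK bP]]]] := picard_contract n A y0 s0 (Rabs (s - s0) + 1) hA.
  by have := Rabs_pos (s - s0); lra.
set r := Rabs (s - s0) + 1 in bK bP.
pose Dom x := Rabs (x - s0) < r.
have hs : Dom s by rewrite /Dom /r; lra.
have cvP j : CVU_dom (fun m => P m.+1 j) Dom.
  apply: (geometric_CVU _ _ (M * / 2)) => m x hx.
  by apply: Rle_trans (bP m.+1 j x (Rlt_le _ _ hx)) _; right; rewrite -tech_pow_Rmult; ring.
have dP m x : Derive (P m.+1 i) x = \big[Rplus/0]_j (A i j x * P m j x).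
  exact/is_derive_unique/hP.
have cP m j x : continuous (P m j) x.
  case: m => [|m]; first exact: continuous_const.
  by apply: ex_derive_continuous; eexists; exact: hP.
have hd : is_derive (fun y : R_AbsRing => real (Lim_seq (fun m => P m.+1 i y))) s
    (real (Lim_seq (fun m => Derive (P m.+1 i) s))).
  apply: (CVU_Derive (fun m => P m.+1 i) Dom) => //.
  - move=> x hx; have he : 0 < r - Rabs (x - s0) by rewrite /Dom in hx; lra.
    exists (mkposreal _ he) => y; rewrite /ball /= /AbsRing_ball /abs /minus /plus /opp /= => hy.
    rewrite /Dom; have -> : y - s0 = (y + - x) + (x - s0) by ring.
    by apply: Rle_lt_trans (Rabs_triang _ _) _; lra.
  - move=> a b x ha hb hx; rewrite /Dom in ha hb *.
    move/Rabs_lt_between: ha => ha; move/Rabs_lt_between: hb => hb.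
    by apply: Rabs_def1; lra.
  - by move=> m x _; eexists; exact: hP.
  - move=> m x _; apply/continuity_pt_filterlim.
    apply: (continuous_ext (fun x => \big[Rplus/0]_j (A i j x * P m j x))) => [z|].
      by rewrite dP.
    apply: Rsum_continuous => j.
    exact: (@continuous_mult R_UniformSpace R_AbsRing _ _ _ (hA i j x) (cP m j x)).
  - apply: (geometric_CVU _ _ (K * M)) => m x hx.
    rewrite !dP Rsum_minus; apply: Rle_trans (Rsum_abs _ _) _.
    apply: Rle_trans (Rsum_le _ _ (fun j => (M * (/ 2) ^ m) * Rabs (A i j x)) _) _.
      move=> j; rewrite -Rmult_minus_distr_l Rabs_mult Rmult_comm.
      apply: Rmult_le_compat_r; [exact: Rabs_pos | exact: bP (Rlt_le _ _ hx)].
    rewrite Rsum_scal; have := bK i x (Rlt_le _ _ hx).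
    have := Rle_trans _ _ _ (Rabs_pos _) (bP m i x (Rlt_le _ _ hx)); nra.
have -> : \big[Rplus/0]_j (A i j s * real (Lim_seq (fun m => P m.+1 j s))) =
    real (Lim_seq (fun m => Derive (P m.+1 i) s)); last exact: hd.
symmetry; rewrite (is_lim_seq_unique _
  (Finite (\big[Rplus/0]_j (A i j s * real (Lim_seq (fun m => P m.+1 j s)))))) //.
apply: (is_lim_seq_ext (fun m => \big[Rplus/0]_j (A i j s * P m j s))) => [m|].
  by rewrite dP.
apply: Rsum_lim_seq => j; apply: is_lim_seq_mult'; first exact: is_lim_seq_const.
by apply/is_lim_seq_incr_1; exact: CVU_dom_lim_seq (cvP j) hs.
Qed.

(** * The equation in logarithmic time *)

(** In the time [s = ln z] the unknowns are [Y1 = phi] and [Y2 = t dphi/dt], and (K)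
    becomes [Y1'' + (g - 1) Y1' + q Y1 = 0] with [q = t^2 (H^2 + i C)]; the singular
    point [t = 0] is sent to minus infinity. *)
Definition Sol (q : R -> C) (g : C) (S : R) (Y1 Y2 : R -> C) : Prop :=
  forall s, s <= S ->
    Cder Y1 s (Y2 s) /\ Cder Y2 s ((1 - g) * Y2 s - q s * Y1 s)%C.

Definition Ccontinuous (q : R -> C) : Prop :=
  forall s, continuous (fun x => Re (q x)) s /\ continuous (fun x => Im (q x)) s.

Lemma Sol_lincomb q g S Y1 Y2 X1 X2 (a b : C) :
  Sol q g S Y1 Y2 -> Sol q g S X1 X2 ->
  Sol q g S (fun s => a * Y1 s + b * X1 s)%C (fun s => a * Y2 s + b * X2 s)%C.
Proof.
move=> hY hX s hs; have [y1 y2] := hY s hs; have [x1 x2] := hX s hs; split.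
  by apply: Cder_plus; apply: Cder_scal.
apply: Cder_eq; first by apply: Cder_plus; apply: Cder_scal; [exact: y2 | exact: x2].
by ring.
Qed.

Lemma Cmod_le_parts (z : C) : Cmod z <= Rabs (Re z) + Rabs (Im z).
Proof.
have -> : z = (RtoC (Re z) + Ci * RtoC (Im z))%C.
  by case: z => x y; apply: injective_projections; rewrite /Re /Im /=; ring.
apply: Rle_trans (Cmod_triangle _ _) _.
rewrite Cmod_mult Cmod_Ci !Cmod_R /Re /Im /= .
by right; congr (Rabs _ + _); [ring | rewrite Rmult_1_l; congr (Rabs _); ring].
Qed.

Lemma Ccontinuous_bounded q a b : Ccontinuous q -> a <= b ->
  exists M, 0 <= M /\ forall s, a <= s <= b -> Cmod (q s) <= M.
Proof.
move=> hq hab.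
have [M1 h1] := continuous_bounded _ a b hab (fun s => proj1 (hq s)).
have [M2 h2] := continuous_bounded _ a b hab (fun s => proj2 (hq s)).
exists (M1 + M2); split.
  have := h1 a (conj (Rle_refl a) hab); have := h2 a (conj (Rle_refl a) hab).
  have := Rabs_pos (Re (q a)); have := Rabs_pos (Im (q a)); lra.
move=> s hs; apply: Rle_trans (Cmod_le_parts _) _.
by have := h1 s hs; have := h2 s hs; lra.
Qed.

Lemma Sol_exists q g s0 (a b : C) : Ccontinuous q ->
  exists Y1 Y2, Y1 s0 = a /\ Y2 s0 = b /\ forall S, Sol q g S Y1 Y2.
Proof.
move=> hq.
pose A (i j : 'I_4) (s : R) : R :=
  match nat_of_ord i, nat_of_ord j with
  | 0, 2 | 1, 3 => 1
  | 2, 0 | 3, 1 => - Re (q s)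
  | 2, 1 => Im (q s)
  | 3, 0 => - Im (q s)
  | 2, 2 | 3, 3 => 1 - Re g
  | 2, 3 => Im g
  | 3, 2 => - Im g
  | _, _ => 0
  end.
pose y0 (i : 'I_4) : R :=
  match nat_of_ord i with 0 => Re a | 1 => Im a | 2 => Re b | _ => Im b end.
have [|y [hy0 hy]] := linear_ode_exists 4 A y0 s0.
  have cN f s : continuous (f : R -> R) s -> continuous (fun x => - f x) s.
    exact: (@continuous_opp R_UniformSpace R_AbsRing R_NormedModule).
  move=> i j s; have [c1 c2] := hq s.
  by case: i => [[|[|[|[|i]]]] hi] //; case: j => [[|[|[|[|j]]]] hj] //;
    rewrite /A /=; (exact: continuous_const || exact: c1 || exact: c2 || exact: cN).
pose i0 : 'I_4 := Ordinal (erefl : (0 < 4)%N).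
pose i1 : 'I_4 := Ordinal (erefl : (1 < 4)%N).
pose i2 : 'I_4 := Ordinal (erefl : (2 < 4)%N).
pose i3 : 'I_4 := Ordinal (erefl : (3 < 4)%N).
have sum4 (F : 'I_4 -> R) : \big[Rplus/0]_j F j = F i0 + F i1 + F i2 + F i3.
  rewrite !big_ord_recl big_ord0 Rplus_0_r -!Rplus_assoc.
  by congr (F _ + F _ + F _ + F _); apply: val_inj.
have e i s : is_derive (y i) s
    (A i i0 s * y i0 s + A i i1 s * y i1 s + A i i2 s * y i2 s + A i i3 s * y i3 s).
  by have := hy i s; rewrite sum4.
exists (fun s => (y i0 s, y i1 s)), (fun s => (y i2 s, y i3 s)); split.
  by rewrite !hy0 /y0 /=; case: (a).
split; first by rewrite !hy0 /y0 /=; case: (b).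
move=> S s _; split; split; rewrite /Re /Im /=.
- by apply: Rderive_eq (e i0 s) _; rewrite /A /= /Re /Im; ring.
- by apply: Rderive_eq (e i1 s) _; rewrite /A /= /Re /Im; ring.
- by apply: Rderive_eq (e i2 s) _; rewrite /A /= /Re /Im; ring.
- by apply: Rderive_eq (e i3 s) _; rewrite /A /= /Re /Im; ring.
Qed.

Definition normsq (Y1 Y2 : R -> C) (s : R) : R := Cmod (Y1 s) ^ 2 + Cmod (Y2 s) ^ 2.

(** The constant grows exponentially with the length of the interval, so that estimates
    uniform in the covector can afford it only over a bounded length. *)
Lemma Sol_gronwall q g S Y1 Y2 a b B : Sol q g S Y1 Y2 -> a <= b <= S ->
  (forall s, a <= s <= b -> Cmod (q s) <= B) ->
  let K := exp ((1 + 2 * Cmod (1 - g)%C + B) * (b - a)) in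
  normsq Y1 Y2 b <= K * normsq Y1 Y2 a /\ normsq Y1 Y2 a <= K * normsq Y1 Y2 b.
Proof.
move=> hY [hab hbS] hB K; set k := 1 + 2 * Cmod (1 - g)%C + B.
pose d s := 2 * (Re (Y1 s) * Re (Y2 s) + Im (Y1 s) * Im (Y2 s)) +
  2 * (Re (Y2 s) * Re ((1 - g) * Y2 s - q s * Y1 s)%C
     + Im (Y2 s) * Im ((1 - g) * Y2 s - q s * Y1 s)%C).
have hd s : a <= s <= b -> is_derive (normsq Y1 Y2) s (d s).
  move=> hs; have [h1 h2] : _ /\ _ := hY s ltac:(lra).
  exact: (@is_derive_plus R_AbsRing R_NormedModule _ _ _ _ _ (Cder_nsq _ _ _ h1) (Cder_nsq _ _ _ h2)).
have bd s : a <= s <= b -> Rabs (d s) <= k * normsq Y1 Y2 s.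
  move=> hs; rewrite /d; apply: Rle_trans (Rabs_triang _ _) _.
  rewrite !Rabs_mult (Rabs_pos_eq 2); last by lra.
  have h1 := Re_inner_le (Y1 s) (Y2 s).
  have h2 := Re_inner_le (Y2 s) ((1 - g) * Y2 s - q s * Y1 s)%C.
  have h3 : Cmod ((1 - g) * Y2 s - q s * Y1 s)%C <= Cmod (1 - g)%C * Cmod (Y2 s) + B * Cmod (Y1 s).
    apply: Rle_trans (Cmod_triangle _ _) _; rewrite Cmod_opp !Cmod_mult.
    have := Rmult_le_compat_r _ _ _ (Cmod_ge_0 (Y1 s)) (hB s hs); lra.
  rewrite /normsq /k; have p1 := Cmod_ge_0 (Y1 s); have p2 := Cmod_ge_0 (Y2 s).
  have pg := Cmod_ge_0 (1 - g)%C; have pB := Rle_trans _ _ _ (Cmod_ge_0 (q s)) (hB s hs).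
  have h4 := Rmult_le_compat_l _ _ _ p2 h3.
  move: h1 h2 h4; set x := Cmod (Y1 s) in p1 *; set y := Cmod (Y2 s) in p2 *.
  set G := Cmod (1 - g)%C in pg *.
  have t1 := pow2_ge_0 (x - y); have t2 : 0 <= B * (x - y) ^ 2 by exact: Rmult_le_pos.
  have t3 : 0 <= G * x ^ 2 by apply: Rmult_le_pos => //; exact: pow2_ge_0.
  move=> h1 h2 h4; nra.
have hw s : is_derive (fun x => k * x) s k.
  by auto_derive => //; ring.
have E : exp (k * b - k * a) = K by rewrite /K -Rmult_minus_distr_l.
rewrite -E; split.
  apply: (gronwall_le _ d (fun x => k * x) (fun _ => k)) => // s hs.
  by apply: Rle_trans (Rle_abs _) _; exact: bd.
apply: (gronwall_ge _ d (fun x => k * x) (fun _ => k)) => // s hs.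
by have := Rle_abs (- d s); rewrite Rabs_Ropp; have := bd s hs; lra.
Qed.

Lemma normsq_eq0 Y1 Y2 s : normsq Y1 Y2 s <= 0 -> Y1 s = RtoC 0 /\ Y2 s = RtoC 0.
Proof.
rewrite /normsq => h; have h1 := pow2_ge_0 (Cmod (Y1 s)); have h2 := pow2_ge_0 (Cmod (Y2 s)).
by split; apply: Cmod_eq_0; have := Cmod_ge_0 (Y1 s); have := Cmod_ge_0 (Y2 s); nra.
Qed.

Lemma Sol_unique q g S Y1 Y2 s0 : Ccontinuous q -> Sol q g S Y1 Y2 -> s0 <= S ->
  Y1 s0 = RtoC 0 -> Y2 s0 = RtoC 0 ->
  forall s, s <= S -> Y1 s = RtoC 0 /\ Y2 s = RtoC 0.
Proof.
move=> hq hY h0 e1 e2 s hs.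
have z0 : normsq Y1 Y2 s0 = 0 by rewrite /normsq e1 e2 Cmod_0; ring.
apply: normsq_eq0.
have [h|h] := Rle_lt_dec s0 s.
  have [B [_ hB]] := Ccontinuous_bounded q s0 s hq h.
  by have [] := Sol_gronwall q g S Y1 Y2 s0 s B hY (conj h hs) hB; rewrite z0 Rmult_0_r.
have [B [_ hB]] := Ccontinuous_bounded q s s0 hq (Rlt_le _ _ h).
by have [_] := Sol_gronwall q g S Y1 Y2 s s0 B hY (conj (Rlt_le _ _ h) h0) hB;
  rewrite z0 Rmult_0_r.
Qed.

(** * The hyperbolic energy estimate *)

(** The terms [2 k Re (Y1 conj Y2)] coming from [k |Y1|^2] and from [|Y2|^2 / k] cancel,
    and the exponential weight turns the damping of [|Y2|^2] into a multiple of
    [k |Y1|^2 - |Y2|^2 / k], which the last summand removes. *)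
Lemma energy_derive (g : C) (Y1 Y2 : R -> C) (w : C) (k kap : R -> R) (dkap : R) (s : R) :
  0 < k s -> is_derive k s (kap s * k s) -> is_derive kap s dkap ->
  Cder Y1 s (Y2 s) -> Cder Y2 s ((1 - g) * Y2 s - (RtoC (k s ^ 2) + w) * Y1 s)%C ->
  let gam := Re g - 1 in
  let G := Re (Y1 s) * Re (Y2 s) + Im (Y1 s) * Im (Y2 s) in
  let X1 := Re (w * Y1 s)%C * Re (Y2 s) + Im (w * Y1 s)%C * Im (Y2 s) in
  let X2 := Re ((1 - g) * Y2 s)%C * Re (Y1 s) + Im ((1 - g) * Y2 s)%C * Im (Y1 s) in
  is_derive (fun x => exp (gam * x) * (k x * Cmod (Y1 x) ^ 2 + Cmod (Y2 x) ^ 2 / k x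
      + (kap x + gam) / k x * (Re (Y1 x) * Re (Y2 x) + Im (Y1 x) * Im (Y2 x)))) s
    (exp (gam * s) * (- (2 / k s) * X1
      + (kap s + gam) / k s * (gam * G + X2 - Re w * Cmod (Y1 s) ^ 2)
      + (dkap - kap s * (kap s + gam)) / k s * G)).
Proof.
move=> hk dk dkp [da db] [dp dr] gam G X1 X2.
pose a x := Re (Y1 x); pose b x := Im (Y1 x); pose p x := Re (Y2 x); pose r x := Im (Y2 x).
apply: (Rderive_ext (fun x => exp (gam * x) * (k x * (a x * a x + b x * b x)
   + (p x * p x + r x * r x) / k x + (kap x + gam) / k x * (a x * p x + b x * r x)))).
  by move=> x; rewrite !Cmod2_alt /= !Rmult_1_r.
have na : is_derive a s (p s) by [].
have nb : is_derive b s (r s) by [].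
auto_derive.
  do 6 (split; first by [eexists; eassumption | lra]).
  by repeat split; try lra; eexists; eassumption.
have -> : Derive (fun x => k x) s = kap s * k s by exact: is_derive_unique.
have -> : Derive (fun x => kap x) s = dkap by exact: is_derive_unique.
have -> : Derive (fun x => a x) s = p s by exact: is_derive_unique.
have -> : Derive (fun x => b x) s = r s by exact: is_derive_unique.
have -> := is_derive_unique _ _ _ dp.
have -> := is_derive_unique _ _ _ dr.
rewrite Cmod2_alt /G /X1 /X2 /a /b /p /r /gam.
rewrite /Re /Im /=; field; lra.
Qed.

Definition energy (gam : R) (k : R -> R) (Y1 Y2 : R -> C) (s : R) : R :=
  exp (gam * s) * (k s * Cmod (Y1 s) ^ 2 + Cmod (Y2 s) ^ 2 / k s).

(** The energy [k |Y1|^2 + |Y2|^2 / k] changes at a relative rate of order one; the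
    correction [((kap + gam) / k) Re (Y1 conj Y2)] is chosen so that its derivative
    cancels the leading part [(kap + gam) (k |Y1|^2 - |Y2|^2 / k)].  Only the first
    order coefficient, worth at most [c0], and terms of relative size [1 / k]
    survive, and [1 / k] is dominated by the derivative of [- 1 / (lo k)]. *)
Lemma energy_estimate (g : C) (c0 lo L L' : R) : 0 < lo -> 0 <= c0 ->
  exists M kmin, 0 < M /\ 1 <= kmin /\
  forall S Y1 Y2 (w : R -> C) k kap dkap s1, s1 <= S ->
    Sol (fun s => RtoC (k s ^ 2) + w s)%C g S Y1 Y2 ->
    (forall s, s1 <= s <= S ->
      kmin <= k s /\ is_derive k s (kap s * k s) /\ is_derive kap s (dkap s) /\
      lo <= kap s <= L /\ Rabs (dkap s) <= L' /\ Cmod (w s) <= c0 * k s) ->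
    let E := energy (Re g - 1) k Y1 Y2 in
    E S <= M * exp (c0 * (S - s1)) * E s1 /\ E s1 <= M * exp (c0 * (S - s1)) * E S.
Proof.
move=> hlo hc0; set gam := Re g - 1.
pose P := Rabs L + Rabs gam.
have hP : 0 <= P by rewrite /P; have := Rabs_pos L; have := Rabs_pos gam; lra.
pose K1 := P * (Rabs gam / 2 + Cmod (1 - g)%C / 2 + c0) + (Rabs L' + Rabs L * P) / 2.
have hK1 : 0 <= K1.
  rewrite /K1; have := Rabs_pos L; have := Rabs_pos L'; have := Rabs_pos gam.
  have := Cmod_ge_0 (1 - g)%C => h1 h2 h3 h4.
  by apply: Rplus_le_le_0_compat; [apply: Rmult_le_pos; lra | nra].
pose K2 := c0 * P + 2 * K1.
have hK2 : 0 <= K2 by rewrite /K2; nra.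
exists (3 * exp (K2 / lo)), (P + 1); split; first by have := exp_pos (K2 / lo); lra.
split; first by lra.
move=> S Y1 Y2 w k kap dkap s1 hS hY H E.
pose G s := Re (Y1 s) * Re (Y2 s) + Im (Y1 s) * Im (Y2 s).
pose X1 s := Re (w s * Y1 s)%C * Re (Y2 s) + Im (w s * Y1 s)%C * Im (Y2 s).
pose X2 s := Re ((1 - g) * Y2 s)%C * Re (Y1 s) + Im ((1 - g) * Y2 s)%C * Im (Y1 s).
pose E1 s := k s * Cmod (Y1 s) ^ 2 + Cmod (Y2 s) ^ 2 / k s.
pose F s := exp (gam * s) * (E1 s + (kap s + gam) / k s * G s).
pose dF s := exp (gam * s) * (- (2 / k s) * X1 s
      + (kap s + gam) / k s * (gam * G s + X2 s - Re (w s) * Cmod (Y1 s) ^ 2)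
      + (dkap s - kap s * (kap s + gam)) / k s * G s).
have dFP s : s1 <= s <= S -> is_derive F s (dF s).
  move=> hs; have [h1 [h2 [h3 _]]] := H s hs.
  have [y1 y2] : _ /\ _ := hY s ltac:(lra).
  by have := energy_derive g Y1 Y2 (w s) k kap (dkap s) s ltac:(lra) h2 h3 y1 y2.
have E1_ge s : s1 <= s <= S -> 2 * (Cmod (Y1 s) * Cmod (Y2 s)) <= E1 s.
  move=> hs; have [h1 _] := H s hs; have k0 : 0 < k s by lra.
  have -> : E1 s = 2 * (Cmod (Y1 s) * Cmod (Y2 s)) + (k s * Cmod (Y1 s) - Cmod (Y2 s)) ^ 2 / k s.
    by rewrite /E1; field; lra.
  have : 0 <= (k s * Cmod (Y1 s) - Cmod (Y2 s)) ^ 2 / k s.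
    by apply: Rdiv_le_0_compat => //; exact: pow2_ge_0.
  lra.
have bG s : s1 <= s <= S -> Rabs (G s) <= E1 s / 2.
  move=> hs; have := E1_ge s hs; have := Re_inner_le (Y1 s) (Y2 s); rewrite -/(G s); lra.
have bX2 s : s1 <= s <= S -> Rabs (X2 s) <= Cmod (1 - g)%C * (E1 s / 2).
  move=> hs; apply: Rle_trans (Re_inner_le _ _) _; rewrite Cmod_mult.
  have := E1_ge s hs; have := Cmod_ge_0 (1 - g)%C; nra.
have bX1 s : s1 <= s <= S -> Rabs (X1 s) <= c0 * k s * (E1 s / 2).
  move=> hs; apply: Rle_trans (Re_inner_le _ _) _; rewrite Cmod_mult.
  have [h1 [_ [_ [_ [_ hw]]]]] := H s hs.
  rewrite Rmult_assoc; apply: Rmult_le_compat => //.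
  - exact: Cmod_ge_0.
  - by apply: Rmult_le_pos; exact: Cmod_ge_0.
  - by have := E1_ge s hs; lra.
have E1_0 s : s1 <= s <= S -> 0 <= E1 s.
  move=> hs; have := E1_ge s hs; have := Cmod_ge_0 (Y1 s); have := Cmod_ge_0 (Y2 s); nra.
have bk s : s1 <= s <= S -> Rabs (kap s + gam) <= P.
  move=> hs; have [_ [_ [_ [h _]]]] := H s hs.
  apply: Rle_trans (Rabs_triang _ _) _; rewrite /P.
  have := Rle_abs L; rewrite (Rabs_pos_eq (kap s)); lra.
have bF s : s1 <= s <= S ->
    (1 - P / k s / 2) * E1 s <= E1 s + (kap s + gam) / k s * G s <= (1 + P / k s / 2) * E1 s.
  move=> hs; have [h1 _] := H s hs; have k0 : 0 < k s by lra.
  suff : Rabs ((kap s + gam) / k s * G s) <= P / k s * (E1 s / 2).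
    by move/Rabs_le_between => ?; lra.
  rewrite Rabs_mult; apply: Rmult_le_compat; try exact: Rabs_pos; last exact: bG.
  rewrite Rabs_div ?(Rabs_pos_eq (k s)); try lra.
  apply: Rmult_le_compat_r; [exact/Rlt_le/Rinv_0_lt_compat | exact: bk].
have bdF s : s1 <= s <= S -> Rabs (dF s) <= exp (gam * s) * ((c0 + K1 / k s) * E1 s).
  move=> hs; have [h1 [_ [_ [hk [hdk hw]]]]] := H s hs; have k0 : 0 < k s by lra.
  have ik : 0 < / k s by exact: Rinv_0_lt_compat.
  rewrite /dF Rabs_mult (Rabs_pos_eq (exp _)); last exact/Rlt_le/exp_pos.
  apply: Rmult_le_compat_l; first exact/Rlt_le/exp_pos.
  have t1 : Rabs (- (2 / k s) * X1 s) <= c0 * E1 s.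
    rewrite Rabs_mult Rabs_Ropp (Rabs_pos_eq (2 / k s)); last first.
      by apply: Rdiv_le_0_compat; lra.
    have -> : c0 * E1 s = 2 / k s * (c0 * k s * (E1 s / 2)) by field; lra.
    by apply: Rmult_le_compat_l; [apply: Rdiv_le_0_compat; lra | exact: bX1].
  have t2 : Rabs (gam * G s + X2 s - Re (w s) * Cmod (Y1 s) ^ 2)
      <= (Rabs gam / 2 + Cmod (1 - g)%C / 2 + c0) * E1 s.
    have u1 : Rabs (gam * G s) <= Rabs gam * (E1 s / 2).
      by rewrite Rabs_mult; apply: Rmult_le_compat_l; [exact: Rabs_pos | exact: bG].
    have u3 : Rabs (Re (w s) * Cmod (Y1 s) ^ 2) <= c0 * E1 s.
      rewrite Rabs_mult (Rabs_pos_eq (_ ^ 2)); last exact: pow2_ge_0.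
      have v1 := Rle_trans _ _ _ (re_le_Cmod (w s)) hw.
      have v2 : k s * Cmod (Y1 s) ^ 2 <= E1 s.
        by have : 0 <= Cmod (Y2 s) ^ 2 / k s;
          [apply: Rdiv_le_0_compat => //; exact: pow2_ge_0 | rewrite /E1; lra].
      have := Rmult_le_compat_r _ _ _ (pow2_ge_0 (Cmod (Y1 s))) v1; nra.
    have u2 := bX2 s hs.
    apply: Rle_trans (Rabs_triang _ _) _; rewrite Rabs_Ropp.
    have := Rabs_triang (gam * G s) (X2 s); lra.
  have t3 : Rabs ((kap s + gam) / k s * (gam * G s + X2 s - Re (w s) * Cmod (Y1 s) ^ 2))
      <= / k s * (P * ((Rabs gam / 2 + Cmod (1 - g)%C / 2 + c0) * E1 s)).
    rewrite /Rdiv (Rmult_comm (kap s + gam)) Rmult_assoc Rabs_mult (Rabs_pos_eq (/ k s)); last lra.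
    apply: Rmult_le_compat_l; first lra.
    by rewrite Rabs_mult; apply: Rmult_le_compat; try exact: Rabs_pos; [exact: bk | exact: t2].
  have t4 : Rabs ((dkap s - kap s * (kap s + gam)) / k s * G s)
      <= / k s * ((Rabs L' + Rabs L * P) * (E1 s / 2)).
    rewrite /Rdiv (Rmult_comm (dkap s - _)) Rmult_assoc Rabs_mult (Rabs_pos_eq (/ k s)); last lra.
    apply: Rmult_le_compat_l; first lra.
    rewrite Rabs_mult; apply: Rmult_le_compat; try exact: Rabs_pos; last exact: bG.
    apply: Rle_trans (Rabs_triang _ _) _; rewrite Rabs_Ropp Rabs_mult.
    apply: Rplus_le_compat; first by have := Rle_abs L'; lra.
    apply: Rmult_le_compat; try exact: Rabs_pos; last exact: bk.
    by rewrite Rabs_pos_eq; have := Rle_abs L; lra.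
  apply: Rle_trans (Rabs_triang _ _) _.
  have t5 := Rabs_triang (- (2 / k s) * X1 s)
    ((kap s + gam) / k s * (gam * G s + X2 s - Re (w s) * Cmod (Y1 s) ^ 2)).
  have -> : (c0 + K1 / k s) * E1 s = c0 * E1 s
     + / k s * (P * ((Rabs gam / 2 + Cmod (1 - g)%C / 2 + c0) * E1 s))
     + / k s * ((Rabs L' + Rabs L * P) * (E1 s / 2)).
    by rewrite /K1; field; lra.
  lra.
(* [- 1 / (lo k)] has derivative [kap / (lo k) >= 1 / k] *)
pose W s := c0 * s - K2 / lo * / k s.
have dW s : s1 <= s <= S -> is_derive W s (c0 + K2 / lo * kap s * / k s).
  move=> hs; have [h1 [h2 _]] := H s hs; rewrite /W.
  auto_derive; first by split; [exists (kap s * k s) | split=> //; lra].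
  have -> : Derive (fun x => k x) s = kap s * k s by exact: is_derive_unique.
  by field; lra.
have bW s : s1 <= s <= S -> Rabs (dF s) <= (c0 + K2 / lo * kap s * / k s) * F s.
  move=> hs; apply: Rle_trans (bdF s hs) _.
  have [h1 [_ [_ [hk _]]]] := H s hs; have k0 : 0 < k s by lra.
  have ik : 0 < / k s by exact: Rinv_0_lt_compat.
  have -> : (c0 + K2 / lo * kap s * / k s) * F s = exp (gam * s) *
      ((c0 + K2 / lo * kap s * / k s) * (E1 s + (kap s + gam) / k s * G s)).
    by rewrite /F; ring.
  apply: Rmult_le_compat_l; first exact/Rlt_le/exp_pos.
  have [lowF _] := bF s hs; have e0 := E1_0 s hs.
  set x := P / k s / 2 in lowF.
  have hx : 0 <= x <= / 2.
    rewrite /x; have hq : P * / k s <= 1.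
      by apply: (Rmult_le_reg_r (k s)) => //; rewrite Rmult_assoc Rinv_l; lra.
    have : 0 <= P * / k s by nra.
    rewrite /Rdiv; lra.
  have e1 : E1 s <= (1 + 2 * x) * (E1 s + (kap s + gam) / k s * G s).
    have : (1 + 2 * x) * ((1 - x) * E1 s) <= (1 + 2 * x) * (E1 s + (kap s + gam) / k s * G s).
      by apply: Rmult_le_compat_l => //; lra.
    have : 0 <= x * (1 - 2 * x) * E1 s.
      by apply: Rmult_le_pos => //; apply: Rmult_le_pos; lra.
    lra.
  have e2 : 0 <= E1 s + (kap s + gam) / k s * G s by nra.
  have c1 : 0 <= c0 + K1 / k s.
    have : 0 <= K1 / k s by apply: Rdiv_le_0_compat.
    lra.
  apply: Rle_trans (Rmult_le_compat_l _ _ _ c1 e1) _.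
  rewrite -Rmult_assoc; apply: Rmult_le_compat_r => //.
  have f1 : K2 * / k s <= K2 / lo * kap s * / k s.
    apply: Rmult_le_compat_r; first lra.
    have -> : K2 = K2 / lo * lo by field; lra.
    have : 0 <= K2 / lo by apply: Rdiv_le_0_compat.
    have -> : K2 / lo * lo / lo * kap s = K2 / lo * kap s by field; lra.
    by move=> ?; apply: Rmult_le_compat_l; lra.
  have -> : (c0 + K1 / k s) * (1 + 2 * x) = c0 + (c0 * P + K1) * / k s + 2 * x * (K1 * / k s).
    by rewrite /x; field; lra.
  have f2 : 0 <= K1 * / k s by nra.
  have f3 : 2 * x * (K1 * / k s) <= 1 * (K1 * / k s) by apply: Rmult_le_compat_r => //; lra.
  have f4 : K2 * / k s = (c0 * P + K1) * / k s + 1 * (K1 * / k s) by rewrite /K2; ring.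
  lra.
have fin : W S - W s1 <= K2 / lo + c0 * (S - s1).
  have [h1 _] := H s1 ltac:(lra); have [h2 _] := H S ltac:(lra).
  have hq : 0 <= K2 / lo by apply: Rdiv_le_0_compat.
  have i1 : / k s1 <= 1 by rewrite -Rinv_1; apply: Rinv_le_contravar; lra.
  have i2 : 0 < / k S by apply: Rinv_0_lt_compat; lra.
  have p1 := Rmult_le_compat_l _ _ _ hq i1; have p2 := Rmult_le_pos _ _ hq (Rlt_le _ _ i2).
  by rewrite /W; lra.
(* since [k >= P], the correction is at most half of the energy *)
have FE s : s1 <= s <= S -> E s <= 2 * F s /\ F s <= 3 / 2 * E s.
  move=> hs; have [h1 _] := H s hs; have k0 : 0 < k s by lra.
  have [l u] := bF s hs; have e0 := E1_0 s hs; have ep := exp_pos (gam * s).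
  have hq : 0 <= P / k s <= 1.
    split; first by apply: Rdiv_le_0_compat.
    by apply: (Rmult_le_reg_r (k s)) => //; rewrite /Rdiv Rmult_assoc Rinv_l; lra.
  rewrite /E /energy -/(E1 s) /F.
  have a1 : E1 s <= 2 * (E1 s + (kap s + gam) / k s * G s) by nra.
  have a2 : E1 s + (kap s + gam) / k s * G s <= 3 / 2 * E1 s by nra.
  by have := Rmult_le_compat_l _ _ _ (Rlt_le _ _ ep) a1;
     have := Rmult_le_compat_l _ _ _ (Rlt_le _ _ ep) a2; lra.
have ew : exp (W S - W s1) <= exp (K2 / lo) * exp (c0 * (S - s1)).
  by rewrite -exp_plus; apply: Rexp_le.
have ep := exp_pos (W S - W s1).
have g1 := gronwall_le F dF W _ s1 S hS dFP dW
  (fun s hs => Rle_trans _ _ _ (Rle_abs _) (bW s hs)).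
have g2 := gronwall_ge F dF W _ s1 S hS dFP dW _.
have {}g2 : F s1 <= exp (W S - W s1) * F S.
  by apply: g2 => s hs; have := bW s hs; move/Rabs_le_between; lra.
have [a1 a2] := FE s1 ltac:(lra); have [b1 b2] := FE S ltac:(lra).
have pE1 : 0 <= E s1 by apply: Rmult_le_pos; [exact/Rlt_le/exp_pos | exact: E1_0 s1 ltac:(lra)].
have pES : 0 <= E S by apply: Rmult_le_pos; [exact/Rlt_le/exp_pos | exact: E1_0 S ltac:(lra)].
move: ew g1 g2; set X := exp (W S - W s1) in ep *.
rewrite (Rmult_assoc 3); set Z := exp (K2 / lo) * exp (c0 * (S - s1)) => ew g1 g2.
have m1 := Rmult_le_compat_l _ _ _ (Rlt_le _ _ ep) a2.
have m2 := Rmult_le_compat_l _ _ _ (Rlt_le _ _ ep) b2.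
have n1 := Rmult_le_compat_r _ _ _ pE1 ew.
have n2 := Rmult_le_compat_r _ _ _ pES ew.
split; lra.
Qed.

(** * The scaled potential *)

(** For [p = 0] this is [t^2 H^2], the square of the frequency in logarithmic time;
    raising [p] differentiates it. *)
Definition mom (n : nat) (b eta : 'I_n -> R) (p : nat) (s : R) : R :=
  \big[Rplus/0]_i ((2 * b i) ^ p * (exp (2 * b i * s) * eta i ^ 2)).

(** [t^2 C], the contribution of the first order spatial terms. *)
Definition first_order (n : nat) (b : 'I_n -> R) (c : 'I_n -> C) (eta : 'I_n -> R) (s : R) : C :=
  \big[Cplus/RtoC 0]_i (c i * RtoC (exp (b i * s) * eta i))%C.

Definition pot (n : nat) (b : 'I_n -> R) (c : 'I_n -> C) (eta : 'I_n -> R) (s : R) : C :=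
  (RtoC (mom n b eta 0 s) + Ci * first_order n b c eta s)%C.

Lemma mom_derive n b eta p s : is_derive (mom n b eta p) s (mom n b eta p.+1 s).
Proof.
apply: (Rsum_derive _ (fun i s => (2 * b i) ^ p * (exp (2 * b i * s) * eta i ^ 2))
  (fun i s => (2 * b i) ^ p.+1 * (exp (2 * b i * s) * eta i ^ 2))) => i.
by auto_derive => //=; ring.
Qed.

Lemma mom_ge0 n b eta s : 0 <= mom n b eta 0 s.
Proof.
apply: Rsum_ge0 => i; rewrite /= Rmult_1_l.
by apply: Rmult_le_pos; [exact/Rlt_le/exp_pos | exact: pow2_ge_0].
Qed.

Lemma mom_bounds n b eta p s lo L : 0 < lo -> (forall i, lo <= b i <= L) ->
  (2 * lo) ^ p * mom n b eta 0 s <= mom n b eta p s <= (2 * L) ^ p * mom n b eta 0 s.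
Proof.
move=> hlo hb; rewrite /mom -!Rsum_scal.
have pos i : 0 <= exp (2 * b i * s) * eta i ^ 2.
  by apply: Rmult_le_pos; [exact/Rlt_le/exp_pos | exact: pow2_ge_0].
split; apply: Rsum_le => i; rewrite pow_O Rmult_1_l; apply: Rmult_le_compat_r => //;
  apply: pow_incr; have := hb i; lra.
Qed.

Lemma Csum_derive (I : finType) (F dF : I -> R -> C) (s : R) :
  (forall i, Cder (F i) s (dF i s)) ->
  Cder (fun x => \big[Cplus/RtoC 0]_i F i x) s (\big[Cplus/RtoC 0]_i dF i s).
Proof.
move=> h; elim: (index_enum I) => [|k r IH].
  rewrite big_nil; apply: (Cder_ext (fun _ => RtoC 0)) => [x|]; first by rewrite big_nil.
  exact: Cder_const.
rewrite big_cons.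
apply: (Cder_ext (fun x => F k x + \big[Cplus/RtoC 0]_(i <- r) F i x)%C) => [x|].
  by rewrite big_cons.
exact: Cder_plus.
Qed.

Lemma pot_derive n b c eta s : exists v, Cder (pot n b c eta) s v.
Proof.
eexists; apply: Cder_plus; first by apply: Cder_RtoC; exact: mom_derive.
apply: Cder_scal.
apply: (Csum_derive _ (fun i s => (c i * RtoC (exp (b i * s) * eta i))%C)
  (fun i s => (c i * RtoC (b i * exp (b i * s) * eta i))%C)) => i.
by apply: Cder_scal; apply: Cder_RtoC; auto_derive => //; ring.
Qed.

Lemma pot_continuous n b c eta : Ccontinuous (pot n b c eta).
Proof.
move=> s; have [v [h1 h2]] := pot_derive n b c eta s.
by split; apply: ex_derive_continuous; eexists; eassumption.
Qed.

(** Cauchy-Schwarz; this is where the Euclidean norm [|c|] of the loss enters. *)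
Lemma first_order_le n b c eta s :
  Cmod (first_order n b c eta s) <= cvnorm c * sqrt (mom n b eta 0 s).
Proof.
rewrite /first_order /cvnorm /mom.
suff [] : 0 <= \big[Rplus/0]_(i < n) Cmod (c i) ^ 2 /\
    0 <= \big[Rplus/0]_i ((2 * b i) ^ 0 * (exp (2 * b i * s) * eta i ^ 2)) /\
    Cmod (\big[Cplus/RtoC 0]_i (c i * RtoC (exp (b i * s) * eta i))%C) <=
    sqrt (\big[Rplus/0]_(i < n) Cmod (c i) ^ 2) *
    sqrt (\big[Rplus/0]_i ((2 * b i) ^ 0 * (exp (2 * b i * s) * eta i ^ 2))) by move=> _ [].
apply: (big_rec3 (fun x y z => 0 <= x /\ 0 <= y /\ Cmod z <= sqrt x * sqrt y)).
  by rewrite Cmod_0 sqrt_0; lra.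
move=> i A B z _ [hA [hB hz]].
have e : (2 * b i) ^ 0 * (exp (2 * b i * s) * eta i ^ 2) = (exp (b i * s) * eta i) ^ 2.
  rewrite pow_O Rmult_1_l Rpow_mult_distr; congr (_ * _).
  by rewrite /= Rmult_1_r -exp_plus; congr exp; ring.
rewrite e; set x := Cmod (c i); set y := exp (b i * s) * eta i.
have hx : 0 <= x by exact: Cmod_ge_0.
have q1 := pow2_ge_0 x; have q2 := pow2_ge_0 y.
split; first lra; split; first lra.
apply: Rle_trans (Cmod_triangle _ _) _; rewrite Cmod_mult Cmod_R -/x.
apply: Rle_trans (Rplus_le_compat_l _ _ _ hz) _.
rewrite -[X in X <= _]Rabs_pos_eq; last first.
  apply: Rplus_le_le_0_compat; first by apply: Rmult_le_pos => //; exact: Rabs_pos.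
  by apply: Rmult_le_pos; exact: sqrt_pos.
rewrite -[X in _ <= X]sqrt_mult; try lra.
rewrite -sqrt_Rsqr_abs; apply: sqrt_le_1_alt.
rewrite /Rsqr.
have sA := sqrt_sqrt A hA; have sB := sqrt_sqrt B hB; have sy := Rsqr_abs y.
rewrite /Rsqr in sy.
set a := sqrt A in sA *; set d := sqrt B in sB *; set w := Rabs y in sy *.
have := pow2_ge_0 (x * d - a * w).
rewrite -sA -sB /= !Rmult_1_r sy; nra.
Qed.

(** All the exponents [2 b_i] and [b_i] are at least [lo], and the excess is harmless on
    a half-line bounded above. *)
Lemma pot_le n b c lo s1 : (forall i, 0 < lo <= b i) ->
  exists B, 0 < B /\ forall eta s, (forall i, Rabs (eta i) <= 1) -> s <= s1 ->
    mom n b eta 0 s <= B /\ Cmod (pot n b c eta s) <= B * exp (lo * s).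
Proof.
move=> hb.
pose B1 := \big[Rplus/0]_i exp ((2 * b i - lo) * s1).
pose B2 := \big[Rplus/0]_i (Cmod (c i) * exp ((b i - lo) * s1)).
pose B3 := \big[Rplus/0]_i exp (2 * b i * s1).
have h1 : 0 <= B1 by apply: Rsum_ge0 => i; exact/Rlt_le/exp_pos.
have h2 : 0 <= B2.
  by apply: Rsum_ge0 => i; apply: Rmult_le_pos; [exact: Cmod_ge_0 | exact/Rlt_le/exp_pos].
have h3 : 0 <= B3 by apply: Rsum_ge0 => i; exact/Rlt_le/exp_pos.
have sq eta : (forall i, Rabs (eta i) <= 1) -> forall i : 'I_n, 0 <= eta i ^ 2 <= 1.
  move=> he i; split; first exact: pow2_ge_0.
  by rewrite -pow2_abs; have := he i; have := Rabs_pos (eta i); nra.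
exists (B1 + B2 + B3 + 1); split; first lra.
move=> eta s he hs; have ep := exp_pos (lo * s); split.
  suff : mom n b eta 0 s <= B3 by lra.
  apply: Rsum_le => i; rewrite pow_O Rmult_1_l; have [e1 e2] := sq eta he i.
  have : exp (2 * b i * s) <= exp (2 * b i * s1) by apply: Rexp_le; have := hb i; nra.
  by have := exp_pos (2 * b i * s); nra.
apply: Rle_trans (Cmod_triangle _ _) _.
rewrite Cmod_mult Cmod_Ci Rmult_1_l Cmod_R Rabs_pos_eq; last exact: mom_ge0.
suff : mom n b eta 0 s <= exp (lo * s) * B1 /\ Cmod (first_order n b c eta s) <= exp (lo * s) * B2.
  by move=> [u v]; nra.
split.
  rewrite -Rsum_scal; apply: Rsum_le => i; rewrite pow_O Rmult_1_l -exp_plus.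
  have [e1 e2] := sq eta he i; have [hl hbi] := hb i.
  have : exp (2 * b i * s) <= exp (lo * s + (2 * b i - lo) * s1) by apply: Rexp_le; nra.
  by have := exp_pos (2 * b i * s); nra.
rewrite -Rsum_scal /first_order.
apply: (big_ind2 (fun z x => Cmod z <= x)).
- by rewrite Cmod_0; lra.
- by move=> z x z' x' hz hz'; apply: Rle_trans (Cmod_triangle _ _) _; lra.
- move=> i _; rewrite Cmod_mult Cmod_R Rabs_mult (Rabs_pos_eq (exp _)); last exact/Rlt_le/exp_pos.
  have [hl hbi] := hb i.
  have e : exp (b i * s) <= exp (lo * s) * exp ((b i - lo) * s1).
    by rewrite -exp_plus; apply: Rexp_le; nra.
  have -> : exp (lo * s) * (Cmod (c i) * exp ((b i - lo) * s1)) =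
    Cmod (c i) * (exp (lo * s) * exp ((b i - lo) * s1)) by ring.
  apply: Rmult_le_compat_l; first exact: Cmod_ge_0.
  by have := he i; have := exp_pos (b i * s); have := Rabs_pos (eta i); nra.
Qed.

(** * The anisotropic scale *)

Definition expo (n : nat) (l : 'I_n -> R) (i : 'I_n) : R := l i + 1.

(** (K) is invariant under [t -> lam t], [xi_i -> lam ^ (- b_i) xi_i] with
    [b_i = l_i + 1].  Taking [lam = <<xi>>] brings every covector into the unit cube,
    which is what makes the constants independent of it. *)
Definition scaled (n : nat) (l : 'I_n -> R) (xi : 'I_n -> R) (i : 'I_n) : R :=
  xi i * exp (- (expo n l i * ln (djbr l xi))).

Lemma jbr_ge1 x : 1 <= jbr x.
Proof. by rewrite /jbr -{1}sqrt_1; apply: sqrt_le_1_alt; have := pow2_ge_0 x; lra. Qed.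

Lemma Rabs_le_jbr x : Rabs x <= jbr x.
Proof.
by rewrite /jbr -sqrt_Rsqr_abs; apply: sqrt_le_1_alt; rewrite Rsqr_pow2; lra.
Qed.

Lemma jbr_le_djbr n (l xi : 'I_n -> R) i : (forall i, -1 < l i) ->
  ln (jbr (xi i)) <= expo n l i * ln (djbr l xi).
Proof.
move=> hl; have hb : 0 < expo n l i by have := hl i; rewrite /expo; lra.
have h : Rpower (jbr (xi i)) (/ (l i + 1)) <= djbr l xi.
  exact: (Rmax_term_le _ (fun i => Rpower (jbr (xi i)) (/ (l i + 1)))).
have h2 := ln_le _ _ (exp_pos _) h.
rewrite /Rpower ln_exp in h2.
have := Rmult_le_compat_l _ _ _ (Rlt_le _ _ hb) h2.
rewrite /expo -Rmult_assoc Rinv_r; lra || (have := hl i; lra).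
Qed.

Lemma djbr_ge1 d (l xi : 'I_d.+1 -> R) : (forall i, -1 < l i) -> 1 <= djbr l xi.
Proof.
move=> hl; apply: Rle_trans (Rmax_term_le _ (fun i => Rpower (jbr (xi i)) (/ (l i + 1))) ord0).
rewrite -{1}exp_0 /Rpower; apply: Rexp_le; apply: Rmult_le_pos.
  by apply/Rlt_le/Rinv_0_lt_compat; have := hl ord0; lra.
by rewrite -ln_1; apply: ln_le; [lra | exact: jbr_ge1].
Qed.

Lemma djbr_attained d (l xi : 'I_d.+1 -> R) : (forall i, -1 < l i) ->
  exists j, ln (jbr (xi j)) = expo d.+1 l j * ln (djbr l xi).
Proof.
move=> hl; have h1 := djbr_ge1 d l xi hl.
have [h|[j hj]] : djbr l xi = 0 \/ exists j, djbr l xi = Rpower (jbr (xi j)) (/ (l j + 1)).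
  rewrite /djbr; elim: (index_enum _) => [|k r IH]; first by left; rewrite big_nil.
  rewrite big_cons; case: (Rmax_case_strong (Rpower (jbr (xi k)) (/ (l k + 1)))
    (\big[Rmax/0]_(j <- r) Rpower (jbr (xi j)) (/ (l j + 1))) 
    (fun x => x = 0 \/ exists j, x = Rpower (jbr (xi j)) (/ (l j + 1)))) => //.
  - by move=> _; right; exists k.
  - by left.
  - by right.
  by lra.
exists j; rewrite hj /Rpower ln_exp /expo -Rmult_assoc Rinv_r; lra || (have := hl j; lra).
Qed.

Lemma scaled_le1 n (l xi : 'I_n -> R) i : (forall i, -1 < l i) ->
  Rabs (scaled n l xi i) <= 1.
Proof.
move=> hl; rewrite /scaled Rabs_mult (Rabs_pos_eq (exp _)); last exact/Rlt_le/exp_pos.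
have j1 := jbr_ge1 (xi i); have j2 := Rabs_le_jbr (xi i).
have e : jbr (xi i) <= exp (expo n l i * ln (djbr l xi)).
  by rewrite -[X in X <= _]exp_ln; [apply: Rexp_le; exact: jbr_le_djbr | lra].
have -> : 1 = exp (expo n l i * ln (djbr l xi)) * exp (- (expo n l i * ln (djbr l xi))).
  by rewrite -exp_plus Rplus_opp_r exp_0.
by apply: Rmult_le_compat_r; [exact/Rlt_le/exp_pos | lra].
Qed.

(** The maximum defining [<<xi>>] is attained at some [j], and there
    [xi_j ^ 2 = <<xi>> ^ (2 b_j) - 1], so that scaling leaves a component of order one
    as soon as [<<xi>>] is large. *)
Lemma scaled_large d (l xi : 'I_d.+1 -> R) lo : (forall i, -1 < l i) ->
  (forall i, 0 < lo <= expo d.+1 l i) -> 1 <= 2 * lo * ln (djbr l xi) ->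
  exists j, / 2 <= scaled d.+1 l xi j ^ 2.
Proof.
move=> hl hb hL; have [j hj] := djbr_attained d l xi hl; exists j.
set lam := ln (djbr l xi) in hL hj *; rewrite /scaled -/lam.
set B := expo d.+1 l j * lam in hj *.
have hB : 1 <= 2 * B.
  have [h1 h2] := hb j; have : 0 <= lam by nra.
  by rewrite /B; nra.
have j2 : jbr (xi j) ^ 2 = 1 + xi j ^ 2.
  by rewrite /jbr pow2_sqrt //; have := pow2_ge_0 (xi j); lra.
have j3 : jbr (xi j) ^ 2 = exp (2 * B).
  have -> : jbr (xi j) = exp B by rewrite -hj exp_ln //; have := jbr_ge1 (xi j); lra.
  by rewrite /= Rmult_1_r -exp_plus; congr exp; ring.
have e2 : exp (- B) ^ 2 = exp (- (2 * B)).
  by rewrite /= Rmult_1_r -exp_plus; congr exp; ring.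
rewrite Rpow_mult_distr e2.
have -> : xi j ^ 2 = exp (2 * B) - 1 by lra.
have e3 : exp (2 * B) * exp (- (2 * B)) = 1 by rewrite -exp_plus Rplus_opp_r exp_0.
have e4 : 2 <= exp (2 * B).
  by have := exp_ineq1_le (2 * B); lra.
have e5 := exp_pos (- (2 * B)).
nra.
Qed.

Lemma mom_scaled n (l xi : 'I_n -> R) (x : R) :
  mom n (expo n l) (scaled n l xi) 0 (ln (djbr l xi) + x) =
  \big[Rplus/0]_i (exp (2 * expo n l i * x) * xi i ^ 2).
Proof.
apply: eq_bigr => i _; rewrite pow_O Rmult_1_l /scaled Rpow_mult_distr.
set lam := ln _; set B := expo n l i.
have -> : exp (- (B * lam)) ^ 2 = exp (- (2 * B * lam)).
  by rewrite /= Rmult_1_r -exp_plus; congr exp; ring.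
have -> : exp (2 * B * (lam + x)) = exp (2 * B * x) * exp (2 * B * lam).
  by rewrite -exp_plus; congr exp; ring.
have e : exp (2 * B * lam) * exp (- (2 * B * lam)) = 1 by rewrite -exp_plus Rplus_opp_r exp_0.
by rewrite -[RHS]Rmult_1_r -e; ring.
Qed.

(** * Two-sided comparison of sizes *)

(** Carrying both inequalities together gives the asymptotic and the scattering
    estimate from the same chain of comparisons. *)
Definition within_factor (K x y : R) : Prop := x <= K * y /\ y <= K * x.

Lemma within_factor_trans K1 K2 x y z : 0 <= K1 -> 0 <= K2 ->
  within_factor K1 x y -> within_factor K2 y z -> within_factor (K1 * K2) x z.
Proof.
move=> h1 h2 [a1 a2] [b1 b2]; split.
  by have := Rmult_le_compat_l _ _ _ h1 b1; rewrite Rmult_assoc; lra.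
by have := Rmult_le_compat_l _ _ _ h2 a2; rewrite (Rmult_comm K1) Rmult_assoc; lra.
Qed.

Lemma within_factor_sym K x y : within_factor K x y -> within_factor K y x.
Proof. by case. Qed.

Lemma within_factor_weaken K K' x y : 0 <= x -> 0 <= y -> K <= K' ->
  within_factor K x y -> within_factor K' x y.
Proof. by move=> hx hy h [a b]; split; nra. Qed.

Lemma within_factor_scal K a x y : 0 <= a -> within_factor K x y -> within_factor K (a * x) (a * y).
Proof.
move=> ha [h1 h2]; split.
  by have := Rmult_le_compat_l _ _ _ ha h1; lra.
by have := Rmult_le_compat_l _ _ _ ha h2; lra.
Qed.

Lemma within_factor_exp a B y : Rabs a <= B -> 0 <= y -> within_factor (exp B) (exp a * y) y.
Proof.
move=> h hy; have [h1 h2] : - B <= a <= B by apply/Rabs_le_between.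
split.
  by apply: Rmult_le_compat_r => //; apply: Rexp_le.
rewrite -Rmult_assoc -exp_plus -[X in X <= _]Rmult_1_l; apply: Rmult_le_compat_r => //.
by rewrite -exp_0; apply: Rexp_le; lra.
Qed.

Lemma within_factor_form A k k' u v : 0 < k -> 0 < k' -> 0 <= u -> 0 <= v ->
  within_factor A k k' -> within_factor A (k * u + v / k) (k' * u + v / k').
Proof.
move=> hk hk' hu hv [h1 h2].
have A0 : 0 < A by nra.
have i1 : / k <= A * / k'.
  apply: (Rmult_le_reg_l (k * k')); first nra.
  have -> : k * k' * / k = k' by field; lra.
  by have -> : k * k' * (A * / k') = A * k by field; lra.
have i2 : / k' <= A * / k.
  apply: (Rmult_le_reg_l (k * k')); first nra.
  have -> : k * k' * / k' = k by field; lra.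
  by have -> : k * k' * (A * / k) = A * k' by field; lra.
by rewrite /Rdiv; split; nra.
Qed.

(** * From a fixed scaled time to the final time *)

Lemma expo_bounds d (l : 'I_d.+1 -> R) : (forall i, -1 < l i) ->
  exists L, forall i, 0 < lmin l + 1 <= expo d.+1 l i /\ expo d.+1 l i <= L.
Proof.
move=> hl.
have [L [_ hL]] := finite_bound _ (fun i x => expo d.+1 l i <= x)
  (fun i x y h1 h2 => Rle_trans _ _ _ h2 h1) (fun i => ex_intro _ _ (Rle_refl _)).
exists L => i; split=> //; split.
  suff : -1 < lmin l by lra.
  apply: (big_ind (Rlt (-1))) => // x y hx hy; exact: Rmin_glb_lt.
suff : lmin l <= l i by rewrite /expo; lra.
rewrite /lmin; have : i \in index_enum 'I_d.+1 by rewrite mem_index_enum.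
elim: (index_enum _) => [//|k r IH]; rewrite big_cons in_cons => /orP [/eqP <-|hi].
  exact: Rmin_l.
by apply: Rle_trans (IH hi); exact: Rmin_r.
Qed.

Lemma vjbr_sq n (xi : 'I_n -> R) : vjbr xi ^ 2 = 1 + \big[Rplus/0]_i xi i ^ 2.
Proof.
rewrite /vjbr pow2_sqrt //; apply: Rplus_le_le_0_compat; first lra.
by apply: Rsum_ge0 => i; exact: pow2_ge_0.
Qed.

Lemma vjbr_ge1 n (xi : 'I_n -> R) : 1 <= vjbr xi.
Proof.
rewrite /vjbr -{1}sqrt_1; apply: sqrt_le_1_alt.
rewrite -[X in X <= _]Rplus_0_r; apply: Rplus_le_compat_l.
by apply: Rsum_ge0 => i; exact: pow2_ge_0.
Qed.

(** At [s = ln <<xi>> + x] the scaling undoes itself: the squared frequency is a weighted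
    sum of the [xi_i ^ 2], with weights that do not depend on [xi]. *)
Lemma vjbr_within_factor n (l : 'I_n -> R) (x : R) :
  exists A, 0 < A /\ forall xi,
    let k := sqrt (mom n (expo n l) (scaled n l xi) 0 (ln (djbr l xi) + x)) in
    1 <= k -> within_factor A k (vjbr xi).
Proof.
pose A1 := \big[Rplus/0]_i exp (2 * expo n l i * x).
pose A2 := \big[Rplus/0]_i exp (- (2 * expo n l i * x)).
have h1 : 0 <= A1 by apply: Rsum_ge0 => i; exact/Rlt_le/exp_pos.
have h2 : 0 <= A2 by apply: Rsum_ge0 => i; exact/Rlt_le/exp_pos.
exists (1 + A1 + A2); split; first by lra.
move=> xi k hk.
have k2 : k ^ 2 = \big[Rplus/0]_i (exp (2 * expo n l i * x) * xi i ^ 2).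
  by rewrite /k pow2_sqrt; [exact: mom_scaled | exact: mom_ge0].
have v1 := vjbr_ge1 n xi; have v2 := vjbr_sq n xi.
have u1 : k ^ 2 <= A1 * vjbr xi ^ 2.
  rewrite k2 Rmult_comm -Rsum_scal; apply: Rsum_le => i.
  rewrite Rmult_comm; apply: Rmult_le_compat_r; first exact/Rlt_le/exp_pos.
  rewrite v2; have := Rsum_term_le _ (fun i => xi i ^ 2) i (fun j => pow2_ge_0 _); lra.
have u2 : vjbr xi ^ 2 <= (1 + A2) * k ^ 2.
  have : \big[Rplus/0]_i xi i ^ 2 <= k ^ 2 * A2.
    rewrite -Rsum_scal; apply: Rsum_le => i.
    have e : exp (2 * expo n l i * x) * exp (- (2 * expo n l i * x)) = 1.
      by rewrite -exp_plus Rplus_opp_r exp_0.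
    have -> : xi i ^ 2 = (exp (2 * expo n l i * x) * xi i ^ 2) * exp (- (2 * expo n l i * x)).
      by rewrite -[LHS]Rmult_1_l -e; ring.
    apply: Rmult_le_compat_r; first exact/Rlt_le/exp_pos.
    rewrite k2; apply: (Rsum_term_le _ (fun i => exp (2 * expo n l i * x) * xi i ^ 2)) => j.
    by apply: Rmult_le_pos; [exact/Rlt_le/exp_pos | exact: pow2_ge_0].
  rewrite v2; nra.
have B : 1 + A1 + A2 <= (1 + A1 + A2) ^ 2 by nra.
split; apply: Rsqr_incr_0_var; try (by apply: Rmult_le_pos; lra); rewrite !Rsqr_pow2 Rpow_mult_distr.
  apply: Rle_trans u1 _; apply: Rmult_le_compat_r; first exact: pow2_ge_0.
  lra.
apply: Rle_trans u2 _; apply: Rmult_le_compat_r; first exact: pow2_ge_0.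
lra.
Qed.

Lemma Sol_within_factor q g S Y1 Y2 a b B : Sol q g S Y1 Y2 -> a <= b <= S ->
  (forall s, a <= s <= b -> Cmod (q s) <= B) ->
  within_factor (exp ((1 + 2 * Cmod (1 - g)%C + B) * (b - a))) (normsq Y1 Y2 a) (normsq Y1 Y2 b).
Proof. by move=> h1 h2 h3; have [] := Sol_gronwall _ _ _ _ _ _ _ _ h1 h2 h3. Qed.

Lemma normsq_ge0 Y1 Y2 s : 0 <= normsq Y1 Y2 s.
Proof.
by have := pow2_ge_0 (Cmod (Y1 s)); have := pow2_ge_0 (Cmod (Y2 s)); rewrite /normsq; lra.
Qed.

Definition final_energy (n : nat) (xi : 'I_n -> R) (y1 y2 : C) : R :=
  vjbr xi * Cmod y1 ^ 2 + Cmod y2 ^ 2 / vjbr xi.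

Lemma final_energy_ge0 n xi y1 y2 : 0 <= final_energy n xi y1 y2.
Proof.
have v := vjbr_ge1 n xi; apply: Rplus_le_le_0_compat.
  by apply: Rmult_le_pos; [lra | exact: pow2_ge_0].
by apply: Rdiv_le_0_compat; [exact: pow2_ge_0 | lra].
Qed.

(** For [<<xi>>] large there is a fixed time [s1] after which the frequency exceeds any
    given bound: the crude Gronwall estimate covers [s0, s1] and the energy estimate
    the rest.  The length of the latter interval is [ln <<xi>>] up to a constant, which
    costs the factor [<<xi>> ^ |c|] in the squared norms, while the exponential weight
    in the energy produces [<<xi>> ^ (Re g - 1)]. *)
Lemma hyperbolic_zone d (l : 'I_d.+1 -> R) (c : 'I_d.+1 -> C) (g : C) (x s0 : R) :
  (forall i, -1 < l i) -> s0 <= x ->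
  exists K Lam, 0 < K /\ 0 <= Lam /\ forall xi Y1 Y2,
    let lam := ln (djbr l xi) in
    Lam <= lam ->
    Sol (pot d.+1 (expo d.+1 l) c (scaled d.+1 l xi)) g (lam + x) Y1 Y2 ->
    within_factor (K * exp (cvnorm c * lam))
      (exp ((Re g - 1) * lam) * final_energy d.+1 xi (Y1 (lam + x)) (Y2 (lam + x)))
      (normsq Y1 Y2 s0).
Proof.
move=> hl hs0; have [L hb] := expo_bounds d l hl.
set lo := lmin l + 1 in hb; set b := expo d.+1 l; set gam := Re g - 1.
have hlo : 0 < lo by have [[]] := hb ord0.
have hbl i : 0 < lo <= b i by have [] := hb i.
have hbL i : lo <= b i <= L by have [[]] := hb i.
have hc0 : 0 <= cvnorm c by exact: sqrt_pos.
have [M [kmin [hM [hk1 EE]]]] := energy_estimate g (cvnorm c) lo L (4 * L ^ 2) hlo hc0.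
(* one scaled component has square at least 1/2, whence [2 kmin ^ 2] *)
pose s1 := Rmax (Rmax 0 s0) (ln (2 * kmin ^ 2) / (2 * lo)).
have s1_0 : 0 <= s1 by apply: Rle_trans (Rmax_l _ _); exact: Rmax_l.
have s1_s0 : s0 <= s1 by apply: Rle_trans (Rmax_l _ _); exact: Rmax_r.
have s1_k : 2 * kmin ^ 2 <= exp (2 * lo * s1).
  rewrite -[X in X <= _]exp_ln; last by nra.
  apply: Rexp_le; have h : ln (2 * kmin ^ 2) / (2 * lo) <= s1 by exact: Rmax_r.
  have := Rmult_le_compat_l (2 * lo) _ _ ltac:(lra) h.
  by have -> : 2 * lo * (ln (2 * kmin ^ 2) / (2 * lo)) = ln (2 * kmin ^ 2) by field; lra.
have [B [hB potB]] := pot_le d.+1 b c lo s1 hbl.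
have [A [hA vA]] := vjbr_within_factor d.+1 l x.
pose Kg := exp ((1 + 2 * Cmod (1 - g)%C + B * exp (lo * s1)) * (s1 - s0)).
pose km := 1 + sqrt B.
have hkm : 0 < km by rewrite /km; have := sqrt_pos B; lra.
pose K := exp (Rabs (gam * x)) * A * (M * exp (cvnorm c * Rabs (x - s1))) *
  exp (Rabs (gam * s1)) * km * Kg.
have hK : 0 < K.
  by rewrite /K /Kg; repeat apply: Rmult_lt_0_compat => //; exact: exp_pos.
exists K, (Rmax 0 (Rmax (s1 - x) (/ (2 * lo)))); split=> //; split; first exact: Rmax_l.
move=> xi Y1 Y2 lam hlam hY; set eta := scaled d.+1 l xi; rewrite -/b -/eta in hY.
have he i : Rabs (eta i) <= 1 by exact: scaled_le1.
have lam0 : 0 <= lam by apply: Rle_trans hlam; exact: Rmax_l.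
have lamx : s1 - x <= lam.
  by apply: Rle_trans hlam; apply: Rle_trans (Rmax_r _ _); exact: Rmax_l.
have lam1 : / (2 * lo) <= lam.
  by apply: Rle_trans hlam; apply: Rle_trans (Rmax_r _ _); exact: Rmax_r.
have [j hj] : exists j, / 2 <= eta j ^ 2.
  apply: (scaled_large d l xi lo hl hbl).
  have := Rmult_le_compat_l (2 * lo) _ _ ltac:(lra) lam1.
  by rewrite Rinv_r -/lam; lra.
set S := lam + x in hY *; have hS : s1 <= S by rewrite /S; lra.
pose m p s := mom d.+1 b eta p s.
have m_low s : s1 <= s -> kmin ^ 2 <= m 0%N s.
  move=> hs; have h1 : exp (2 * b j * s) * eta j ^ 2 <= m 0%N s.
    have := Rsum_term_le _ (fun i => (2 * b i) ^ 0 * (exp (2 * b i * s) * eta i ^ 2)) j.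
    rewrite pow_O Rmult_1_l; apply=> i; rewrite pow_O Rmult_1_l.
    by apply: Rmult_le_pos; [exact/Rlt_le/exp_pos | exact: pow2_ge_0].
  have h2 : exp (2 * lo * s1) <= exp (2 * b j * s).
    by apply: Rexp_le; have := hbl j; nra.
  nra.
have mpos s : s1 <= s -> 0 < m 0%N s by move=> /m_low; nra.
pose k s := sqrt (m 0%N s).
have kk s : k s ^ 2 = m 0%N s by rewrite /k pow2_sqrt //; exact: mom_ge0.
have k_low s : s1 <= s -> kmin <= k s.
  move=> /m_low h; rewrite /k -[X in X <= _]sqrt_pow2; last by lra.
  exact: sqrt_le_1_alt.
pose kap s := m 1%N s / (2 * m 0%N s).
pose dkap s := m 2%N s / (2 * m 0%N s) - m 1%N s ^ 2 / (2 * m 0%N s ^ 2).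
have HY : Sol (fun s => RtoC (k s ^ 2) + Ci * first_order d.+1 b c eta s)%C g S Y1 Y2.
  by move=> s hs; rewrite kk; exact: hY.
have H s : s1 <= s <= S -> kmin <= k s /\ is_derive k s (kap s * k s) /\
      is_derive kap s (dkap s) /\ lo <= kap s <= L /\ Rabs (dkap s) <= 4 * L ^ 2 /\
      Cmod (Ci * first_order d.+1 b c eta s)%C <= cvnorm c * k s.
  move=> [hs _]; have mp := mpos s hs.
  have [m1l m1u] := mom_bounds d.+1 b eta 1 s lo L hlo hbL.
  have [m2l m2u] := mom_bounds d.+1 b eta 2 s lo L hlo hbL.
  rewrite -!/(m _ s) !pow_1 in m1l m1u m2l m2u.
  have dm p : is_derive (m p) s (m p.+1 s) by exact: mom_derive.
  split; first exact: k_low.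
  split.
    have kp : 0 < k s by exact: sqrt_lt_R0.
    apply: Rderive_eq (is_derive_sqrt (m 0%N) s _ (dm 0%N) mp) _.
    by rewrite /kap -/(k s) -kk; field; lra.
  split.
    rewrite /kap; auto_derive.
      by repeat split; try (eexists; exact: dm); lra.
    have -> : Derive (fun s => m 1%N s) s = m 2%N s by exact: is_derive_unique.
    have -> : Derive (fun s => m 0%N s) s = m 1%N s by exact: is_derive_unique.
    by rewrite /dkap; field; lra.
  have q1 : lo <= kap s <= L.
    by rewrite /kap; split; [apply/Rle_div_r | apply/Rle_div_l]; lra.
  split=> //; split; last first.
    by rewrite Cmod_mult Cmod_Ci Rmult_1_l; exact: first_order_le.
  have -> : dkap s = m 2%N s / (2 * m 0%N s) - 2 * kap s ^ 2.
    by rewrite /dkap /kap; field; lra.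
  have q2 : 0 <= m 2%N s / (2 * m 0%N s) <= 2 * L ^ 2.
    split; first by apply: Rdiv_le_0_compat; [nra | lra].
    apply/Rle_div_l; first lra.
    by apply: Rle_trans m2u _; right; ring.
  by apply: Rabs_le; split; nra.
have [E1 E2] := EE S Y1 Y2 _ k kap dkap s1 hS HY H.
have cE : within_factor (M * exp (cvnorm c * (S - s1))) (energy gam k Y1 Y2 S)
    (energy gam k Y1 Y2 s1) by split.
have pY1 s := pow2_ge_0 (Cmod (Y1 s)); have pY2 s := pow2_ge_0 (Cmod (Y2 s)).
have kS : 1 <= k S by apply: Rle_trans hk1 _; exact: k_low.
have ks1 : 1 <= k s1 by apply: Rle_trans hk1 _; apply: k_low; lra.
have v1 := vjbr_ge1 d.+1 xi.
have c1 : within_factor A (final_energy d.+1 xi (Y1 S) (Y2 S))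
    (k S * Cmod (Y1 S) ^ 2 + Cmod (Y2 S) ^ 2 / k S).
  apply: within_factor_form => //; try lra.
  by apply: within_factor_sym; apply: vA.
have fe0 := final_energy_ge0 d.+1 xi (Y1 S) (Y2 S).
have c2 : within_factor (exp (Rabs (gam * x)) * A)
    (exp (gam * lam) * final_energy d.+1 xi (Y1 S) (Y2 S)) (energy gam k Y1 Y2 S).
  apply: within_factor_trans (_ : within_factor _ _ (exp (gam * S) * final_energy d.+1 xi (Y1 S) (Y2 S))) _.
  - exact/Rlt_le/exp_pos.
  - lra.
  - apply: within_factor_sym.
    have -> : exp (gam * S) * final_energy d.+1 xi (Y1 S) (Y2 S) =
      exp (gam * x) * (exp (gam * lam) * final_energy d.+1 xi (Y1 S) (Y2 S)).
      by rewrite -Rmult_assoc -exp_plus; congr (exp _ * _); rewrite /S; ring.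
    apply: within_factor_exp; first exact: Rle_refl.
    by apply: Rmult_le_pos => //; exact/Rlt_le/exp_pos.
  - by apply: within_factor_scal; [exact/Rlt_le/exp_pos | exact: c1].
have c3 : within_factor (exp (Rabs (gam * s1)) * km) (energy gam k Y1 Y2 s1) (normsq Y1 Y2 s1).
  have [mB _] := potB eta s1 he (Rle_refl _).
  have kB : k s1 <= km.
    by rewrite /km; have : k s1 <= sqrt B; [exact: sqrt_le_1_alt | lra].
  have cf : within_factor km (k s1 * Cmod (Y1 s1) ^ 2 + Cmod (Y2 s1) ^ 2 / k s1)
      (1 * Cmod (Y1 s1) ^ 2 + Cmod (Y2 s1) ^ 2 / 1).
    by apply: within_factor_form => //; try lra; split; nra.
  rewrite Rmult_1_l Rdiv_1_r in cf.
  apply: within_factor_trans (within_factor_exp _ _ _ (Rle_refl _) _) cf => //; try lra.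
  - exact/Rlt_le/exp_pos.
  - apply: Rplus_le_le_0_compat; first by apply: Rmult_le_pos; lra || exact: pY1.
    by apply: Rdiv_le_0_compat; [exact: pY2 | lra].
have c4 : within_factor Kg (normsq Y1 Y2 s1) (normsq Y1 Y2 s0).
  apply: within_factor_sym; apply: Sol_within_factor hY _ _; first by [].
  move=> s hs; have [_ h] := potB eta s he (proj2 hs).
  apply: Rle_trans h _; apply: Rmult_le_compat_l; first lra.
  by apply: Rexp_le; nra.
have e1 := exp_pos (Rabs (gam * x)); have e2 := exp_pos (Rabs (gam * s1)).
have e3 := exp_pos (cvnorm c * (S - s1)).
have c5 := within_factor_trans _ _ _ _ _ _ _ c2 (within_factor_trans _ _ _ _ _ _ _ cE
  (within_factor_trans _ _ _ _ _ _ _ c3 c4)).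
apply: within_factor_weaken (c5 _ _ _ _ _ _).
- by apply: Rmult_le_pos => //; exact/Rlt_le/exp_pos.
- exact: normsq_ge0.
- have -> : K * exp (cvnorm c * lam) = exp (Rabs (gam * x)) * A *
      (M * (exp (cvnorm c * Rabs (x - s1)) * exp (cvnorm c * lam)) *
        (exp (Rabs (gam * s1)) * km * Kg)).
    by rewrite /K; ring.
  have eK : 0 < Kg by exact: exp_pos.
  apply: Rmult_le_compat_l; first by nra.
  apply: Rmult_le_compat_r; first by apply: Rmult_le_pos; nra.
  apply: Rmult_le_compat_l; first lra.
  rewrite -exp_plus; apply: Rexp_le; have := Rle_abs (x - s1); rewrite /S; nra.
- by nra.
- by apply: Rmult_le_pos; [nra|apply: Rmult_le_pos; [nra| exact/Rlt_le/exp_pos]].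
- by nra.
- by apply: Rmult_le_pos; [nra|exact/Rlt_le/exp_pos].
- by nra.
- exact/Rlt_le/exp_pos.
Qed.

(** When [<<xi>>] is bounded, so are all weights and the length of the time interval,
    and the crude Gronwall estimate suffices. *)
Lemma final_time d (l : 'I_d.+1 -> R) (c : 'I_d.+1 -> C) (g : C) (x s0 : R) :
  (forall i, -1 < l i) -> s0 <= x ->
  exists K, 0 < K /\ forall xi Y1 Y2,
    let lam := ln (djbr l xi) in
    Sol (pot d.+1 (expo d.+1 l) c (scaled d.+1 l xi)) g (lam + x) Y1 Y2 ->
    within_factor (K * exp (cvnorm c * lam))
      (exp ((Re g - 1) * lam) * final_energy d.+1 xi (Y1 (lam + x)) (Y2 (lam + x)))
      (normsq Y1 Y2 s0).
Proof.
move=> hl hs0; have [L hb] := expo_bounds d l hl.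
set lo := lmin l + 1 in hb; set gam := Re g - 1.
have [K1 [Lam [hK1 [hLam H]]]] := hyperbolic_zone d l c g x s0 hl hs0.
pose b := expo d.+1 l.
have hbl i : 0 < lo <= b i by have [] := hb i.
have [B [hB potB]] := pot_le d.+1 b c lo (Lam + x) hbl.
pose Bm := B * exp (lo * (Lam + x)).
have hBm : 0 < Bm by apply: Rmult_lt_0_compat => //; exact: exp_pos.
pose G := 1 + 2 * Cmod (1 - g)%C + Bm.
have hG : 0 < G by rewrite /G; have := Cmod_ge_0 (1 - g)%C; lra.
pose V := 1 + \big[Rplus/0]_(i < d.+1) exp (b i * Lam) ^ 2.
have hV : 1 <= V.
  rewrite /V -[X in X <= _]Rplus_0_r; apply: Rplus_le_compat_l.
  by apply: Rsum_ge0 => i; exact: pow2_ge_0.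
pose K2 := exp (Rabs gam * Lam) * V * exp (G * (Lam + x - s0)).
have hK2 : 0 < K2.
  by rewrite /K2; repeat apply: Rmult_lt_0_compat; try exact: exp_pos; lra.
exists (K1 + K2); split; first lra.
move=> xi Y1 Y2 lam hY.
have lam0 : 0 <= lam.
  by rewrite /lam -ln_1; apply: ln_le; [lra | exact: djbr_ge1].
have hc0 : 0 <= cvnorm c by exact: sqrt_pos.
have ec : 1 <= exp (cvnorm c * lam).
  by rewrite -exp_0; apply: Rexp_le; exact: Rmult_le_pos.
have fe0 := final_energy_ge0 d.+1 xi (Y1 (lam + x)) (Y2 (lam + x)).
have p1 : 0 <= exp (gam * lam) * final_energy d.+1 xi (Y1 (lam + x)) (Y2 (lam + x)).
  by apply: Rmult_le_pos => //; exact/Rlt_le/exp_pos.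
have p2 := normsq_ge0 Y1 Y2 s0.
have [h|h] := Rle_lt_dec Lam lam.
  apply: within_factor_weaken (H xi Y1 Y2 h hY) => //.
  by apply: Rmult_le_compat_r; [exact/Rlt_le/exp_pos | lra].
have v1 := vjbr_ge1 d.+1 xi.
have vV : vjbr xi <= V.
  apply: Rle_trans (_ : vjbr xi ^ 2 <= V); first by move: v1; set v := vjbr xi; nra.
  rewrite vjbr_sq; apply: Rplus_le_compat_l; apply: Rsum_le => i.
  rewrite -(pow2_abs (xi i)); apply: pow_incr; split; first exact: Rabs_pos.
  apply: Rle_trans (Rabs_le_jbr _) _.
  have j1 := jbr_ge1 (xi i).
  rewrite -[X in X <= _]exp_ln; last lra.
  apply: Rexp_le; apply: Rle_trans (jbr_le_djbr _ l xi i hl) _.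
  by rewrite -/lam -/b; have := hbl i; nra.
have c1 : within_factor (exp (Rabs gam * Lam))
    (exp (gam * lam) * final_energy d.+1 xi (Y1 (lam + x)) (Y2 (lam + x)))
    (final_energy d.+1 xi (Y1 (lam + x)) (Y2 (lam + x))).
  apply: within_factor_exp => //; rewrite Rabs_mult (Rabs_pos_eq lam) //.
  by apply: Rmult_le_compat_l; [exact: Rabs_pos | lra].
have c2 : within_factor V (final_energy d.+1 xi (Y1 (lam + x)) (Y2 (lam + x)))
    (normsq Y1 Y2 (lam + x)).
  have -> : normsq Y1 Y2 (lam + x) = 1 * Cmod (Y1 (lam + x)) ^ 2 + Cmod (Y2 (lam + x)) ^ 2 / 1.
    by rewrite Rmult_1_l Rdiv_1_r.
  by apply: within_factor_form; try exact: pow2_ge_0; try lra; split; nra.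
have c3 : within_factor (exp (G * (Lam + x - s0))) (normsq Y1 Y2 (lam + x)) (normsq Y1 Y2 s0).
  apply: within_factor_sym.
  apply: within_factor_weaken (Sol_within_factor _ _ _ _ _ s0 (lam + x) Bm hY _ _).
  - exact: normsq_ge0.
  - exact: normsq_ge0.
  - by apply: Rexp_le; rewrite -/G; apply: Rmult_le_compat_l; lra.
  - by lra.
  - move=> s hs; have [_ ] := potB (scaled d.+1 l xi) s (fun i => scaled_le1 _ l xi i hl) ltac:(lra).
    move=> hh; apply: Rle_trans hh _; apply: Rmult_le_compat_l; first lra.
    by apply: Rexp_le; have [[]] := hb ord0; rewrite -/lo; nra.
have e1 := exp_pos (Rabs gam * Lam); have e2 := exp_pos (G * (Lam + x - s0)).
apply: within_factor_weaken (within_factor_trans _ _ _ _ _ _ _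
  (within_factor_trans _ _ _ _ _ _ _ c1 c2) c3) => //; try nra.
by rewrite -/K2; nra.
Qed.

(** * Limits of complex-valued functions *)

Lemma Cfilterlim_parts {X : Type} (F : (X -> Prop) -> Prop) (FF : Filter F) (f : X -> C) (z : C) :
  filterlim f F (locally z) <->
  filterlim (fun x => Re (f x)) F (locally (Re z)) /\
  filterlim (fun x => Im (f x)) F (locally (Im z)).
Proof.
split=> [h|[h1 h2]].
  split; apply/filterlim_locally => eps; move/filterlim_locally/(_ eps): h;
  by apply: filter_imp => x [].
apply/filterlim_locally => eps.
move/filterlim_locally/(_ eps): h1 => h1; move/filterlim_locally/(_ eps): h2 => h2.
by apply: filter_imp (filter_and _ _ h1 h2) => x [] ? ?; split.
Qed.

Lemma Rfilterlim_lincomb {X : Type} (F : (X -> Prop) -> Prop) (FF : Filter F)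
    (f h : X -> R) (u v x y : R) :
  filterlim f F (locally x) -> filterlim h F (locally y) ->
  filterlim (fun s => u * f s + v * h s) F (locally (u * x + v * y)).
Proof.
move=> hf hh.
apply: (filterlim_comp_2 (G := locally (u * x)) (H := locally (v * y)) _ _ Rplus).
- exact: filterlim_comp hf (filterlim_scal_r u x).
- exact: filterlim_comp hh (filterlim_scal_r v y).
- exact: (@filterlim_plus R_AbsRing R_NormedModule).
Qed.

Lemma Cfilterlim_lincomb {X : Type} (F : (X -> Prop) -> Prop) (FF : Filter F)
    (f h : X -> C) (a b p q : C) :
  filterlim f F (locally p) -> filterlim h F (locally q) ->
  filterlim (fun s => a * f s + b * h s)%C F (locally (a * p + b * q)%C).
Proof.
move=> /(Cfilterlim_parts F FF) [f1 f2] /(Cfilterlim_parts F FF) [h1 h2].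
apply/(Cfilterlim_parts F FF); split.
  have := Rfilterlim_lincomb F FF _ _ 1 1 _ _ (Rfilterlim_lincomb F FF _ _ (Re a) (- Im a) _ _ f1 f2)
    (Rfilterlim_lincomb F FF _ _ (Re b) (- Im b) _ _ h1 h2).
  have -> : Re (a * p + b * q)%C = 1 * (Re a * Re p + - Im a * Im p) + 1 * (Re b * Re q + - Im b * Im q).
    by rewrite /Re /Im /=; ring.
  by apply: filterlim_ext => x; rewrite /Re /Im /=; ring.
have := Rfilterlim_lincomb F FF _ _ 1 1 _ _ (Rfilterlim_lincomb F FF _ _ (Im a) (Re a) _ _ f1 f2)
  (Rfilterlim_lincomb F FF _ _ (Im b) (Re b) _ _ h1 h2).
have -> : Im (a * p + b * q)%C = 1 * (Im a * Re p + Re a * Im p) + 1 * (Im b * Re q + Re b * Im q).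
  by rewrite /Re /Im /=; ring.
by apply: filterlim_ext => x; rewrite /Re /Im /=; ring.
Qed.

Lemma Cfilterlim_scal {X : Type} (F : (X -> Prop) -> Prop) (FF : Filter F)
    (f : X -> C) (a p : C) :
  filterlim f F (locally p) -> filterlim (fun s => a * f s)%C F (locally (a * p)%C).
Proof.
move=> h; have := Cfilterlim_lincomb F FF f f a (RtoC 0) p p h h.
have -> : (a * p + RtoC 0 * p = a * p)%C by ring.
by apply: filterlim_ext => x; ring.
Qed.

Lemma Cfilterlim_unique {X : Type} (F : (X -> Prop) -> Prop) (FF : ProperFilter' F)
    (f : X -> C) (p q : C) :
  filterlim f F (locally p) -> filterlim f F (locally q) -> p = q.
Proof.
move=> /(Cfilterlim_parts F _) [a1 a2] /(Cfilterlim_parts F _) [b1 b2].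
apply: injective_projections.
  exact: (@filterlim_locally_unique X R_AbsRing R_NormedModule F FF (fun x => Re (f x)) _ _ a1 b1).
exact: (@filterlim_locally_unique X R_AbsRing R_NormedModule F FF (fun x => Im (f x)) _ _ a2 b2).
Qed.

Lemma Cfilterlim_modsq {X : Type} (F : (X -> Prop) -> Prop) (FF : Filter F)
    (f : X -> C) (p : C) :
  filterlim f F (locally p) ->
  filterlim (fun x => Cmod (f x) ^ 2) F (locally (Cmod p ^ 2)).
Proof.
move=> /(Cfilterlim_parts F FF) [f1 f2]; rewrite Cmod2_alt.
have sq h x : filterlim h F (locally x) -> filterlim (fun s : X => h s ^ 2) F (locally (x ^ 2)).
  move=> hh; apply: (filterlim_comp _ _ _ h (fun y => y ^ 2) F (locally x) _ hh).
  apply: (ex_derive_continuous (fun y => y ^ 2) x).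
  by auto_derive.
have := Rfilterlim_lincomb F FF _ _ 1 1 _ _ (sq _ _ f1) (sq _ _ f2).
rewrite !Rmult_1_l; apply: filterlim_ext => x.
by rewrite Cmod2_alt !Rmult_1_l.
Qed.

(** * Solutions of integrable systems near minus infinity *)

Definition Cderive (f : R -> C) (s : R) : C :=
  (Derive (fun x => Re (f x)) s, Derive (fun x => Im (f x)) s).

Lemma Cder_unique f s v : Cder f s v -> v = Cderive f s.
Proof.
move=> [h1 h2]; rewrite /Cderive.
by rewrite (is_derive_unique _ _ _ h1) (is_derive_unique _ _ _ h2); case: v {h1 h2}.
Qed.

Lemma Cfilterlim_cauchy_minfty (f : R -> C) (G : R -> R) (sig : R) :
  (forall a b, a <= b <= sig -> Rabs (Re (f b) - Re (f a)) <= G b /\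
     Rabs (Im (f b) - Im (f a)) <= G b) ->
  filterlim G (Rbar_locally m_infty) (locally 0) ->
  exists p : C, filterlim f (Rbar_locally m_infty) (locally p).
Proof.
move=> hf hG.
have cau (h : R -> R) : (forall a b, a <= b <= sig -> Rabs (h b - h a) <= G b) ->
    exists y, filterlim h (Rbar_locally m_infty) (locally y).
  move=> hh.
  have PF : ProperFilter (Rbar_locally m_infty) by exact: Rbar_locally_filter.
  apply/(@filterlim_locally_cauchy R R_CompleteSpace (Rbar_locally m_infty) PF h) => eps.
  move/filterlim_locally/(_ eps): hG => [M hM].
  exists (fun x => x < Rmin M sig); split; first by exists (Rmin M sig).
  have key u v : u <= v -> v < Rmin M sig -> Rabs (h v - h u) < eps.
    move=> huv hv; have v1 := Rlt_le_trans _ _ _ hv (Rmin_l _ _).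
    have v2 := Rlt_le_trans _ _ _ hv (Rmin_r _ _).
    apply: Rle_lt_trans (hh u v _) _; first lra.
    have := hM v v1; rewrite /ball /= /AbsRing_ball /abs /minus /plus /opp /= Ropp_0 Rplus_0_r.
    by have := Rle_abs (G v); lra.
  move=> u v hu hv; rewrite /ball /= /AbsRing_ball /abs /minus /plus /opp /=.
  have [h1|h1] := Rle_lt_dec u v; first exact: key.
  by rewrite -Rabs_Ropp Ropp_plus_distr Ropp_involutive Rplus_comm; apply: key => //; lra.
have [x hx] := cau (fun s => Re (f s)) (fun a b h => proj1 (hf a b h)).
have [y hy] := cau (fun s => Im (f s)) (fun a b h => proj2 (hf a b h)).
by exists (x, y); apply/(Cfilterlim_parts _ _); split.
Qed.

Lemma exp_lim_minfty M del : 0 < del ->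
  filterlim (fun s => M * exp (del * s)) (Rbar_locally m_infty) (locally 0).
Proof.
move=> hd.
have h : filterlim (fun s => exp (del * s)) (Rbar_locally m_infty) (locally 0).
  apply/filterlim_locally => eps; exists (ln eps / del) => x hx.
  rewrite /ball /= /AbsRing_ball /abs /minus /plus /opp /= Ropp_0 Rplus_0_r.
  rewrite Rabs_pos_eq; last exact/Rlt_le/exp_pos.
  rewrite -[X in _ < X]exp_ln; last by case: eps {hx}.
  apply: exp_increasing; move/(Rmult_lt_compat_l del _ _ hd): hx.
  by have -> : del * (ln eps / del) = ln eps by field; lra.
have := filterlim_comp _ _ _ _ _ _ _ _ h (filterlim_scal_r M 0).
by rewrite /scal /= /mult /= Rmult_0_r.
Qed.

(** The logarithmic derivative of [|psi1|^2 + |psi2|^2] is at most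
    [4 K exp (del s)], which is integrable at minus infinity: the norm varies by a
    bounded factor and both components are Cauchy. *)
Lemma integrable_limits (K del sig : R) (psi1 psi2 : R -> C) :
  0 <= K -> 0 < del ->
  (forall s, s <= sig -> exists v1 v2, Cder psi1 s v1 /\ Cder psi2 s v2 /\
     Cmod v1 + Cmod v2 <= K * exp (del * s) * (Cmod (psi1 s) + Cmod (psi2 s))) ->
  exists p1 p2 : C, filterlim psi1 (Rbar_locally m_infty) (locally p1) /\
    filterlim psi2 (Rbar_locally m_infty) (locally p2) /\
    within_factor (exp (4 * K / del * exp (del * sig)))
      (Cmod p1 ^ 2 + Cmod p2 ^ 2) (normsq psi1 psi2 sig).
Proof.
move=> hK hd H.
pose d1 := Cderive psi1; pose d2 := Cderive psi2.
have {}H s : s <= sig -> Cder psi1 s (d1 s) /\ Cder psi2 s (d2 s) /\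
     Cmod (d1 s) + Cmod (d2 s) <= K * exp (del * s) * (Cmod (psi1 s) + Cmod (psi2 s)).
  move=> hs; have [v1 [v2 [h1 [h2 h3]]]] := H s hs.
  by rewrite /d1 /d2 -(Cder_unique _ _ _ h1) -(Cder_unique _ _ _ h2).
pose n := normsq psi1 psi2.
pose dn s := 2 * (Re (psi1 s) * Re (d1 s) + Im (psi1 s) * Im (d1 s)) +
  2 * (Re (psi2 s) * Re (d2 s) + Im (psi2 s) * Im (d2 s)).
have hn s : s <= sig -> is_derive n s (dn s).
  move=> hs; have [h1 [h2 _]] := H s hs.
  exact: (@is_derive_plus R_AbsRing R_NormedModule _ _ _ _ _ (Cder_nsq _ _ _ h1) (Cder_nsq _ _ _ h2)).
have bn s : s <= sig -> Rabs (dn s) <= 4 * K * exp (del * s) * n s.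
  move=> hs; have [_ [_ h3]] := H s hs.
  apply: Rle_trans (Rabs_triang _ _) _; rewrite !Rabs_mult (Rabs_pos_eq 2); last lra.
  have i1 := Re_inner_le (psi1 s) (d1 s); have i2 := Re_inner_le (psi2 s) (d2 s).
  rewrite /n /normsq; move: h3 i1 i2.
  set x := Cmod (psi1 s); set y := Cmod (psi2 s); set u := Cmod (d1 s); set v := Cmod (d2 s).
  have x0 : 0 <= x by exact: Cmod_ge_0. have y0 : 0 <= y by exact: Cmod_ge_0.
  have u0 : 0 <= u by exact: Cmod_ge_0. have v0 : 0 <= v by exact: Cmod_ge_0.
  move=> h3 i1 i2.
  have ep : 0 <= K * exp (del * s) by apply: Rmult_le_pos => //; exact/Rlt_le/exp_pos.
  have a1 := Rmult_le_compat_l (x + y) _ _ ltac:(lra) h3.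
  have a2 : (x + y) * (x + y) <= 2 * (x ^ 2 + y ^ 2) by have := pow2_ge_0 (x - y); lra.
  have a3 := Rmult_le_compat_l _ _ _ ep a2.
  have a4 := Rmult_le_pos _ _ x0 v0; have a5 := Rmult_le_pos _ _ y0 u0.
  lra.
pose W s := 4 * K / del * exp (del * s).
have hW s : is_derive W s (4 * K * exp (del * s)).
  by rewrite /W; auto_derive => //; field; lra.
have Wpos s : 0 <= W s.
  apply: Rmult_le_pos; last exact/Rlt_le/exp_pos.
  by apply: Rdiv_le_0_compat => //; lra.
have n0 s : 0 <= n s by exact: normsq_ge0.
have wf s : s <= sig -> within_factor (exp (W sig)) (n s) (n sig).
  move=> hs.
  have e : exp (W sig - W s) <= exp (W sig) by apply: Rexp_le; have := Wpos s; lra.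
  split; apply: Rle_trans; try (apply: (Rmult_le_compat_r _ _ _ (n0 _) e)).
    apply: (gronwall_ge n dn W (fun s => 4 * K * exp (del * s))) => // x [_ hx].
      exact: hn.
    by have := Rle_abs (- dn x); rewrite Rabs_Ropp; have := bn x hx; lra.
  apply: (gronwall_le n dn W (fun s => 4 * K * exp (del * s))) => // x [_ hx].
    exact: hn.
  by have := Rle_abs (dn x); have := bn x hx; lra.
(* [x + y <= 1 + x ^ 2 + y ^ 2] turns the bound of the squares into a bound of the sum *)
pose B := 1 + exp (W sig) * n sig.
have bpsi s : s <= sig -> Cmod (psi1 s) + Cmod (psi2 s) <= B.
  move=> hs; have [h _] := wf s hs; apply: Rle_trans (_ : 1 + n s <= _); last by rewrite /B; lra.
  by rewrite /n /normsq; have := pow2_ge_0 (2 * Cmod (psi1 s) - 1);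
     have := pow2_ge_0 (2 * Cmod (psi2 s) - 1); nra.
pose M := K * B / del.
have hG s : is_derive (fun x => M * exp (del * x)) s (K * B * exp (del * s)).
  by rewrite /M; auto_derive => //; field; lra.
have B0 : 0 <= B by rewrite /B; have := n0 sig; have := exp_pos (W sig); nra.
have M0 : 0 <= M by apply: Rdiv_le_0_compat => //; exact: Rmult_le_pos.
have bd s : s <= sig -> Cmod (d1 s) <= K * B * exp (del * s) /\ Cmod (d2 s) <= K * B * exp (del * s).
  move=> hs; have [_ [_ h3]] := H s hs.
  have u1 := Cmod_ge_0 (d1 s); have u2 := Cmod_ge_0 (d2 s).
  have : K * exp (del * s) * (Cmod (psi1 s) + Cmod (psi2 s)) <= K * exp (del * s) * B.
    apply: Rmult_le_compat_l; last exact: bpsi.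
    by apply: Rmult_le_pos => //; exact/Rlt_le/exp_pos.
  by split; lra.
have lim (f df : R -> C) : (forall s, s <= sig -> Cder f s (df s)) ->
    (forall s, s <= sig -> Cmod (df s) <= K * B * exp (del * s)) ->
    exists p : C, filterlim f (Rbar_locally m_infty) (locally p).
  move=> hf hb.
  apply: (Cfilterlim_cauchy_minfty f (fun s => M * exp (del * s)) sig); last first.
    exact: exp_lim_minfty.
  move=> a b [hab hbs].
  have [||| q1 q2] := Cvariation_le f df (fun s => M * exp (del * s))
    (fun s => K * B * exp (del * s)) a b hab.
  - by move=> s hs; apply: hf; lra.
  - by move=> s hs.
  - by move=> s hs; apply: hb; lra.
  have : 0 <= M * exp (del * a) by apply: Rmult_le_pos => //; exact/Rlt_le/exp_pos.
  by move=> ?; split; lra.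
have [p1 hp1] := lim psi1 d1 (fun s hs => proj1 (H s hs)) (fun s hs => proj1 (bd s hs)).
have [p2 hp2] := lim psi2 d2 (fun s hs => proj1 (proj2 (H s hs))) (fun s hs => proj2 (bd s hs)).
exists p1, p2; split=> //; split=> //.
have FF : Filter (Rbar_locally m_infty) by apply: filter_filter; exact: (Rbar_locally_filter m_infty).
have PF : ProperFilter' (Rbar_locally m_infty) by exact: Proper_StrongProper.
have ln : filterlim n (Rbar_locally m_infty) (locally (Cmod p1 ^ 2 + Cmod p2 ^ 2)).
  have := Rfilterlim_lincomb _ FF _ _ 1 1 _ _ (Cfilterlim_modsq _ FF _ _ hp1) (Cfilterlim_modsq _ FF _ _ hp2).
  by rewrite !Rmult_1_l; apply: filterlim_ext => s; rewrite !Rmult_1_l.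
have near : Rbar_locally m_infty (fun s => s <= sig) by exists sig => s hs; exact: Rlt_le.
split.
  apply: (@filterlim_le _ (Rbar_locally m_infty) PF n (fun _ => exp (W sig) * n sig)
    (Finite _) (Finite _) _ ln (filterlim_const _)).
  by apply: filter_imp near => s hs; have [] := wf s hs.
have ln2 := filterlim_comp _ _ _ _ _ _ _ _ ln (filterlim_scal_r (exp (W sig)) (Cmod p1 ^ 2 + Cmod p2 ^ 2)).
apply: (@filterlim_le _ (Rbar_locally m_infty) PF (fun _ => n sig) _
    (Finite _) (Finite _) _ (filterlim_const _) ln2).
by apply: filter_imp near => s hs; have [] := wf s hs.
Qed.

(** * Complex powers *)

(** [exp (g s)] for real [s]: the power [t ^ g] read in the variable [s = ln t]. *)
Definition cexp (g : C) (s : R) : C :=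
  (exp (Re g * s) * cos (Im g * s), exp (Re g * s) * sin (Im g * s)).

Lemma Rcpow_cexp t g : Rcpow t g = cexp g (ln t).
Proof. by []. Qed.

Lemma cexp_derive g s : Cder (cexp g) s (g * cexp g s)%C.
Proof. by split; rewrite /cexp /Re /Im /=; auto_derive => //; ring. Qed.

Lemma cexp_plus g s t : cexp g (s + t) = (cexp g s * cexp g t)%C.
Proof.
rewrite /cexp !Rmult_plus_distr_l exp_plus cos_plus sin_plus.
by apply: injective_projections; rewrite /=; ring.
Qed.

Lemma cexp_plus_exp g h s : cexp (g + h)%C s = (cexp g s * cexp h s)%C.
Proof.
rewrite /cexp /Re /Im /= !Rmult_plus_distr_r exp_plus cos_plus sin_plus.
by apply: injective_projections; rewrite /=; ring.
Qed.

Lemma cexp_real (x s : R) : cexp (RtoC x) s = RtoC (exp (x * s)).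
Proof. by rewrite /cexp /= Rmult_0_l cos_0 sin_0 Rmult_1_r Rmult_0_r. Qed.

Lemma cexp_mod g s : Cmod (cexp g s) = exp (Re g * s).
Proof.
apply: Rsqr_inj; [exact: Cmod_ge_0 | exact/Rlt_le/exp_pos |].
rewrite !Rsqr_pow2 Cmod2_alt.
transitivity (exp (Re g * s) ^ 2 * (Rsqr (sin (Im g * s)) + Rsqr (cos (Im g * s)))).
  by rewrite /Rsqr /cexp {1}/Re {2}/Im /=; ring.
by rewrite sin2_cos2 Rmult_1_r.
Qed.

Lemma cexp_opp g s : (cexp (- g)%C s * cexp g s)%C = RtoC 1.
Proof.
rewrite -cexp_plus_exp; have -> : (- g + g)%C = RtoC 0 by ring.
by rewrite cexp_real Rmult_0_l exp_0.
Qed.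

(** * Symbol bounds in logarithmic time *)

Lemma log_power_le (del : R) (p : nat) : 0 < del ->
  exists K, 0 < K /\ forall s, s <= 0 -> (1 + Rabs s) ^ p <= K * exp (- (del * s)).
Proof.
move=> hd; elim: p del hd => [|p IH] del hd.
  exists 1; split=> [|s hs]; first lra.
  have : exp 0 <= exp (- (del * s)) by apply: Rexp_le; nra.
  by rewrite exp_0 /=; lra.
have [|K [hK h]] := IH (del / 2); first lra.
exists ((1 + 2 / del) * K); split.
  by apply: Rmult_lt_0_compat => //; have := Rdiv_lt_0_compat 2 del ltac:(lra) hd; lra.
move=> s hs; rewrite -tech_pow_Rmult.
have -> : (1 + 2 / del) * K * exp (- (del * s)) =
    ((1 + 2 / del) * exp (- (del / 2 * s))) * (K * exp (- (del / 2 * s))).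
  have -> : exp (- (del * s)) = exp (- (del / 2 * s)) * exp (- (del / 2 * s)).
    by rewrite -exp_plus; congr exp; field.
  by ring.
have a0 : 0 <= 1 + Rabs s by have := Rabs_pos s; lra.
apply: Rmult_le_compat => //; [exact: pow_le | | exact: h].
rewrite Rabs_left1 //.
have e1 := exp_ineq1_le (- (del / 2 * s)); have e0 : 1 <= exp (- (del / 2 * s)).
  by rewrite -exp_0; apply: Rexp_le; nra.
have e2 : 2 / del * (1 + - (del / 2 * s)) <= 2 / del * exp (- (del / 2 * s)).
  by apply: Rmult_le_compat_l => //; apply: Rdiv_le_0_compat; lra.
have e3 : 2 / del * (1 + - (del / 2 * s)) = 2 / del + - s by field; lra.
have := Rdiv_lt_0_compat 2 del ltac:(lra) hd; lra.
Qed.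

Lemma mnorm_ent (A : mat2) (i j : nat) : (i < 2)%N -> (j < 2)%N -> Cmod (ent A i j) <= mnorm A.
Proof.
rewrite /mnorm; case: i => [|[|i]] // _; case: j => [|[|j]] // _.
- by apply: Rle_trans (Rmax_l _ _); exact: Rmax_l.
- by apply: Rle_trans (Rmax_l _ _); exact: Rmax_r.
- by apply: Rle_trans (Rmax_r _ _); exact: Rmax_l.
- by apply: Rle_trans (Rmax_r _ _); exact: Rmax_r.
Qed.

(** An arbitrarily small loss in the exponent absorbs the powers of the logarithm. *)
Lemma symbol_le n (T : R) (l : 'I_n -> R) rho q (f : R -> ('I_n -> R) -> mat2) q' :
  rho < 1 -> (forall xi, 0 < djbr l xi) -> symbol T l rho q f -> q' < q ->
  exists K, 0 < K /\ forall t xi, ZP T l rho t xi -> forall i j, (i < 2)%N -> (j < 2)%N ->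
    Cmod (ent (f t xi) i j) <= K * exp (q' * ln (zvar l t xi)).
Proof.
move=> hrho hlam [_ [F [p [F0 [_ FB]]]]] hq.
have [C0 hC0] := FB 0%N.
have [K [hK h]] := log_power_le (q - q') p ltac:(lra).
exists ((Rabs C0 + 1) * K); split.
  by apply: Rmult_lt_0_compat => //; have := Rabs_pos C0; lra.
move=> t xi hz i j hi hj; rewrite -F0 //.
apply: Rle_trans (mnorm_ent _ _ _ hi hj) _.
apply: Rle_trans (hC0 t xi hz) _.
have z0 : 0 < zvar l t xi by apply: Rmult_lt_0_compat => //; case: hz => [[]].
set z := zvar l t xi in z0 *.
have hs : ln z <= 0.
  by rewrite -ln_1; apply: ln_le => //; case: hz => _; rewrite -/z; lra.
have ep := exp_pos (q * ln z); rewrite /Rpower.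
have pp : 0 <= (1 + Rabs (ln z)) ^ p by apply: pow_le; have := Rabs_pos (ln z); lra.
have h1 := h _ hs.
have -> : (Rabs C0 + 1) * K * exp (q' * ln z) =
   (Rabs C0 + 1) * exp (q * ln z) * (K * exp (- ((q - q') * ln z))).
  have -> : exp (q' * ln z) = exp (q * ln z) * exp (- ((q - q') * ln z)).
    by rewrite -exp_plus; congr exp; ring.
  by ring.
have := Rle_abs C0 => h2; have := Rabs_pos C0 => h3.
apply: Rle_trans (_ : (Rabs C0 + 1) * exp (q * ln z) * (1 + Rabs (ln z)) ^ p <= _).
  by apply: Rmult_le_compat_r => //; apply: Rmult_le_compat_r; lra.
by apply: Rmult_le_compat_l => //; apply: Rmult_le_pos; lra.
Qed.

(** * Entries of 2x2 matrices *)

Lemma ent_mult (A B : mat2) i j : (i < 2)%N -> (j < 2)%N ->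
  ent (A * B)%M i j = (ent A i 0 * ent B 0 j + ent A i 1 * ent B 1 j)%C.
Proof.
move=> /ltP hi /ltP hj; rewrite /ent /Mmult coeff_mat_bij //.
by rewrite sum_Sn sum_O.
Qed.

Lemma ent_plus (A B : mat2) i j : (i < 2)%N -> (j < 2)%N ->
  ent (A + B)%M i j = (ent A i j + ent B i j)%C.
Proof. by move=> /ltP hi /ltP hj; rewrite /ent /Mplus coeff_mat_bij. Qed.

Lemma ent_minus (A B : mat2) i j : (i < 2)%N -> (j < 2)%N ->
  ent (A - B)%M i j = (ent A i j - ent B i j)%C.
Proof. by move=> /ltP hi /ltP hj; rewrite /ent /Mplus /Mopp !coeff_mat_bij. Qed.

Lemma ent_scal a (A : mat2) i j : (i < 2)%N -> (j < 2)%N ->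
  ent (mscal a A) i j = (a * ent A i j)%C.
Proof. by move=> /ltP hi /ltP hj; rewrite {1}/ent /mscal coeff_mat_bij. Qed.

Lemma ent_msum (F : nat -> mat2) m i j : (i < 2)%N -> (j < 2)%N ->
  ent (msum F m) i j = \big[Cplus/RtoC 0]_(1 <= k < m.+1) ent (F k) i j.
Proof.
move=> hi hj; rewrite /msum.
apply: (big_morph (fun A => ent A i j)) => [A B|]; first exact: ent_plus.
by move/ltP: hi => hi; move/ltP: hj => hj; rewrite /ent /Mzero coeff_mat_bij.
Qed.

Lemma ent_mk22 a b c d : (ent (mk22 a b c d) 0 0 = a) * (ent (mk22 a b c d) 0 1 = b) *
  (ent (mk22 a b c d) 1 0 = c) * (ent (mk22 a b c d) 1 1 = d).
Proof. by []. Qed.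

Lemma ent_one : (ent (@Mone C_Ring 2) 0 0 = RtoC 1) * (ent (@Mone C_Ring 2) 0 1 = RtoC 0) *
  (ent (@Mone C_Ring 2) 1 0 = RtoC 0) * (ent (@Mone C_Ring 2) 1 1 = RtoC 1).
Proof. by []. Qed.

(** * Asymptotic data of solutions *)

(** Linearity in the Cauchy data at each time; complex superposition of solutions then
    passes to their asymptotic data. *)
Definition linear_readout (p : R -> C -> C -> C) : Prop :=
  forall s a b y1 y2 x1 x2,
    p s (a * y1 + b * x1)%C (a * y2 + b * x2)%C = (a * p s y1 y2 + b * p s x1 x2)%C.

(** [p1] and [p2] read off, from the Cauchy data of a solution at time [s], two
    quantities that converge at minus infinity, to limits comparable with the
    Cauchy data at [sig]. *)
Definition asymptotic_map (q : R -> C) (g : C) (sig K : R) (p1 p2 : R -> C -> C -> C) : Prop :=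
  linear_readout p1 /\ linear_readout p2 /\
  forall S Y1 Y2, sig <= S -> Sol q g S Y1 Y2 ->
    exists l1 l2 : C,
      filterlim (fun s => p1 s (Y1 s) (Y2 s)) (Rbar_locally m_infty) (locally l1) /\
      filterlim (fun s => p2 s (Y1 s) (Y2 s)) (Rbar_locally m_infty) (locally l2) /\
      within_factor K (Cmod l1 ^ 2 + Cmod l2 ^ 2) (normsq Y1 Y2 sig).

Lemma sumsq_le K (x y x' y' : R) : 0 <= x' -> 0 <= y' ->
  x' <= K * (x + y) -> y' <= K * (x + y) ->
  x' ^ 2 + y' ^ 2 <= 4 * K ^ 2 * (x ^ 2 + y ^ 2).
Proof.
move=> hx hy h1 h2.
have e1 : x' ^ 2 <= (K * (x + y)) ^ 2 by apply: pow_incr.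
have e2 : y' ^ 2 <= (K * (x + y)) ^ 2 by apply: pow_incr.
have e3 : (x + y) ^ 2 <= 2 * (x ^ 2 + y ^ 2) by have := pow2_ge_0 (x - y); lra.
have := Rmult_le_compat_l _ _ _ (pow2_ge_0 K) e3; rewrite Rpow_mult_distr in e1 e2; lra.
Qed.

Lemma asymptotic_map_intro q g sig K del A p1 p2 :
  0 <= K -> 0 < del -> linear_readout p1 -> linear_readout p2 ->
  (forall S Y1 Y2, sig <= S -> Sol q g S Y1 Y2 -> forall s, s <= sig ->
     exists v1 v2, Cder (fun s => p1 s (Y1 s) (Y2 s)) s v1 /\
       Cder (fun s => p2 s (Y1 s) (Y2 s)) s v2 /\
       Cmod v1 + Cmod v2 <= K * exp (del * s) *
         (Cmod (p1 s (Y1 s) (Y2 s)) + Cmod (p2 s (Y1 s) (Y2 s)))) ->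
  (forall y1 y2, Cmod (p1 sig y1 y2) <= A * (Cmod y1 + Cmod y2) /\
     Cmod (p2 sig y1 y2) <= A * (Cmod y1 + Cmod y2) /\
     Cmod y1 <= A * (Cmod (p1 sig y1 y2) + Cmod (p2 sig y1 y2)) /\
     Cmod y2 <= A * (Cmod (p1 sig y1 y2) + Cmod (p2 sig y1 y2))) ->
  asymptotic_map q g sig (exp (4 * K / del * exp (del * sig)) * (4 * A ^ 2)) p1 p2.
Proof.
move=> hK hd b1 b2 H HA; split=> //; split=> // S Y1 Y2 hS hY.
have [l1 [l2 [h1 [h2 h3]]]] := integrable_limits K del sig _ _ hK hd (H S Y1 Y2 hS hY).
exists l1, l2; split=> //; split=> //.
apply: within_factor_trans h3 _; first exact/Rlt_le/exp_pos.
  by have := pow2_ge_0 A; lra.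
have [a1 [a2 [a3 a4]]] := HA (Y1 sig) (Y2 sig).
by split; apply: sumsq_le => //; exact: Cmod_ge_0.
Qed.

(** In the resonant case the solution grows logarithmically: [Y1 - s Y2] and [Y2]
    have derivatives [s q Y1] and [- q Y1]. *)
Lemma asymptotic_map_resonant n (b : 'I_n -> R) (c : 'I_n -> C) lo sig :
  (forall i, 0 < lo <= b i) -> 0 < lo -> sig <= 0 ->
  exists K, 0 < K /\ forall eta, (forall i, Rabs (eta i) <= 1) ->
    asymptotic_map (pot n b c eta) (RtoC 1) sig K
      (fun s y1 y2 => y1 - RtoC s * y2)%C (fun s y1 y2 => y2).
Proof.
move=> hb hlo hsig.
have [B [hB potB]] := pot_le n b c lo sig hb.
have [K0 [hK0 logB]] := log_power_le (lo / 2) 2 ltac:(lra).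
pose A := 1 + Rabs sig.
have hA : 1 <= A by rewrite /A; have := Rabs_pos sig; lra.
exists (exp (4 * (B * K0) / (lo / 2) * exp (lo / 2 * sig)) * (4 * A ^ 2)); split.
  by apply: Rmult_lt_0_compat; [exact: exp_pos | nra].
move=> eta he; apply: asymptotic_map_intro; try lra; first by nra.
- by move=> s a a' y1 y2 x1 x2; ring.
- by [].
- move=> S Y1 Y2 hS hY s hs; have [y1 y2] := hY s ltac:(lra).
  exists (RtoC s * (pot n b c eta s * Y1 s))%C, (- (pot n b c eta s * Y1 s))%C.
  split.
    apply: Cder_eq.
      apply: Cder_plus; first exact: y1.
      apply: Cder_opp; apply: Cder_mult; last exact: y2.
      by apply: Cder_RtoC; exact: (is_derive_id s).
    rewrite /one /=; ring.
  split; first by apply: Cder_eq y2 _; ring.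
  rewrite Cmod_opp !Cmod_mult Cmod_R.
  have [_ hp] := potB eta s he hs.
  have hl := logB s ltac:(lra).
  set P1 := Cmod (Y1 s - RtoC s * Y2 s)%C; set P2 := Cmod (Y2 s).
  have hY1 : Cmod (Y1 s) <= P1 + Rabs s * P2.
    have {1}-> : Y1 s = ((Y1 s - RtoC s * Y2 s) + RtoC s * Y2 s)%C by ring.
    by apply: Rle_trans (Cmod_triangle _ _) _; rewrite Cmod_mult Cmod_R; exact: Rle_refl.
  have p1 : 0 <= P1 by exact: Cmod_ge_0. have p2 : 0 <= P2 by exact: Cmod_ge_0.
  have rs := Rabs_pos s.
  have hY1' : Cmod (Y1 s) <= (1 + Rabs s) * (P1 + P2) by nra.
  have q0 := Cmod_ge_0 (pot n b c eta s).
  have -> : Rabs s * (Cmod (pot n b c eta s) * Cmod (Y1 s)) + Cmod (pot n b c eta s) * Cmod (Y1 s)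
     = (1 + Rabs s) * Cmod (pot n b c eta s) * Cmod (Y1 s) by ring.
  apply: Rle_trans (_ : (1 + Rabs s) * (B * exp (lo * s)) * ((1 + Rabs s) * (P1 + P2)) <= _).
    apply: Rmult_le_compat => //.
    - by apply: Rmult_le_pos; lra.
    - exact: Cmod_ge_0.
    - by apply: Rmult_le_compat_l; lra.
  have -> : (1 + Rabs s) * (B * exp (lo * s)) * ((1 + Rabs s) * (P1 + P2)) =
     B * exp (lo * s) * (P1 + P2) * (1 + Rabs s) ^ 2 by ring.
  have -> : B * K0 * exp (lo / 2 * s) * (P1 + P2) =
     B * exp (lo * s) * (P1 + P2) * (K0 * exp (- (lo / 2 * s))).
    have -> : exp (lo / 2 * s) = exp (lo * s) * exp (- (lo / 2 * s)).
      by rewrite -exp_plus; congr exp; field.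
    by ring.
  apply: Rmult_le_compat_l => //; apply: Rmult_le_pos; last lra.
  by apply: Rmult_le_pos; [lra | exact/Rlt_le/exp_pos].
- move=> y1 y2; set P1 := Cmod (y1 - _)%C.
  have rs := Rabs_pos sig; have u1 := Cmod_ge_0 y1; have u2 := Cmod_ge_0 y2.
  have u3 : 0 <= P1 by exact: Cmod_ge_0.
  have h1 : P1 <= Cmod y1 + Rabs sig * Cmod y2.
    by apply: Rle_trans (Cmod_triangle _ _) _; rewrite Cmod_opp Cmod_mult Cmod_R; lra.
  have h2 : Cmod y1 <= P1 + Rabs sig * Cmod y2.
    have {1}-> : y1 = ((y1 - RtoC sig * y2) + RtoC sig * y2)%C by ring.
    by apply: Rle_trans (Cmod_triangle _ _) _; rewrite Cmod_mult Cmod_R; exact: Rle_refl.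
  rewrite /A; repeat split; nra.
Qed.

(** With [w = ((g - 1) Y1 + Y2, Y2)] the vector [Q w] solves a system whose diagonal is
    [(D 0, 1 - g + D 1)] and whose remainder is [Rm w].  Conjugation by
    [diag (1, exp ((g - 1) s))] removes [1 - g] and multiplies the off-diagonal part of
    the remainder by [exp (+- (Re g - 1) s)]; the decay rate [|Re g - 1| + del] required of
    [Rm] leaves an integrable system. *)
Lemma asymptotic_map_nonresonant (g : C) (sig del KD KR : R) :
  g <> RtoC 1 -> sig <= 0 -> 0 < del -> 0 <= KD -> 0 <= KR ->
  exists K, 0 < K /\ forall (q r : R -> C) (Q Rm : nat -> nat -> R -> C) (D : nat -> R -> C),
    (forall s, q s = (r s * (g - 1))%C) ->
    (forall i s, (i < 2)%N -> s <= sig ->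
      let B := if i is 0 then RtoC (-1) else (- g)%C in
      Cder (Q i 0%N) s (Rm i 0%N s - (Q i 0%N s * (- 1 - r s) + Q i 1%N s * (- r s))
        + (B + D i s) * Q i 0%N s)%C /\
      Cder (Q i 1%N) s (Rm i 1%N s - (Q i 0%N s * r s + Q i 1%N s * (r s - g))
        + (B + D i s) * Q i 1%N s)%C /\
      Cmod (D i s) <= KD * exp (del * s)) ->
    (forall i j s, (i < 2)%N -> (j < 2)%N -> s <= sig ->
      Cmod (Rm i j s) <= KR * exp ((Rabs (Re g - 1) + del) * s) /\
      Cmod (Q i j s - (if i == j then 1 else 0))%C <= / 4) ->
    asymptotic_map q g sig K
      (fun s y1 y2 => Q 0%N 0%N s * ((g - 1) * y1 + y2) + Q 0%N 1%N s * y2)%C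
      (fun s y1 y2 => cexp (g - 1) s *
         (Q 1%N 0%N s * ((g - 1) * y1 + y2) + Q 1%N 1%N s * y2))%C.
Proof.
move=> hg hsig hdel hKD hKR.
have g1 : (g - 1)%C <> RtoC 0.
  by move=> e; apply: hg; transitivity ((g - 1) + 1)%C; [ring | rewrite e; ring].
set gam := Re g - 1; set m := Cmod (g - 1)%C.
have m0 : 0 < m by apply/Cmod_gt_0.
have im : 0 < / m by exact: Rinv_0_lt_compat.
pose E := exp (Rabs gam * Rabs sig).
have hE : 1 <= E.
  rewrite /E -exp_0; apply: Rexp_le.
  by apply: Rmult_le_pos; exact: Rabs_pos.
pose A := 4 * E * (2 + m + 2 * / m).
pose K0 := KD + 4 * KR.
exists (exp (4 * K0 / del * exp (del * sig)) * (4 * A ^ 2)); split.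
  apply: Rmult_lt_0_compat; first exact: exp_pos.
  have : 0 < A by rewrite /A; apply: Rmult_lt_0_compat; lra.
  nra.
move=> q r Q Rm D hq HQ HR.
have Recg : Re (g - 1)%C = gam by rewrite /gam /Re /=; ring.
have Emod s : Cmod (cexp (g - 1)%C s) = exp (gam * s) by rewrite cexp_mod Recg.
(* [w] is controlled by [Q w] since [Q] is close to the identity *)
have near s (w1 w2 : C) : s <= sig ->
   Cmod w1 + Cmod w2 <= 2 * (Cmod (Q 0%N 0%N s * w1 + Q 0%N 1%N s * w2)%C
     + Cmod (Q 1%N 0%N s * w1 + Q 1%N 1%N s * w2)%C) /\
   Cmod (Q 0%N 0%N s * w1 + Q 0%N 1%N s * w2)%C <= 2 * (Cmod w1 + Cmod w2) /\
   Cmod (Q 1%N 0%N s * w1 + Q 1%N 1%N s * w2)%C <= 2 * (Cmod w1 + Cmod w2).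
  move=> hs.
  have [_ q00] := HR 0%N 0%N s erefl erefl hs; have [_ q01] := HR 0%N 1%N s erefl erefl hs.
  have [_ q10] := HR 1%N 0%N s erefl erefl hs; have [_ q11] := HR 1%N 1%N s erefl erefl hs.
  rewrite /= in q00 q01 q10 q11.
  have n1 := Cmod_ge_0 w1; have n2 := Cmod_ge_0 w2.
  have bnd (a b : C) : Cmod a <= / 4 -> Cmod b <= / 4 ->
      Cmod (a * w1 + b * w2)%C <= / 4 * (Cmod w1 + Cmod w2).
    move=> ha hb; apply: Rle_trans (Cmod_triangle _ _) _; rewrite !Cmod_mult; nra.
  have e1 := bnd _ _ q00 q01; have e2 := bnd _ _ q10 q11.
  have i1 : (Q 0%N 0%N s * w1 + Q 0%N 1%N s * w2)%C =
    (w1 + ((Q 0%N 0%N s - 1) * w1 + (Q 0%N 1%N s - 0) * w2))%C by ring.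
  have i2 : (Q 1%N 0%N s * w1 + Q 1%N 1%N s * w2)%C =
    (w2 + ((Q 1%N 0%N s - 0) * w1 + (Q 1%N 1%N s - 1) * w2))%C by ring.
  have low (u e : C) : Cmod u <= Cmod (u + e)%C + Cmod e.
    have {1}-> : u = ((u + e) + - e)%C by ring.
    by apply: Rle_trans (Cmod_triangle _ _) _; rewrite Cmod_opp; exact: Rle_refl.
  rewrite i1 i2; set e0 := ((Q 0%N 0%N s - 1) * w1 + _)%C in e1 *.
  set e3 := ((Q 1%N 0%N s - 0) * w1 + _)%C in e2 *.
  have l1 := low w1 e0; have l2 := low w2 e3.
  have t1 := Cmod_triangle w1 e0; have t2 := Cmod_triangle w2 e3.
  by split; [lra | split; lra].
apply: (asymptotic_map_intro _ _ _ K0 del A) => //.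
- by rewrite /K0; lra.
- by move=> s a b y1 y2 x1 x2; ring.
- by move=> s a b y1 y2 x1 x2; ring.
- move=> S Y1 Y2 hS hY s hs; have [y1 y2] := hY s ltac:(lra).
  pose w1 x := ((g - 1) * Y1 x + Y2 x)%C.
  have dw1 : Cder w1 s (- q s * Y1 s)%C.
    apply: Cder_eq; first by apply: Cder_plus y2; apply: Cder_scal; exact: y1.
    by ring.
  have [Q00 [Q01 hD0]] := HQ 0%N s erefl hs; have [Q10 [Q11 hD1]] := HQ 1%N s erefl hs.
  have [R00 _] := HR 0%N 0%N s erefl erefl hs; have [R01 _] := HR 0%N 1%N s erefl erefl hs.
  have [R10 _] := HR 1%N 0%N s erefl erefl hs; have [R11 _] := HR 1%N 1%N s erefl erefl hs.
  rewrite /= -/gam in R00 R01 R10 R11.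
  pose x1 x := (Q 0%N 0%N x * w1 x + Q 0%N 1%N x * Y2 x)%C.
  pose x2 x := (Q 1%N 0%N x * w1 x + Q 1%N 1%N x * Y2 x)%C.
  pose f1 := (Rm 0%N 0%N s * w1 s + Rm 0%N 1%N s * Y2 s)%C.
  pose f2 := (Rm 1%N 0%N s * w1 s + Rm 1%N 1%N s * Y2 s)%C.
  have dx1 : Cder x1 s (D 0%N s * x1 s + f1)%C.
    apply: Cder_eq; first by apply: Cder_plus; apply: Cder_mult; eassumption.
    by rewrite /= /x1 /f1 /w1 hq; ring.
  have dx2 : Cder x2 s ((1 - g + D 1%N s) * x2 s + f2)%C.
    apply: Cder_eq; first by apply: Cder_plus; apply: Cder_mult; eassumption.
    by rewrite /= /x2 /f2 /w1 hq; ring.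
  exists (D 0%N s * x1 s + f1)%C, (D 1%N s * (cexp (g - 1) s * x2 s) + cexp (g - 1) s * f2)%C.
  split; first exact: dx1.
  split.
    apply: Cder_eq; first by apply: Cder_mult; [exact: cexp_derive | exact: dx2].
    by rewrite /x2 /w1; ring.
  rewrite -/(w1 s) -/(x1 s) -/(x2 s) !Cmod_mult Emod.
  have [nw _] := near s (w1 s) (Y2 s) hs; rewrite -/(x1 s) -/(x2 s) in nw.
  set W := Cmod (w1 s) + Cmod (Y2 s) in nw.
  have n1 := Cmod_ge_0 (w1 s); have n2 := Cmod_ge_0 (Y2 s).
  have n3 := Cmod_ge_0 (x1 s); have n4 := Cmod_ge_0 (x2 s).
  set rr := exp ((Rabs gam + del) * s) in R00 R01 R10 R11.
  have rr0 : 0 < rr by exact: exp_pos.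
  have bf (a b : C) : Cmod a <= KR * rr -> Cmod b <= KR * rr ->
      Cmod (a * w1 s + b * Y2 s)%C <= KR * rr * W.
    move=> ha hb; apply: Rle_trans (Cmod_triangle _ _) _; rewrite !Cmod_mult /W; nra.
  have bf1 := bf _ _ R00 R01; have bf2 := bf _ _ R10 R11.
  rewrite -/f1 -/f2 in bf1 bf2.
  set eg := exp (gam * s); have eg0 : 0 < eg by exact: exp_pos.
  set ed := exp (del * s) in hD0 hD1 *; have ed0 : 0 < ed by exact: exp_pos.
  pose ea := exp (Rabs gam * s); have ea0 : 0 < ea by exact: exp_pos.
  have rrE : rr = ea * ed by rewrite /rr /ea /ed -exp_plus; congr exp; ring.
  have s0 : s <= 0 by lra.
  have ea1 : ea <= 1 by rewrite -exp_0; apply: Rexp_le; have := Rabs_pos gam; nra.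
  have ea2 : ea <= eg.
    by apply: Rexp_le; have := Rle_abs gam; nra.
  have ea3 : ea * eg <= 1.
    rewrite /ea /eg -exp_plus -exp_0; apply: Rexp_le.
    by have := Rle_abs (- gam); rewrite Rabs_Ropp; nra.
  have m1 : Cmod (D 0%N s * x1 s + f1)%C <= KD * ed * Cmod (x1 s) + KR * rr * W.
    apply: Rle_trans (Cmod_triangle _ _) _; rewrite Cmod_mult.
    by apply: Rplus_le_compat => //; apply: Rmult_le_compat_r.
  have m2 : Cmod (D 1%N s * (cexp (g - 1) s * x2 s) + cexp (g - 1) s * f2)%C <=
      KD * ed * (eg * Cmod (x2 s)) + eg * (KR * rr * W).
    apply: Rle_trans (Cmod_triangle _ _) _; rewrite !Cmod_mult Emod -/eg.
    apply: Rplus_le_compat; last by apply: Rmult_le_compat_l => //; lra.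
    by apply: Rmult_le_compat_r => //; apply: Rmult_le_pos; lra.
  have key : rr * W + eg * (rr * W) <= 4 * ed * (Cmod (x1 s) + eg * Cmod (x2 s)).
    rewrite rrE.
    have w0 : 0 <= W by rewrite /W; lra.
    have b1 : (1 + eg) * ea * W <= (1 + eg) * ea * (2 * (Cmod (x1 s) + Cmod (x2 s))).
      by apply: Rmult_le_compat_l => //; nra.
    have b2 : (1 + eg) * ea <= 2 by lra.
    have b3 : (1 + eg) * ea <= 2 * eg.
      have : eg * ea <= eg * 1 by apply: Rmult_le_compat_l; lra.
      lra.
    have b4 := Rmult_le_compat_r _ _ _ n3 b2; have b5 := Rmult_le_compat_r _ _ _ n4 b3.
    have b6 : (1 + eg) * ea * W <= 4 * (Cmod (x1 s) + eg * Cmod (x2 s)) by lra.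
    have := Rmult_le_compat_l _ _ _ (Rlt_le _ _ ed0) b6; lra.
  have := Rmult_le_compat_l _ _ _ hKR key; rewrite /K0; lra.
- move=> y1 y2; set w1 := ((g - 1) * y1 + y2)%C.
  have [nw [nx1 nx2]] := near sig w1 y2 (Rle_refl _).
  set x1 := (Q 0%N 0%N sig * w1 + _)%C in nw nx1 *.
  set x2 := (Q 1%N 0%N sig * w1 + _)%C in nw nx2 *.
  rewrite Cmod_mult Emod.
  have u1 := Cmod_ge_0 y1; have u2 := Cmod_ge_0 y2.
  have v1 := Cmod_ge_0 x1; have v2 := Cmod_ge_0 x2.
  have hw : Cmod w1 <= m * Cmod y1 + Cmod y2.
    by apply: Rle_trans (Cmod_triangle _ _) _; rewrite Cmod_mult; exact: Rle_refl.
  have hy : Cmod y1 <= / m * (Cmod w1 + Cmod y2).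
    have -> : y1 = (/ (g - 1) * (w1 + - y2))%C by rewrite /w1; field.
    rewrite Cmod_mult Cmod_inv // -/m; apply: Rmult_le_compat_l; first lra.
    by apply: Rle_trans (Cmod_triangle _ _) _; rewrite Cmod_opp; exact: Rle_refl.
  set eg := exp (gam * sig).
  have eg1 : eg <= E.
    apply: Rexp_le; apply: Rle_trans (Rle_abs _) _; rewrite Rabs_mult; exact: Rle_refl.
  have eg2 : 1 <= E * eg.
    rewrite /E /eg -exp_plus -exp_0; apply: Rexp_le.
    by have := Rle_abs (- (gam * sig)); rewrite Rabs_Ropp Rabs_mult; lra.
  have eg0 : 0 < eg by exact: exp_pos.
  have pos := Rmult_le_pos _ _ (Rlt_le _ _ eg0) v2.
  have hx2 : Cmod x2 <= E * (eg * Cmod x2).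
    by rewrite -Rmult_assoc -[X in X <= _]Rmult_1_l; apply: Rmult_le_compat_r.
  have sumw : Cmod w1 + Cmod y2 <= 2 * E * (Cmod x1 + eg * Cmod x2) by nra.
  have sw : Cmod w1 + Cmod y2 <= (2 + m) * (Cmod y1 + Cmod y2) by nra.
  have sw0 : 0 <= (2 + m) * (Cmod y1 + Cmod y2) by nra.
  have AA : 4 * E * (2 + m) <= A by rewrite /A; nra.
  have AB : 4 * E * (2 * / m) <= A by rewrite /A; nra.
  have AC : 4 * E <= A by rewrite /A; nra.
  have y0 : 0 <= Cmod y1 + Cmod y2 by lra.
  have x0 : 0 <= Cmod x1 + eg * Cmod x2 by lra.
  have big : 4 * E * (2 + m) * (Cmod y1 + Cmod y2) <= A * (Cmod y1 + Cmod y2).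
    exact: Rmult_le_compat_r.
  split; first by nra.
  split.
    apply: Rle_trans (_ : E * (2 * (Cmod w1 + Cmod y2)) <= _); last by nra.
    by apply: Rmult_le_compat => //; lra.
  split.
    apply: Rle_trans hy _.
    apply: Rle_trans (Rmult_le_compat_l _ _ _ (Rlt_le _ _ im) sumw) _.
    apply: Rle_trans (Rmult_le_compat_r _ _ _ x0 AB); nra.
  apply: Rle_trans (Rmult_le_compat_r _ _ _ x0 AC).
  have := Cmod_ge_0 w1; nra.
Qed.

(** * Relative and two-sided derivatives *)

Lemma is_derive_within_parts (D : R -> Prop) (f : R -> C) (t : R) (v : C) :
  is_derive_within D f t v <->
  (forall eps : posreal, locally t (fun s => D s /\ s <> t ->
     Rabs ((Re (f s) - Re (f t)) / (s - t) - Re v) < eps /\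
     Rabs ((Im (f s) - Im (f t)) / (s - t) - Im v) < eps)).
Proof.
have e s : Re (RtoC (/ (s - t)) * (f s - f t))%C = (Re (f s) - Re (f t)) / (s - t) /\
    Im (RtoC (/ (s - t)) * (f s - f t))%C = (Im (f s) - Im (f t)) / (s - t).
  by rewrite /Re /Im /Rdiv /=; split; ring.
split=> [h eps|h].
  move/filterlim_locally/(_ eps): h; rewrite /within; apply: filter_imp => s hs hD.
  have [h1 h2] := hs hD.
  by have [e1 e2] := e s; rewrite -e1 -e2; split; [exact: h1 | exact: h2].
apply/filterlim_locally => eps; apply: filter_imp (h eps) => s hs /hs [h1 h2].
have [e1 e2] := e s; rewrite -e1 -e2 in h1 h2.
by split; [exact: h1 | exact: h2].
Qed.

Lemma is_derive_quotient (f : R -> R) (t v : R) :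
  is_derive f t v <->
  (forall eps : posreal, locally t (fun s => s <> t -> Rabs ((f s - f t) / (s - t) - v) < eps)).
Proof.
split=> [/is_derive_Reals h eps|h].
  have [del hd] := h eps (cond_pos eps); exists del => s hs hst.
  have := hd (s - t); have -> : t + (s - t) = s by ring.
  by apply; [lra | exact: hs].
apply/is_derive_Reals => eps he; have [del hd] := h (mkposreal eps he).
exists del => x hx hxd; have := hd (t + x).
have -> : t + x - t = x by ring.
apply; last by lra.
rewrite /ball /= /AbsRing_ball /abs /minus /plus /opp /=.
by have -> : t + x + - t = x by ring.
Qed.

Lemma Cder_of_within (D : R -> Prop) (f : R -> C) (t : R) (v : C) :
  locally t D -> is_derive_within D f t v -> Cder f t v.
Proof.
move=> hD /is_derive_within_parts h.
by split; apply/is_derive_quotient => eps;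
  apply: filter_imp (filter_and _ _ hD (h eps)) => s [h1 h2] h3;
  have [] := h2 (conj h1 h3).
Qed.

Lemma within_of_Cder (D : R -> Prop) (f : R -> C) (t : R) (v : C) :
  Cder f t v -> is_derive_within D f t v.
Proof.
move=> [/is_derive_quotient h1 /is_derive_quotient h2]; apply/is_derive_within_parts => eps.
by apply: filter_imp (filter_and _ _ (h1 eps) (h2 eps)) => s [a b] [_ hs]; split; [exact: a | exact: b].
Qed.

(** Affine extension past the final time turns one-sided derivatives at [T] into
    two-sided ones. *)
Definition extend (T : R) (f : R -> C) (v : C) (s : R) : C :=
  if Rle_dec s T then f s else (f T + RtoC (s - T) * v)%C.

Lemma extend_eq T f v s : s <= T -> extend T f v s = f s.
Proof. by rewrite /extend; case: Rle_dec. Qed.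

Lemma extend_derive T f (df : R -> C) t : 0 < t <= T ->
  is_derive_within (fun s => 0 < s <= T) f t (df t) -> Cder (extend T f (df T)) t (df t).
Proof.
move=> ht /is_derive_within_parts h.
have step (eps : posreal) : locally t (fun s => s <> t ->
     Rabs ((Re (extend T f (df T) s) - Re (extend T f (df T) t)) / (s - t) - Re (df t)) < eps /\
     Rabs ((Im (extend T f (df T) s) - Im (extend T f (df T) t)) / (s - t) - Im (df t)) < eps).
  have pos : locally t (fun s => 0 < s) by apply: (locally_interval _ t 0 p_infty) => //=; lra.
  have [hlt|heq] := Rlt_le_dec t T.
    have lt : locally t (fun s => s < T) by apply: (locally_interval _ t m_infty T) => //=.
    apply: filter_imp (filter_and _ _ (filter_and _ _ pos lt) (h eps)) => s [[h1 h2] h3] hs.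
    by rewrite !extend_eq; try lra; apply: h3; split=> //; lra.
  have eT : t = T by lra.
  apply: filter_imp (filter_and _ _ pos (h eps)) => s [h1 h3] hs.
  rewrite (extend_eq T f (df T) t); last lra.
  rewrite /extend; case: Rle_dec => hsT; first by apply: h3; split=> //; lra.
  have -> : (Re (f T + RtoC (s - T) * df T)%C - Re (f t)) / (s - t) - Re (df t) = 0.
    by rewrite eT /Re /=; field; lra.
  have -> : (Im (f T + RtoC (s - T) * df T)%C - Im (f t)) / (s - t) - Im (df t) = 0.
    by rewrite eT /Im /=; field; lra.
  by rewrite Rabs_R0; split; exact: cond_pos.
by split; apply/is_derive_quotient => eps; apply: filter_imp (step eps) => s hs /hs [].
Qed.

(** * The diagonalizing sequences in logarithmic time *)

Lemma Cbig_derive (r : seq nat) (F dF : nat -> R -> C) (s : R) :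
  (forall k, k \in r -> Cder (F k) s (dF k s)) ->
  Cder (fun x => \big[Cplus/RtoC 0]_(k <- r) F k x) s (\big[Cplus/RtoC 0]_(k <- r) dF k s).
Proof.
elim: r => [|k r IH] h.
  rewrite big_nil; apply: (Cder_ext (fun _ => RtoC 0)) => [x|]; first by rewrite big_nil.
  exact: Cder_const.
rewrite big_cons.
apply: (Cder_ext (fun x => F k x + \big[Cplus/RtoC 0]_(i <- r) F i x)%C) => [x|].
  by rewrite big_cons.
apply: Cder_plus; first by apply: h; rewrite mem_head.
by apply: IH => j hj; apply: h; rewrite in_cons hj orbT.
Qed.

Lemma Cbig_mod_le (r : seq nat) (F : nat -> C) (a : nat -> R) :
  (forall k, k \in r -> Cmod (F k) <= a k) ->
  Cmod (\big[Cplus/RtoC 0]_(k <- r) F k) <= \big[Rplus/0]_(k <- r) a k.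
Proof.
elim: r => [|k r IH] h; first by rewrite !big_nil Cmod_0; exact: Rle_refl.
rewrite !big_cons; apply: Rle_trans (Cmod_triangle _ _) _; apply: Rplus_le_compat.
  by apply: h; rewrite mem_head.
by apply: IH => j hj; apply: h; rewrite in_cons hj orbT.
Qed.

Lemma Rbig_scal_seq (r : seq nat) (a : nat -> R) (x : R) :
  \big[Rplus/0]_(k <- r) (a k * x) = (\big[Rplus/0]_(k <- r) a k) * x.
Proof.
by elim: r => [|k r IH]; rewrite ?big_nil ?big_cons ?IH; ring.
Qed.

(** [M_P] diagonalizes the singular part of the system: up to the factor [1 / t], the
    conjugate is [diag (-1, - g)] plus the matrix with rows [(- r, r)], [(- r, r)], where
    [r] is small near [t = 0]. *)
Lemma conjugated_system d (l : 'I_d -> R) c g t xi : g <> RtoC 1 -> 0 < t ->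
  let q := (RtoC (t ^ 2) * (RtoC (Hsq l t xi) + Ci * Cfr l c t xi))%C in
  let r := (q / (g - 1))%C in
  let P := (M_P g * A_P l c g t xi * minv (M_P g))%M in
  (ent P 0 0 = RtoC (/ t) * (- 1 - r))%C /\ (ent P 0 1 = RtoC (/ t) * r)%C /\
  (ent P 1 0 = RtoC (/ t) * (- r))%C /\ (ent P 1 1 = RtoC (/ t) * (r - g))%C.
Proof.
move=> hg ht q r P.
have g1 : (g - 1)%C <> RtoC 0.
  by move=> e; apply: hg; transitivity ((g - 1) + 1)%C; [ring | rewrite e; ring].
have tC : RtoC t <> RtoC 0 by move=> [] ?; lra.
have it : RtoC (/ t) = (/ RtoC t)%C by rewrite RtoC_inv //; lra.
have int : RtoC (- / t) = (- / RtoC t)%C by rewrite RtoC_opp it.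
have t2 : RtoC (t ^ 2) = (RtoC t * RtoC t)%C by rewrite /= Rmult_1_r RtoC_mult.
have tH : RtoC (t * Hsq l t xi) = (RtoC t * RtoC (Hsq l t xi))%C by rewrite RtoC_mult.
have dM : mdet (M_P g) = (g - 1)%C by rewrite /mdet /M_P !ent_mk22; ring.
rewrite /P !ent_mult // /minv !ent_scal // dM /M_P /A_P !ent_mk22.
rewrite it int tH /r /q t2.
by repeat split; field.
Qed.

Lemma exp2_ln t : 0 < t -> exp (2 * ln t) = t ^ 2.
Proof.
move=> ht; have -> : 2 * ln t = ln t + ln t by ring.
by rewrite exp_plus exp_ln //; ring.
Qed.

Lemma pot_scaled n (l xi : 'I_n -> R) (c : 'I_n -> C) t : 0 < t ->
  pot n (expo n l) c (scaled n l xi) (ln (djbr l xi) + ln t) =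
  (RtoC (t ^ 2) * (RtoC (Hsq l t xi) + Ci * Cfr l c t xi))%C.
Proof.
move=> ht; rewrite /pot mom_scaled.
have -> : \big[Rplus/0]_i (exp (2 * expo n l i * ln t) * xi i ^ 2) = t ^ 2 * Hsq l t xi.
  rewrite /Hsq -Rsum_scal; apply: eq_bigr => i _.
  rewrite /Rpower -Rmult_assoc -(exp2_ln t ht) -exp_plus.
  by congr (exp _ * _); rewrite /expo; ring.
have -> : first_order n (expo n l) c (scaled n l xi) (ln (djbr l xi) + ln t) =
    (RtoC (t ^ 2) * Cfr l c t xi)%C.
  rewrite /Cfr (big_morph (Cmult (RtoC (t ^ 2))) (id1 := RtoC 0) (op1 := Cplus)); last 2 first.
  - by move=> x y; ring.
  - by ring.
  apply: eq_bigr => i _; rewrite /scaled.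
  have -> : (RtoC (t ^ 2) * (c i * RtoC (Rpower t (l i - 1) * xi i)))%C =
    (c i * RtoC (t ^ 2 * (Rpower t (l i - 1) * xi i)))%C by rewrite !RtoC_mult; ring.
  congr (_ * RtoC _)%C.
  rewrite /Rpower -[RHS]Rmult_assoc -(exp2_ln t ht) -exp_plus.
  rewrite [xi i * _]Rmult_comm -Rmult_assoc -exp_plus; congr (exp _ * _).
  by rewrite /expo; ring.
by rewrite RtoC_mult; ring.
Qed.

Lemma ZP_log d T (l : 'I_d.+1 -> R) rho xi s : (forall i, -1 < l i) ->
  0 < rho -> rho <= T -> s <= ln rho ->
  let t := exp (s - ln (djbr l xi)) in
  ZP T l rho t xi /\ zvar l t xi = exp s /\ 0 < t.
Proof.
move=> hl hrho hT hs t; have h1 := djbr_ge1 d l xi hl.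
have lam0 : 0 <= ln (djbr l xi) by rewrite -ln_1; apply: ln_le; lra.
have tp : 0 < t by exact: exp_pos.
have ze : zvar l t xi = exp s.
  by rewrite /zvar /t -{1}[djbr l xi]exp_ln -?exp_plus; [congr exp; ring | lra].
have se : exp s <= rho by rewrite -[rho]exp_ln //; exact: Rexp_le.
split=> //; split; last by rewrite ze.
split=> //; apply: Rle_trans hT; apply: Rle_trans se.
by apply: Rexp_le; lra.
Qed.

Lemma ZP_interior d T (l : 'I_d.+1 -> R) rho rho1 t xi : (forall i, -1 < l i) ->
  rho < rho1 -> rho < T -> ZP T l rho t xi -> locally t (fun s => ZP T l rho1 s xi).
Proof.
move=> hl h1 h2 [[h3 h4] h5]; have h6 := djbr_ge1 d l xi hl.
have h7 : t <= zvar l t xi by rewrite /zvar; nra.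
apply: (locally_interval _ t 0 (Rmin T (rho1 / djbr l xi))) => //=.
  apply: Rmin_glb_lt; first lra.
  by apply/Rlt_div_r; first lra; rewrite Rmult_comm -/(zvar l t xi); lra.
move=> y y0 yy; have y1 := Rlt_le_trans _ _ _ yy (Rmin_l _ _).
have y2 := Rlt_le_trans _ _ _ yy (Rmin_r _ _).
split; first lra.
by rewrite /zvar Rmult_comm; apply/Rle_div_r; lra.
Qed.

(** As [z = lam t], the matrix [B_P / z] cancels against the subtraction made in [R_P],
    and [z (B_P / z + R_P)] is the conjugated system itself; what remains is the equation
    for the derivative of [Q] in logarithmic time. *)
Lemma remainder_entries (g r : C) (z lam t : R) (P Q dS DS Rm : mat2) (i : nat) :
  0 < t -> 0 < lam -> z = lam * t -> (i < 2)%N ->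
  (ent P 0 0 = RtoC (/ t) * (- 1 - r))%C -> (ent P 0 1 = RtoC (/ t) * r)%C ->
  (ent P 1 0 = RtoC (/ t) * (- r))%C -> (ent P 1 1 = RtoC (/ t) * (r - g))%C ->
  Rm = (dS + Q * (mscal (RtoC (/ z)) (B_P g) + mscal (RtoC (/ lam)) (P - mscal (RtoC (/ t)) (B_P g)))
    - (mscal (RtoC (/ z)) (B_P g) + DS) * Q)%M ->
  ent DS 0 1 = RtoC 0 -> ent DS 1 0 = RtoC 0 ->
  let B := if i is 0 then RtoC (-1) else (- g)%C in
  (RtoC z * ent dS i 0 = RtoC z * ent Rm i 0 - (ent Q i 0 * (- 1 - r) + ent Q i 1 * (- r))
     + (B + RtoC z * ent DS i i) * ent Q i 0)%C /\
  (RtoC z * ent dS i 1 = RtoC z * ent Rm i 1 - (ent Q i 0 * r + ent Q i 1 * (r - g))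
     + (B + RtoC z * ent DS i i) * ent Q i 1)%C.
Proof.
move=> ht hlam -> hi p00 p01 p10 p11 -> d01 d10 B.
have tC : RtoC t <> RtoC 0 by move=> []; lra.
have lC : RtoC lam <> RtoC 0 by move=> []; lra.
have it : RtoC (/ t) = (/ RtoC t)%C by rewrite RtoC_inv //; lra.
have il : RtoC (/ lam) = (/ RtoC lam)%C by rewrite RtoC_inv //; lra.
have iz : RtoC (/ (lam * t)) = (/ (RtoC lam * RtoC t))%C.
  by rewrite RtoC_inv ?RtoC_mult //; nra.
set W := (mscal (RtoC (/ (lam * t))) (B_P g) + mscal (RtoC (/ lam)) (P - mscal (RtoC (/ t)) (B_P g)))%M.
have eW j k : (j < 2)%N -> (k < 2)%N -> ent W j k = (/ RtoC lam * ent P j k)%C.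
  move=> hj hk; rewrite /W ent_plus // ent_scal // ent_scal // ent_minus // ent_scal // iz il it.
  by field.
move: W eW => W eW.
have eR k : (k < 2)%N -> ent (dS + Q * W - (mscal (RtoC (/ (lam * t))) (B_P g) + DS) * Q)%M i k
    = (ent dS i k + (ent Q i 0 * ent W 0 k + ent Q i 1 * ent W 1 k)
       - ((RtoC (/ (lam * t)) * ent (B_P g) i 0 + ent DS i 0) * ent Q 0 k
         + (RtoC (/ (lam * t)) * ent (B_P g) i 1 + ent DS i 1) * ent Q 1 k))%C.
  move=> hk; rewrite ent_minus // ent_plus // ent_mult // ent_mult //.
  by rewrite ent_plus // ent_scal // ent_plus // ent_scal.
rewrite !eR // !eW // p00 p01 p10 p11 iz it RtoC_mult /B_P.
have m1 : RtoC (-1) = (- RtoC 1)%C by rewrite -RtoC_opp.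
rewrite /B {B}.
case: i hi {eR} => [|[|i]] // _; cbv iota; rewrite !ent_mk22 ?d01 ?d10 m1; split.
all: by field.
Qed.

Definition diagQ (d : nat) (l : 'I_d.+1 -> R) (N : nat -> R -> ('I_d.+1 -> R) -> mat2)
    (mP : nat) (xi : 'I_d.+1 -> R) (i j : nat) (s : R) : C :=
  ent (Q_P N mP (exp (s - ln (djbr l xi))) xi) i j.

(** Multiplied by the factor [z] of the logarithmic derivative, the remainder of order [m]
    is [z ^ ((m + 1) (l_* + 1))] up to logarithms.  Conjugation by [diag (1, z ^ (g - 1))]
    consumes [z ^ |Re g - 1|], which [m (l_* + 1) >= |Re g - 1|] affords, and the surplus
    [z ^ (l_* + 1)] makes it integrable.  The smallness of [rho2] keeps [Q] within [1/4] of
    the identity. *)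
Lemma diagonalizer_asymptotic_map (T : R) (d : nat) (l : 'I_d.+1 -> R) (c : 'I_d.+1 -> C)
    (g : C) (rho1 : R) (N D Rem : nat -> R -> ('I_d.+1 -> R) -> mat2) :
  0 < T -> (forall i, -1 < l i) -> 0 < rho1 < 1 -> g <> RtoC 1 ->
  diagonalizer T l c g rho1 N D Rem ->
  exists m0, forall mP, (m0 <= mP)%N ->
  exists rho2 K, (0 < rho2 <= rho1 /\ rho2 <= T) /\ 0 < K /\ forall xi,
    let Q := diagQ d l N mP xi in
    asymptotic_map (pot d.+1 (expo d.+1 l) c (scaled d.+1 l xi)) g (ln rho2) K
      (fun s y1 y2 => Q 0%N 0%N s * ((g - 1) * y1 + y2) + Q 0%N 1%N s * y2)%C
      (fun s y1 y2 => cexp (g - 1) s *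
         (Q 1%N 0%N s * ((g - 1) * y1 + y2) + Q 1%N 1%N s * y2))%C.
Proof.
move=> hT hl hrho1 hg hd.
have [L hb] := expo_bounds d l hl.
set a1 := lmin l + 1 in hb.
have ha1 : 0 < a1 by have [[]] := hb ord0.
set del := a1 / 2; have hdel : 0 < del by rewrite /del; lra.
set gam := Re g - 1.
have lampos xi : 0 < djbr l xi by have := djbr_ge1 d l xi hl; lra.
have [m1 hm1] : exists m : nat, Rabs gam <= INR m * a1.
  have [m [_ hm]] := nfloor_ex (Rabs gam / a1) ltac:(apply: Rdiv_le_0_compat; [exact: Rabs_pos | exact: ha1]).
  exists m.+1; rewrite S_INR.
  by apply/Rle_div_l => //; lra.
exists (maxn 1 m1) => mP; rewrite geq_max => /andP [hm0 hmP].
have rate : Rabs gam <= INR mP * a1.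
  by apply: Rle_trans hm1 _; apply: Rmult_le_compat_r; [lra | exact: le_INR _ _ (leP hmP)].
have [hDm [_ [_ [hRm _]]]] := hd mP hm0.
have rate_k (k : nat) : (1 <= k)%N -> a1 <= INR k * a1.
  by move/leP/le_INR => h; have := Rmult_le_compat_r _ _ _ (Rlt_le _ _ ha1) h; rewrite /= Rmult_1_l.
(* half of the exponent [l_* + 1] is given up to the logarithms *)
have bound (k : nat) : exists K, 0 < K /\ ((1 <= k)%N -> forall t xi, ZP T l rho1 t xi ->
    forall i j, (i < 2)%N -> (j < 2)%N ->
    Cmod (ent (N k t xi) i j) <= K * exp (del * ln (zvar l t xi)) /\
    Cmod (ent (D k t xi) i j) <= K * exp ((del - 1) * ln (zvar l t xi))).
  case: (posnP k) => [->|hk]; first by exists 1; split=> //; lra.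
  have [hD [_ [hN _]]] := hd k hk; have rk := rate_k k hk.
  have [KN [hKN bN]] := symbol_le _ T l rho1 _ _ del ltac:(lra) lampos hN
    ltac:(rewrite -/a1 /del; lra).
  have [KD [hKD bD]] := symbol_le _ T l rho1 _ _ (del - 1) ltac:(lra) lampos hD
    ltac:(rewrite -/a1 /del; lra).
  exists (KN + KD); split=> [|_ t xi hz i j hi hj]; first lra.
  have := bN t xi hz i j hi hj; have := bD t xi hz i j hi hj.
  have := exp_pos (del * ln (zvar l t xi)); have := exp_pos ((del - 1) * ln (zvar l t xi)).
  by split; nra.
have [Kk hKk] := choose_function _ _ _ bound.
pose KS := \big[Rplus/0]_(1 <= k < mP.+1) Kk k.
have hKS : 0 <= KS.
  rewrite /KS; elim: (index_iota _ _) => [|k r IH]; first by rewrite big_nil; lra.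
  rewrite big_cons; have [hh _] := hKk k; apply: Rplus_le_le_0_compat => //; exact: Rlt_le.
have [KR [hKR bR]] := symbol_le _ T l rho1 _ _ (Rabs gam + del - 1) ltac:(lra) lampos hRm
  ltac:(move: ha1 rate; rewrite /del /a1; lra).
pose rho2 := Rmin (Rmin (rho1 / 2) (T / 2)) (exp (- ln (4 * (KS + 1)) / del)).
have r1 : rho2 <= rho1 / 2 by apply: Rle_trans (Rmin_l _ _) (Rmin_l _ _).
have r2 : rho2 <= T / 2 by apply: Rle_trans (Rmin_l _ _) (Rmin_r _ _).
have r0 : 0 < rho2.
  by rewrite /rho2; repeat apply: Rmin_glb_lt; try exact: exp_pos; lra.
have sig0 : ln rho2 <= 0 by rewrite -ln_1; apply: ln_le; lra.
have small : KS * exp (del * ln rho2) <= / 4.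
  have h : ln rho2 <= - ln (4 * (KS + 1)) / del.
    by rewrite -[X in _ <= X]ln_exp; apply: ln_le => //; exact: Rmin_r.
  have h2 : del * ln rho2 <= - ln (4 * (KS + 1)).
    have := Rmult_le_compat_l del _ _ ltac:(lra) h.
    by have -> : del * (- ln (4 * (KS + 1)) / del) = - ln (4 * (KS + 1)) by field; lra.
  have := Rexp_le _ _ h2; rewrite exp_Ropp exp_ln; last lra.
  move=> h3; apply: Rle_trans (Rmult_le_compat_l _ _ _ hKS h3) _.
  by apply: (Rmult_le_reg_r (4 * (KS + 1))); [lra | rewrite Rmult_assoc Rinv_l; lra].
have [K [hK AM]] := asymptotic_map_nonresonant g (ln rho2) del KS KR hg sig0 hdel hKS (Rlt_le _ _ hKR).
exists rho2, K; split; first by lra.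
split=> // xi Q; set lam := ln (djbr l xi).
set q := pot d.+1 (expo d.+1 l) c (scaled d.+1 l xi).
pose t s := exp (s - lam).
have g1 : (g - 1)%C <> RtoC 0.
  by move=> e; apply: hg; transitivity ((g - 1) + 1)%C; [ring | rewrite e; ring].
have zone s : s <= ln rho2 ->
    [/\ ZP T l rho2 (t s) xi, ZP T l rho1 (t s) xi, zvar l (t s) xi = exp s & 0 < t s].
  move=> hs; have [z1 [z2 z3]] := ZP_log d T l rho2 xi s hl r0 ltac:(lra) hs.
  by split=> //; case: z1 => a b; split=> //; apply: Rle_trans b _; lra.
have lnz s : s <= ln rho2 -> ln (zvar l (t s) xi) = s.
  by move=> hs; have [_ _ -> _] := zone s hs; rewrite ln_exp.
apply: (AM q (fun s => q s / (g - 1))%C Q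
  (fun i j s => RtoC (exp s) * ent (Rem mP (t s) xi) i j)%C
  (fun i s => RtoC (exp s) * ent (msum (fun k => D k (t s) xi) mP) i i)%C).
- by move=> s; field.
- move=> i s hi hs B.
  have [z2 z1 ze tp] := zone s hs.
  have [_ [Ddiag [_ [_ Hrem]]]] := hd mP hm0.
  have [dN [hdN Rdef]] := Hrem (t s) xi z1.
  have Ddiag0 i' j : (i' < 2)%N -> (j < 2)%N -> i' <> j ->
      ent (msum (fun k => D k (t s) xi) mP) i' j = RtoC 0.
    move=> hi' hj hij; rewrite ent_msum //.
    rewrite big_nat_cond; apply: (big_ind (fun x => x = RtoC 0)) => [//|x y -> ->|k]; first by ring.
    rewrite andbT => /andP [hk _]; have [_ [dd _]] := hd k hk.
    have [d1 d2] := dd (t s) xi z1.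
    by case: i' hi' hij => [|[|i']] // _; case: j hj => [|[|j]] //.
  have dQ j : (j < 2)%N -> Cder (Q i j) s (RtoC (exp s) * ent (msum dN mP) i j)%C.
    move=> hj.
    have dE : Cder (fun x => ent (Q_P N mP x xi) i j) (t s)
       (RtoC (djbr l xi) * ent (msum dN mP) i j)%C.
      rewrite ent_msum //.
      apply: (Cder_ext (fun x => ent (@Mone C_Ring 2) i j +
          \big[Cplus/RtoC 0]_(1 <= k < mP.+1) ent (N k x xi) i j)%C) => [x|].
        by rewrite /Q_P ent_plus // ent_msum.
      rewrite (big_morph (Cmult (RtoC (djbr l xi))) (id1 := RtoC 0) (op1 := Cplus)); last 2 first.
      - by move=> x y; ring.
      - by ring.
      apply: Cder_eq.
        apply: Cder_plus; first exact: Cder_const.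
        apply: (Cbig_derive _ (fun k x => ent (N k x xi) i j)
          (fun k x => RtoC (djbr l xi) * ent (dN k) i j)%C) => k.
        rewrite mem_index_iota => hk.
        apply: Cder_of_within; first exact: (ZP_interior d T l rho2 rho1 (t s) xi hl ltac:(lra) ltac:(lra) z2).
        by apply: hdN.
      exact: Cplus_0_l.
    have dt : is_derive t s (t s) by rewrite /t; auto_derive => //; rewrite /Rminus; ring.
    apply: Cder_eq; first exact: (Cder_comp (fun x => ent (Q_P N mP x xi) i j) t s _ _ dE dt).
    have -> : RtoC (exp s) = (RtoC (t s) * RtoC (djbr l xi))%C.
      by rewrite -ze /zvar RtoC_mult; ring.
    by ring.
  have [G00 [G01 [G10 G11]]] := conjugated_system d.+1 l c g (t s) xi hg tp.
  have qE : q s = (RtoC (t s ^ 2) * (RtoC (Hsq l (t s) xi) + Ci * Cfr l c (t s) xi))%C.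
    by rewrite -pot_scaled // /t ln_exp /q; congr pot; rewrite /lam; ring.
  rewrite -qE in G00 G01 G10 G11.
  rewrite ze /R_P in Rdef.
  have ze' : exp s = djbr l xi * t s by rewrite -ze.
  have [v0 v1] := remainder_entries g _ (exp s) (djbr l xi) (t s) _ _ _ _ _ i tp (lampos xi) ze' hi
    G00 G01 G10 G11 Rdef (Ddiag0 0%N 1%N erefl erefl ltac:(by [])) (Ddiag0 1%N 0%N erefl erefl ltac:(by [])).
  split; first exact: Cder_eq (dQ 0%N erefl) v0.
  split; first exact: Cder_eq (dQ 1%N erefl) v1.
  rewrite Cmod_mult Cmod_R (Rabs_pos_eq (exp s)); last exact/Rlt_le/exp_pos.
  rewrite ent_msum //.
  have -> : KS * exp (del * s) = exp s * \big[Rplus/0]_(1 <= k < mP.+1) (Kk k * exp ((del - 1) * s)).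
    rewrite Rbig_scal_seq -/KS.
    have -> : exp (del * s) = exp s * exp ((del - 1) * s) by rewrite -exp_plus; congr exp; ring.
    by ring.
  apply: Rmult_le_compat_l; first exact/Rlt_le/exp_pos.
  apply: Cbig_mod_le => k; rewrite mem_index_iota => /andP [hk _].
  have [_ /(_ hk _ _ z1 i i hi hi) [_]] := hKk k.
  by rewrite lnz.
- move=> i j s hi hj hs; have [_ z1 _ _] := zone s hs; split.
    rewrite Cmod_mult Cmod_R (Rabs_pos_eq (exp s)); last exact/Rlt_le/exp_pos.
    have := bR (t s) xi z1 i j hi hj; rewrite lnz // => h.
    apply: Rle_trans (Rmult_le_compat_l _ _ _ (Rlt_le _ _ (exp_pos s)) h) _; right.
    have -> : exp ((Rabs (Re g - 1) + del) * s) = exp s * exp ((Rabs gam + del - 1) * s).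
      by rewrite -exp_plus; congr exp; rewrite -/gam; ring.
    by ring.
  have -> : (Q i j s - (if i == j then 1 else 0))%C =
      \big[Cplus/RtoC 0]_(1 <= k < mP.+1) ent (N k (t s) xi) i j.
    rewrite /Q /diagQ /Q_P ent_plus // ent_msum // -/lam -/(t s).
    by case: i hi => [|[|i]] // _; case: j hj => [|[|j]] // _; rewrite /= !ent_one; ring.
  apply: Rle_trans small.
  apply: Rle_trans (_ : KS * exp (del * s) <= _); last first.
    by apply: Rmult_le_compat_l => //; apply: Rexp_le; nra.
  rewrite /KS -Rbig_scal_seq.
  apply: Cbig_mod_le => k; rewrite mem_index_iota => /andP [hk _].
  have [_ /(_ hk _ _ z1 i j hi hj) [+ _]] := hKk k.
  by rewrite lnz.
Qed.

(** * The limiting quantities in logarithmic time *)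

Lemma ent_mult_col (A : mat2) (a b : C) i : (i < 2)%N ->
  ent (@Mmult C_Ring 2 2 1 A (mk21 a b)) i 0 = (ent A i 0 * a + ent A i 1 * b)%C.
Proof.
move=> /ltP hi; rewrite {1}/ent /Mmult coeff_mat_bij; [|exact: hi|exact/ltP].
by rewrite sum_Sn sum_O.
Qed.

Lemma varphi_nonresonant d (l : 'I_d.+1 -> R) g N mP phi dphi t xi :
  g <> RtoC 1 -> 0 < t ->
  let lam := ln (djbr l xi) in let s := lam + ln t in let Q := diagQ d l N mP xi in
  let w := ((g - 1) * phi t xi + RtoC t * dphi t xi)%C in
  varphi_p g N mP phi dphi t xi =
    (Q 0%N 0%N s * w + Q 0%N 1%N s * (RtoC t * dphi t xi))%C /\
  (cexp (g - 1) lam * varphi_m g N mP phi dphi t xi)%C =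
    (cexp (g - 1) s * (Q 1%N 0%N s * w + Q 1%N 1%N s * (RtoC t * dphi t xi)))%C.
Proof.
move=> hg ht lam s Q w.
have tC : RtoC t <> RtoC 0 by move=> []; lra.
have it : RtoC (/ t) = (/ RtoC t)%C by rewrite RtoC_inv //; lra.
have et : exp (s - ln (djbr l xi)) = t.
  have -> : s - ln (djbr l xi) = ln t by rewrite /s /lam; ring.
  exact: exp_ln.
rewrite /varphi_p /varphi_m /varphi_col; rewrite (_ : is_left (Ceq_dec g (RtoC 1)) = false); last first.
  by destruct (Ceq_dec g (RtoC 1)).
rewrite /Q /diagQ et !ent_mult_col // !ent_mult // !ent_mk22 it; split.
  by rewrite /w; field.
have -> : cexp (g - 1) s = (cexp (g - 1) lam * cexp (g - 1) (ln t))%C by rewrite -cexp_plus.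
have -> : Rcpow t g = (cexp (g - 1) (ln t) * RtoC t)%C.
  have {1}-> : g = ((g - 1) + RtoC 1)%C by ring.
  by rewrite Rcpow_cexp cexp_plus_exp cexp_real Rmult_1_l exp_ln.
by rewrite /w; field.
Qed.

(** Both cases of [g] in one interface.  The second quantity is [<<xi>> ^ (g - 1) phi_-]
    because in this normalization no power of [<<xi>>] is left when it is expressed in
    the scaled time, so that [K] does not depend on [xi]. *)
Lemma asymptotic_maps (T : R) (d : nat) (l : 'I_d.+1 -> R) (c : 'I_d.+1 -> C) (g : C)
    (rho1 : R) (N D Rem : nat -> R -> ('I_d.+1 -> R) -> mat2) :
  0 < T -> (forall i, -1 < l i) -> 0 < rho1 < 1 ->
  (g <> RtoC 1 -> diagonalizer T l c g rho1 N D Rem) ->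
  exists m0, forall mP, (m0 <= mP)%N ->
  exists rho2 K, (0 < rho2 <= rho1 /\ rho2 <= T) /\ 0 < K /\
  exists p1 p2 : ('I_d.+1 -> R) -> R -> C -> C -> C, forall xi,
    let lam := ln (djbr l xi) in
    asymptotic_map (pot d.+1 (expo d.+1 l) c (scaled d.+1 l xi)) g (ln rho2) K (p1 xi) (p2 xi) /\
    forall phi dphi t, 0 < t ->
      let val (p : R -> C -> C -> C) := p (lam + ln t) (phi t xi) (RtoC t * dphi t xi)%C in
      let php := varphi_p g N mP phi dphi t xi in
      let phm := varphi_m g N mP phi dphi t xi in
      (g <> RtoC 1 -> php = val (p1 xi)) /\
      (g = RtoC 1 -> (php - RtoC (ln (zvar l t xi)) * phm)%C = val (p1 xi)) /\
      (cexp (g - 1) lam * phm)%C = val (p2 xi).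
Proof.
move=> hT hl hrho1 hd; case: (Ceq_dec g (RtoC 1)) => hg.
  have [L hb] := expo_bounds d l hl.
  pose rho2 := Rmin rho1 T.
  have r0 : 0 < rho2 by apply: Rmin_glb_lt; lra.
  have r1 : rho2 <= rho1 by exact: Rmin_l.
  have sig0 : ln rho2 <= 0 by rewrite -ln_1; apply: ln_le; lra.
  have [K [hK AM]] := asymptotic_map_resonant d.+1 (expo d.+1 l) c _ (ln rho2)
    (fun i => proj1 (hb i)) (proj1 (proj1 (hb ord0))) sig0.
  exists 0%N => mP _; exists rho2, K; split; first by split=> //; exact: Rmin_r.
  split=> //.
  exists (fun _ s y1 y2 => y1 - RtoC s * y2)%C, (fun _ s y1 y2 => y2) => xi lam.
  rewrite hg; split; first by apply: AM => i; exact: scaled_le1.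
  move=> phi dphi t ht val php phm; split=> //.
  have e1 : is_left (Ceq_dec (RtoC 1) (RtoC 1)) = true by destruct (Ceq_dec (RtoC 1) (RtoC 1)).
  have ep : php = phi t xi by rewrite /php /varphi_p e1.
  have em : phm = (RtoC t * dphi t xi)%C by rewrite /phm /varphi_m e1.
  split=> [_|].
    rewrite ep em /val; congr (_ - RtoC _ * _)%C.
    by rewrite /zvar ln_mult //; have := djbr_ge1 d l xi hl; lra.
  rewrite em /val; have -> : (1 - 1)%C = RtoC 0 by ring.
  by rewrite cexp_real Rmult_0_l exp_0; ring.
have [m0 H] := diagonalizer_asymptotic_map T d l c g rho1 N D Rem hT hl hrho1 hg (hd hg).
exists m0 => mP hm; have [rho2 [K [hr [hK AM]]]] := H mP hm.
exists rho2, K; split=> //; split=> //.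
exists (fun xi s y1 y2 => diagQ d l N mP xi 0%N 0%N s * ((g - 1) * y1 + y2)
    + diagQ d l N mP xi 0%N 1%N s * y2)%C,
  (fun xi s y1 y2 => cexp (g - 1) s * (diagQ d l N mP xi 1%N 0%N s * ((g - 1) * y1 + y2)
    + diagQ d l N mP xi 1%N 1%N s * y2))%C => xi lam.
split; first exact: AM.
move=> phi dphi t ht val php phm.
by have [h1 h2] := varphi_nonresonant d l g N mP phi dphi t xi hg ht.
Qed.

(** * Solutions in the original and in the logarithmic time *)

Lemma log_time_derive x t : 0 < t -> is_derive (fun t => x + ln t) t (/ t).
Proof. by move=> ht; auto_derive => //; field; lra. Qed.

Lemma Sol_of_K_solution T d (l : 'I_d -> R) c g phi dphi xi : 0 < T ->
  K_solution T l c g phi dphi ->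
  let lam := ln (djbr l xi) in
  exists Y1 Y2, Sol (pot d (expo d l) c (scaled d l xi)) g (lam + ln T) Y1 Y2 /\
    forall t, 0 < t <= T -> Y1 (lam + ln t) = phi t xi /\
      Y2 (lam + ln t) = (RtoC t * dphi t xi)%C.
Proof.
move=> hT hK lam; have [ddphi H] := hK xi.
pose e1 := extend T (fun s => phi s xi) (dphi T xi).
pose e2 := extend T (fun s => dphi s xi) (ddphi T).
pose t s := exp (s - lam).
have tT s : s <= lam + ln T -> 0 < t s <= T.
  move=> hs; split; first exact: exp_pos.
  by rewrite -[X in _ <= X]exp_ln //; apply: Rexp_le; lra.
exists (fun s => e1 (t s)), (fun s => RtoC (t s) * e2 (t s))%C; split.
  move=> s hs; have ht := tT s hs; have [h1 [h2 [_ h4]]] := H (t s) ht.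
  have d1 : Cder e1 (t s) (dphi (t s) xi).
    exact: (extend_derive T (fun s => phi s xi) (fun s => dphi s xi)).
  have d2 : Cder e2 (t s) (ddphi (t s)).
    exact: (extend_derive T (fun s => dphi s xi) ddphi).
  have dt : is_derive t s (t s) by rewrite /t; auto_derive => //; rewrite /Rminus; ring.
  have E1 : e1 (t s) = phi (t s) xi by apply: extend_eq; lra.
  have E2 : e2 (t s) = dphi (t s) xi by apply: extend_eq; lra.
  split.
    by apply: Cder_eq; [exact: (Cder_comp _ _ _ _ _ d1 dt) | rewrite E2].
  apply: Cder_eq.
    apply: Cder_mult; first exact: (Cder_RtoC _ _ _ dt).
    exact: (Cder_comp _ _ _ _ _ d2 dt).
  rewrite E1 E2.
  have -> : pot d (expo d l) c (scaled d l xi) s =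
      (RtoC (t s ^ 2) * (RtoC (Hsq l (t s) xi) + Ci * Cfr l c (t s) xi))%C.
    rewrite -pot_scaled; last by lra.
    by rewrite /t ln_exp; congr pot; rewrite /lam; ring.
  have tC : RtoC (t s) <> RtoC 0 by move=> []; lra.
  have -> : ddphi (t s) = (- ((RtoC (Hsq l (t s) xi) + Ci * Cfr l c (t s) xi) * phi (t s) xi
      + g * RtoC (/ t s) * dphi (t s) xi))%C.
    set Z := (ddphi (t s) + _ + _)%C in h4.
    transitivity (Z - ((RtoC (Hsq l (t s) xi) + Ci * Cfr l c (t s) xi) * phi (t s) xi
      + g * RtoC (/ t s) * dphi (t s) xi))%C; first by rewrite /Z; ring.
    by rewrite h4; ring.
  rewrite RtoC_inv; last by lra.
  have -> : RtoC (t s ^ 2) = (RtoC (t s) * RtoC (t s))%C by rewrite /= Rmult_1_r RtoC_mult.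
  by field.
move=> x hx; have -> : t (lam + ln x) = x.
  rewrite /t; have -> : lam + ln x - lam = ln x by ring.
  by apply: exp_ln; lra.
by split; rewrite ?/e1 ?/e2 extend_eq //; lra.
Qed.

Lemma K_solution_of_Sol T d (l : 'I_d -> R) c g (Y1 Y2 : ('I_d -> R) -> R -> C) :
  (forall xi S, Sol (pot d (expo d l) c (scaled d l xi)) g S (Y1 xi) (Y2 xi)) ->
  K_solution T l c g (fun t xi => Y1 xi (ln (djbr l xi) + ln t))
    (fun t xi => Cmult (RtoC (/ t)) (Y2 xi (ln (djbr l xi) + ln t))).
Proof.
move=> H xi; set lam := ln (djbr l xi); set q := pot d (expo d l) c (scaled d l xi).
pose dd t := let s := lam + ln t in
  (RtoC (/ t) * (RtoC (/ t) * (- g * Y2 xi s - q s * Y1 xi s)))%C.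
exists dd => t [ht hT] I.
have [y1 y2] := H xi (lam + ln t) (lam + ln t) (Rle_refl _).
have dlog := log_time_derive lam t ht.
have c1 := Cder_comp _ _ _ _ _ y1 dlog; have c2 := Cder_comp _ _ _ _ _ y2 dlog.
have tC : RtoC t <> RtoC 0 by move=> []; lra.
have it : RtoC (/ t) = (/ RtoC t)%C by rewrite RtoC_inv //; lra.
have dinv : Cder (fun t => RtoC (/ t)) t (- RtoC (/ t) * RtoC (/ t))%C.
  apply: Cder_eq.
    apply: (Cder_RtoC (fun t => / t) t (- (/ t * / t))).
    by auto_derive; [lra | field; lra].
  by rewrite RtoC_opp RtoC_mult; ring.
split; first by apply: within_of_Cder; exact: c1.
split.
  apply: within_of_Cder; apply: Cder_eq; first by apply: Cder_mult; [exact: dinv | exact: c2].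
  by rewrite /dd -/q; ring.
split.
  have [v hv] := pot_derive d (expo d l) c (scaled d l xi) (lam + ln t).
  have c3 := Cder_comp _ _ _ _ _ hv dlog.
  have [w hw] : exists w, Cder dd t w.
    eexists; apply: Cder_mult; first exact: dinv.
    apply: Cder_mult; first exact: dinv.
    apply: Cder_plus; first by apply: Cder_scal; exact: c2.
    by apply: Cder_opp; apply: Cder_mult; [exact: c3 | exact: c1].
  apply: filterlim_filter_le_1 (Cder_continuous _ _ _ hw); exact: filter_le_within.
have qE : q (lam + ln t) = (RtoC (t ^ 2) * (RtoC (Hsq l t xi) + Ci * Cfr l c t xi))%C.
  exact: pot_scaled.
rewrite /dd qE it.
have -> : RtoC (t ^ 2) = (RtoC t * RtoC t)%C by rewrite /= Rmult_1_r RtoC_mult.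
by field.
Qed.

(** * Limits at time zero *)

(** The filter of the limits in [asymptotic_data]. *)
Definition near0 d (T : R) (l : 'I_d -> R) (rho : R) (xi : 'I_d -> R) : (R -> Prop) -> Prop :=
  within (fun tau => ZP T l rho tau xi) (at_right 0).

Lemma near0_pos d T (l : 'I_d -> R) rho xi : near0 d T l rho xi (fun t => 0 < t <= T).
Proof. by rewrite /near0 /within; apply: filter_forall => t []. Qed.

(** Properness, i.e. the fact that [Z_P] accumulates at [t = 0] over every [xi], is what
    makes these limits unique. *)
Lemma near0_proper d T (l : 'I_d.+1 -> R) rho xi : (forall i, -1 < l i) -> 0 < T -> 0 < rho ->
  ProperFilter' (near0 d.+1 T l rho xi).
Proof.
move=> hl hT hrho; have h1 := djbr_ge1 d l xi hl.
constructor; last by apply: within_filter.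
move=> [eps he].
pose x := Rmin (eps / 2) (Rmin T (rho / djbr l xi)).
have x0 : 0 < x.
  rewrite /x; repeat apply: Rmin_glb_lt => //; first by have := cond_pos eps; lra.
  by apply: Rdiv_lt_0_compat; lra.
have x1 : x <= eps / 2 by exact: Rmin_l.
have x2 : x <= T by apply: Rle_trans (Rmin_r _ _) (Rmin_l _ _).
have x3 : x <= rho / djbr l xi by apply: Rle_trans (Rmin_r _ _) (Rmin_r _ _).
apply: (he x) => //.
  rewrite /ball /= /AbsRing_ball /abs /minus /plus /opp /= Ropp_0 Rplus_0_r Rabs_pos_eq; last lra.
  by have := cond_pos eps; lra.
by split=> //; rewrite /zvar Rmult_comm; apply/Rle_div_r; lra.
Qed.

Lemma log_time_near0 d T (l : 'I_d -> R) rho xi x :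
  filterlim (fun t => x + ln t) (near0 d T l rho xi) (Rbar_locally m_infty).
Proof.
apply: filterlim_filter_le_1 (_ : filterlim _ (at_right 0) _); first exact: filter_le_within.
move=> P [M hM]; have h := is_lim_ln_0 (fun y => P (x + y)).
apply: h; exists (M - x) => y hy; apply: hM; lra.
Qed.

Lemma limit_in_log_time d T (l : 'I_d -> R) rho xi x (f : R -> C) (h : R -> C) p :
  (forall t, 0 < t <= T -> h t = f (x + ln t)) ->
  filterlim f (Rbar_locally m_infty) (locally p) ->
  filterlim h (near0 d T l rho xi) (locally p).
Proof.
move=> e hf; apply: (filterlim_ext_loc (fun t => f (x + ln t))).
  by apply: filter_imp (near0_pos d T l rho xi) => t ht; rewrite e.
exact: filterlim_comp (log_time_near0 d T l rho xi x) hf.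
Qed.

(** * Solutions are parametrized by their asymptotic data *)

Lemma minfty_proper : ProperFilter' (Rbar_locally m_infty).
Proof. exact: Proper_StrongProper. Qed.

Lemma asymptotic_zero q g sig K p1 p2 S Y1 Y2 :
  asymptotic_map q g sig K p1 p2 -> sig <= S -> Sol q g S Y1 Y2 ->
  filterlim (fun s => p1 s (Y1 s) (Y2 s)) (Rbar_locally m_infty) (locally (RtoC 0)) ->
  filterlim (fun s => p2 s (Y1 s) (Y2 s)) (Rbar_locally m_infty) (locally (RtoC 0)) ->
  Y1 sig = RtoC 0 /\ Y2 sig = RtoC 0.
Proof.
move=> [_ [_ H]] hS hY h1 h2; have [l1 [l2 [a1 [a2 [_ w]]]]] := H S Y1 Y2 hS hY.
have PF := minfty_proper.
have e1 : l1 = RtoC 0 := Cfilterlim_unique _ PF _ _ _ a1 h1.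
have e2 : l2 = RtoC 0 := Cfilterlim_unique _ PF _ _ _ a2 h2.
by apply: normsq_eq0; move: w; rewrite e1 e2 Cmod_0; lra.
Qed.

Lemma asymptotic_lincomb q g sig K p1 p2 (a b : C) (Y1 Y2 X1 X2 : R -> C) (l1 l2 m1 m2 : C) :
  asymptotic_map q g sig K p1 p2 ->
  filterlim (fun s => p1 s (Y1 s) (Y2 s)) (Rbar_locally m_infty) (locally l1) ->
  filterlim (fun s => p2 s (Y1 s) (Y2 s)) (Rbar_locally m_infty) (locally l2) ->
  filterlim (fun s => p1 s (X1 s) (X2 s)) (Rbar_locally m_infty) (locally m1) ->
  filterlim (fun s => p2 s (X1 s) (X2 s)) (Rbar_locally m_infty) (locally m2) ->
  filterlim (fun s => p1 s (a * Y1 s + b * X1 s)%C (a * Y2 s + b * X2 s)%C)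
    (Rbar_locally m_infty) (locally (a * l1 + b * m1)%C) /\
  filterlim (fun s => p2 s (a * Y1 s + b * X1 s)%C (a * Y2 s + b * X2 s)%C)
    (Rbar_locally m_infty) (locally (a * l2 + b * m2)%C).
Proof.
move=> [b1 [b2 _]] h1 h2 h3 h4.
have FF : Filter (Rbar_locally m_infty) by apply: filter_filter; exact: (Rbar_locally_filter m_infty).
split.
  apply: (filterlim_ext (fun s => a * p1 s (Y1 s) (Y2 s) + b * p1 s (X1 s) (X2 s))%C).
    by move=> s; rewrite b1.
  exact: Cfilterlim_lincomb.
apply: (filterlim_ext (fun s => a * p2 s (Y1 s) (Y2 s) + b * p2 s (X1 s) (X2 s))%C).
  by move=> s; rewrite b2.
exact: Cfilterlim_lincomb.
Qed.

(** The map from Cauchy data to asymptotic data is linear and, being bounded below,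
    injective on a two-dimensional space: its determinant does not vanish, and
    Cramer's rule produces a solution with given limits. *)
Lemma scattering_exists q g sig K p1 p2 (l1 l2 : C) : Ccontinuous q ->
  asymptotic_map q g sig K p1 p2 ->
  exists Y1 Y2, (forall S, Sol q g S Y1 Y2) /\
    filterlim (fun s => p1 s (Y1 s) (Y2 s)) (Rbar_locally m_infty) (locally l1) /\
    filterlim (fun s => p2 s (Y1 s) (Y2 s)) (Rbar_locally m_infty) (locally l2).
Proof.
move=> hq AM; have [_ [_ H]] := AM.
have [Y1 [Y2 [y1 [y2 hY]]]] := Sol_exists q g sig (RtoC 1) (RtoC 0) hq.
have [X1 [X2 [x1 [x2 hX]]]] := Sol_exists q g sig (RtoC 0) (RtoC 1) hq.
have [a1 [a2 [ha1 [ha2 _]]]] := H sig Y1 Y2 (Rle_refl _) (hY sig).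
have [b1 [b2 [hb1 [hb2 _]]]] := H sig X1 X2 (Rle_refl _) (hX sig).
have inj (u v : C) : (u * a1 + v * b1)%C = RtoC 0 -> (u * a2 + v * b2)%C = RtoC 0 ->
    u = RtoC 0 /\ v = RtoC 0.
  move=> e1 e2; have [L1 L2] := asymptotic_lincomb _ _ _ _ _ _ u v _ _ _ _ _ _ _ _ AM ha1 ha2 hb1 hb2.
  rewrite e1 in L1; rewrite e2 in L2.
  have [] := asymptotic_zero _ _ _ _ _ _ sig _ _ AM (Rle_refl _)
    (Sol_lincomb _ _ _ _ _ _ _ u v (hY sig) (hX sig)) L1 L2.
  rewrite y1 y2 x1 x2 => f1 f2; split.
    by transitivity (u * RtoC 1 + v * RtoC 0)%C; [ring | exact: f1].
  by transitivity (u * RtoC 0 + v * RtoC 1)%C; [ring | exact: f2].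
have det : (a1 * b2 - a2 * b1)%C <> RtoC 0.
  move=> e.
  have [eb1 ea1] : b1 = RtoC 0 /\ (- a1)%C = RtoC 0.
    apply: inj; first by ring.
    by transitivity (- (a1 * b2 - a2 * b1))%C; [ring | rewrite e; ring].
  have [eb2 ea2] : b2 = RtoC 0 /\ (- a2)%C = RtoC 0.
    apply: inj; last by ring.
    by transitivity (a1 * b2 - a2 * b1)%C; [ring | rewrite e].
  have [] := inj (RtoC 1) (RtoC 0).
  - by transitivity (- (- a1))%C; [rewrite eb1; ring | rewrite ea1; ring].
  - by transitivity (- (- a2))%C; [rewrite eb2; ring | rewrite ea2; ring].
  by move=> [] ?; lra.
pose u := ((l1 * b2 - l2 * b1) / (a1 * b2 - a2 * b1))%C.
pose v := ((a1 * l2 - a2 * l1) / (a1 * b2 - a2 * b1))%C.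
exists (fun s => u * Y1 s + v * X1 s)%C, (fun s => u * Y2 s + v * X2 s)%C.
split; first by move=> S; apply: Sol_lincomb.
have -> : l1 = (u * a1 + v * b1)%C by rewrite /u /v; field.
have -> : l2 = (u * a2 + v * b2)%C by rewrite /u /v; field.
exact: asymptotic_lincomb AM ha1 ha2 hb1 hb2.
Qed.

Lemma scattering_unique q g sig K p1 p2 S Y1 Y2 X1 X2 (l1 l2 : C) : Ccontinuous q ->
  asymptotic_map q g sig K p1 p2 -> sig <= S -> Sol q g S Y1 Y2 -> Sol q g S X1 X2 ->
  filterlim (fun s => p1 s (Y1 s) (Y2 s)) (Rbar_locally m_infty) (locally l1) ->
  filterlim (fun s => p2 s (Y1 s) (Y2 s)) (Rbar_locally m_infty) (locally l2) ->
  filterlim (fun s => p1 s (X1 s) (X2 s)) (Rbar_locally m_infty) (locally l1) ->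
  filterlim (fun s => p2 s (X1 s) (X2 s)) (Rbar_locally m_infty) (locally l2) ->
  forall s, s <= S -> Y1 s = X1 s.
Proof.
move=> hq AM hS hY hX h1 h2 h3 h4 s hs.
have [L1 L2] := asymptotic_lincomb _ _ _ _ _ _ (RtoC 1) (- RtoC 1)%C _ _ _ _ _ _ _ _ AM h1 h2 h3 h4.
have e (z : C) : (1 * z + - (1) * z)%C = RtoC 0 by ring.
rewrite !e in L1 L2.
have hZ := Sol_lincomb _ _ _ _ _ _ _ (RtoC 1) (- RtoC 1)%C hY hX.
have [z1 z2] := asymptotic_zero _ _ _ _ _ _ S _ _ AM hS hZ L1 L2.
have [z _] := Sol_unique _ _ _ _ _ sig hq hZ hS z1 z2 s hs.
transitivity ((1 * Y1 s + - (1) * X1 s) + X1 s)%C; first by ring.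
by rewrite z; ring.
Qed.

Lemma cauchy_unique q g S Y1 Y2 X1 X2 : Ccontinuous q ->
  Sol q g S Y1 Y2 -> Sol q g S X1 X2 -> Y1 S = X1 S -> Y2 S = X2 S ->
  forall s, s <= S -> Y1 s = X1 s.
Proof.
move=> hq hY hX e1 e2 s hs.
have hZ := Sol_lincomb _ _ _ _ _ _ _ (RtoC 1) (- RtoC 1)%C hY hX.
have z1 : (1 * Y1 S + - (1) * X1 S)%C = RtoC 0 by rewrite e1; ring.
have z2 : (1 * Y2 S + - (1) * X2 S)%C = RtoC 0 by rewrite e2; ring.
have [z _] := Sol_unique _ _ _ _ _ S hq hZ (Rle_refl _) z1 z2 s hs.
transitivity ((1 * Y1 s + - (1) * X1 s) + X1 s)%C; first by ring.
by rewrite z; ring.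
Qed.

(** * The weighted norms *)

Lemma norm_at_T_energy n (T : R) : 0 < T -> exists A, 0 < A /\ forall (xi : 'I_n -> R) (u v : C),
  within_factor A (norm_at_T xi u v ^ 2) (final_energy n xi u (RtoC T * v)%C).
Proof.
move=> hT; exists (2 * (1 + / T ^ 2) + (1 + T ^ 2)).
have T2 : 0 < T ^ 2 by exact: pow_lt.
have iT2 : 0 < / T ^ 2 by exact: Rinv_0_lt_compat.
split; first lra.
move=> xi u v; have v1 := vjbr_ge1 n xi.
rewrite /norm_at_T /final_energy Cmod_mult Cmod_R (Rabs_pos_eq T); last lra.
set w := vjbr xi in v1 *; set h := Rpower w (1 / 2).
have h0 : 0 < h by exact: exp_pos.
have -> : Rpower w (- (1 / 2)) = / h by rewrite Rpower_Ropp.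
have hw : w = h * h.
  rewrite /h -Rpower_plus; have -> : 1 / 2 + 1 / 2 = 1 by field.
  by rewrite Rpower_1; lra.
have x0 := Cmod_ge_0 u; have y0 := Cmod_ge_0 v.
set x := Cmod u in x0 *; set y := Cmod v in y0 *.
rewrite Rpow_mult_distr.
have ih : 0 < / h by exact: Rinv_0_lt_compat.
set a := h * x; set b := / h * y.
have a0 : 0 <= a by apply: Rmult_le_pos; lra.
have b0 : 0 <= b by apply: Rmult_le_pos; lra.
have -> : w * x ^ 2 = a ^ 2 by rewrite hw /a; ring.
have -> : T ^ 2 * y ^ 2 / w = T ^ 2 * b ^ 2 by rewrite hw /b; field; lra.
have p1 := pow2_ge_0 (a - b); have p2 := pow2_ge_0 a; have p3 := pow2_ge_0 b.
have ab := Rmult_le_pos _ _ a0 b0.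
have sq : a ^ 2 + b ^ 2 <= (a + b) ^ 2 <= 2 * (a ^ 2 + b ^ 2) by lra.
have q1 : b ^ 2 = / T ^ 2 * (T ^ 2 * b ^ 2) by field; lra.
have q2 : 0 <= T ^ 2 * b ^ 2 by apply: Rmult_le_pos; lra.
have q3 : 0 <= / T ^ 2 * a ^ 2 by apply: Rmult_le_pos; lra.
have q4 : 0 <= T ^ 2 * a ^ 2 by apply: Rmult_le_pos; lra.
have q5 : 0 <= T ^ 2 * (T ^ 2 * b ^ 2) by apply: Rmult_le_pos; lra.
have q6 : 0 <= T ^ 2 * (a + b) ^ 2 by apply: Rmult_le_pos; [lra | exact: pow2_ge_0].
have q7 : 0 <= / T ^ 2 * (a + b) ^ 2 by apply: Rmult_le_pos; [lra | exact: pow2_ge_0].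
have q8 : T ^ 2 * b ^ 2 <= T ^ 2 * (a + b) ^ 2 by apply: Rmult_le_compat_l; lra.
have q9 := pow2_ge_0 (a + b).
split; lra.
Qed.

Lemma norm_at_0_data n (l xi : 'I_n -> R) g (u v : C) :
  let lam := ln (djbr l xi) in let l2 := (cexp (g - 1) lam * v)%C in
  within_factor 2 (exp ((Re g - 1) * lam) * norm_at_0 l g xi u v ^ 2) (Cmod u ^ 2 + Cmod l2 ^ 2).
Proof.
move=> lam l2; set gam := Re g - 1.
have -> : Cmod l2 = exp (gam * lam) * Cmod v.
  by rewrite /l2 Cmod_mult cexp_mod /gam; congr (exp (_ * _) * _); rewrite /Re /=; ring.
rewrite /norm_at_0 /Rpower -/lam.
set e := exp ((Re g - 1) / 2 * lam).
have e0 : 0 < e by exact: exp_pos.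
have -> : exp ((1 - Re g) / 2 * lam) = / e.
  by rewrite /e -exp_Ropp; congr exp; field.
have -> : exp (gam * lam) = e * e by rewrite /e -exp_plus; congr exp; rewrite /gam; field.
have x0 := Cmod_ge_0 u; have y0 := Cmod_ge_0 v.
set x := Cmod u in x0 *; set y := Cmod v in y0 *.
have -> : e * e * (/ e * x + e * y) ^ 2 = (x + e * e * y) ^ 2 by field; lra.
set z := e * e * y.
have z0 : 0 <= z by apply: Rmult_le_pos => //; nra.
have p1 := pow2_ge_0 (x - z); have p2 := Rmult_le_pos _ _ x0 z0.
have p3 := pow2_ge_0 x; have p4 := pow2_ge_0 z.
split; lra.
Qed.

Lemma loss_sq n (l : 'I_n -> R) (c : 'I_n -> C) xi :
  loss l c xi ^ 2 = exp (cvnorm c * ln (djbr l xi)).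
Proof. by rewrite /loss /Rpower /= Rmult_1_r -exp_plus; congr exp; field. Qed.

Lemma le_of_sq_le A x y : 0 <= y -> 0 <= A -> x ^ 2 <= A * y ^ 2 -> x <= sqrt A * y.
Proof.
move=> hy hA h; apply: Rle_trans (Rle_abs _) _.
have -> : sqrt A * y = Rabs (sqrt A * y).
  by rewrite Rabs_pos_eq //; apply: Rmult_le_pos => //; exact: sqrt_pos.
apply: Rsqr_le_abs_0; rewrite !Rsqr_pow2 Rpow_mult_distr pow2_sqrt //.
Qed.

(** The Cauchy data at [T] and the asymptotic data are both compared with the Cauchy
    data at the fixed scaled time [ln rho2]; the powers of [<<xi>>] in the norms are
    exactly those produced by the change to the scaled time. *)
Lemma data_comparison (T : R) (d : nat) (l : 'I_d.+1 -> R) (c : 'I_d.+1 -> C) (g : C)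
    (rho2 K2 : R) :
  0 < T -> (forall i, -1 < l i) -> 0 < rho2 <= T -> 0 < K2 ->
  exists K, forall xi Y1 Y2 (u v php phm : C),
    let lam := ln (djbr l xi) in
    Sol (pot d.+1 (expo d.+1 l) c (scaled d.+1 l xi)) g (lam + ln T) Y1 Y2 ->
    Y1 (lam + ln T) = u -> Y2 (lam + ln T) = (RtoC T * v)%C ->
    within_factor K2 (Cmod php ^ 2 + Cmod (cexp (g - 1) lam * phm)%C ^ 2)
      (normsq Y1 Y2 (ln rho2)) ->
    norm_at_0 l g xi php phm <= K * (loss l c xi * norm_at_T xi u v) /\
    norm_at_T xi u v <= K * (loss l c xi * norm_at_0 l g xi php phm).
Proof.
move=> hT hl [hr hrT] hK2.
have [K1 [hK1 FT]] := final_time d l c g (ln T) (ln rho2) hl (ln_le _ _ hr hrT).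
have [A [hA NT]] := norm_at_T_energy d.+1 T hT.
exists (sqrt (2 * (K2 * (K1 * A)))) => xi Y1 Y2 u v php phm lam hY e1 e2 w2.
have w1 := FT xi Y1 Y2 hY; rewrite -/lam e1 e2 in w1.
have wT := NT xi u v; have w0 := norm_at_0_data d.+1 l xi g php phm.
rewrite -/lam in w0.
set EG := exp ((Re g - 1) * lam) in w0 w1.
have EG0 : 0 < EG by exact: exp_pos.
set EC := exp (cvnorm c * lam) in w1; have EC0 : 0 < EC by exact: exp_pos.
have w3 := within_factor_scal _ EG _ _ (Rlt_le _ _ EG0) wT.
have KE : 0 <= K1 * EC by apply: Rmult_le_pos; lra.
have KEA : 0 <= K1 * EC * A by apply: Rmult_le_pos; lra.
have KKEA : 0 <= K2 * (K1 * EC * A) by apply: Rmult_le_pos; lra.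
have [W1 W2] := within_factor_trans _ _ _ _ _ (Rlt_le _ _ Rlt_0_2) KKEA w0
  (within_factor_trans _ _ _ _ _ (Rlt_le _ _ hK2) KEA w2
  (within_factor_trans _ _ _ _ _ KE (Rlt_le _ _ hA) (within_factor_sym _ _ _ w1)
    (within_factor_sym _ _ _ w3))).
have LQ : loss l c xi ^ 2 = EC by exact: loss_sq.
have pT : 0 <= norm_at_T xi u v.
  by apply: Rplus_le_le_0_compat; apply: Rmult_le_pos; try exact: Cmod_ge_0; exact/Rlt_le/exp_pos.
have p0 : 0 <= norm_at_0 l g xi php phm.
  by apply: Rplus_le_le_0_compat; apply: Rmult_le_pos; try exact: Cmod_ge_0; exact/Rlt_le/exp_pos.
have pL : 0 <= loss l c xi by exact/Rlt_le/exp_pos.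
have cst : 0 <= 2 * (K2 * (K1 * A)).
  by apply: Rmult_le_pos; [lra | apply: Rmult_le_pos; [lra | apply: Rmult_le_pos; lra]].
split; apply: le_of_sq_le => //; try exact: Rmult_le_pos; rewrite Rpow_mult_distr LQ;
  apply: (Rmult_le_reg_l EG) => //.
  by apply: Rle_trans W1 _; right; ring.
by apply: Rle_trans W2 _; right; rewrite -/EG; ring.
Qed.

(** * Asymptotics and scattering *)

Theorem theorem3p14 (T : R) (d : nat) (l : 'I_d.+1 -> R) (c : 'I_d.+1 -> C) (g : C)
    (rho1 : R) (N D Rem : nat -> R -> ('I_d.+1 -> R) -> @matrix C 2 2)
    (hT : 0 < T) (hl : forall i, -1 < l i) (hrho1 : 0 < rho1 < 1)
    (hseq : g <> RtoC 1 -> diagonalizer T l c g rho1 N D Rem) :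
  exists m0 : nat, forall mP : nat, (m0 <= mP)%N ->
  exists rho2 : R, 0 < rho2 <= rho1 /\ forall rho0 : R, 0 < rho0 <= rho2 ->
  (* Asymptotics *)
  (exists K : R, forall phi0 phi1 : ('I_d.+1 -> R) -> C,
     exists phi dphi : R -> ('I_d.+1 -> R) -> C,
       K_solution T l c g phi dphi /\
       (forall xi, phi T xi = phi0 xi /\ dphi T xi = phi1 xi) /\
       (forall psi dpsi : R -> ('I_d.+1 -> R) -> C,
          K_solution T l c g psi dpsi ->
          (forall xi, psi T xi = phi0 xi /\ dpsi T xi = phi1 xi) ->
          forall t xi, 0 < t <= T -> psi t xi = phi t xi) /\
       exists php0 phm0 : ('I_d.+1 -> R) -> C,
         asymptotic_data T l g rho0 N mP phi dphi php0 phm0 /\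
         forall xi,
           norm_at_0 l g xi (php0 xi) (phm0 xi)
             <= K * (loss l c xi * norm_at_T xi (phi T xi) (dphi T xi))) /\
  (* Scattering *)
  (exists K : R, forall php0 phm0 : ('I_d.+1 -> R) -> C,
     exists phi dphi : R -> ('I_d.+1 -> R) -> C,
       K_solution T l c g phi dphi /\
       asymptotic_data T l g rho0 N mP phi dphi php0 phm0 /\
       (forall psi dpsi : R -> ('I_d.+1 -> R) -> C,
          K_solution T l c g psi dpsi ->
          asymptotic_data T l g rho0 N mP psi dpsi php0 phm0 ->
          forall t xi, 0 < t <= T -> psi t xi = phi t xi) /\
       forall xi,
         norm_at_T xi (phi T xi) (dphi T xi)
           <= K * (loss l c xi * norm_at_0 l g xi (php0 xi) (phm0 xi))).
Proof.
have [m0 H] := asymptotic_maps T d l c g rho1 N D Rem hT hl hrho1 hseq.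
exists m0 => mP hm; have [rho2 [K2 [[hr1 hr2] [hK2 [p1 [p2 AM]]]]]] := H mP hm.
exists rho2; split=> // rho0 hr0.
have [K DC] := data_comparison T d l c g rho2 K2 hT hl (conj (proj1 hr1) hr2) hK2.
pose lam xi := ln (djbr l xi).
pose q xi := pot d.+1 (expo d.+1 l) c (scaled d.+1 l xi).
have qc xi : Ccontinuous (q xi) by exact: pot_continuous.
have lam0 xi : 0 <= lam xi.
  by rewrite /lam -ln_1; apply: ln_le; [lra | exact: djbr_ge1].
have sigS xi : ln rho2 <= lam xi + ln T.
  by have := ln_le _ _ (proj1 hr1) hr2; have := lam0 xi; lra.
have lt xi t : 0 < t <= T -> lam xi + ln t <= lam xi + ln T.
  by move=> ht; have := ln_le t T; lra.
have PF xi : ProperFilter' (near0 d.+1 T l rho0 xi) by apply: near0_proper => //; lra.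
have FF xi : Filter (near0 d.+1 T l rho0 xi) by exact: within_filter.
(* the factor [<<xi>> ^ (g - 1)] in [p2] is undone on the limit of [phi_-] *)
have toT phi dphi xi Y1 Y2 l1 l2 :
    (forall t, 0 < t <= T -> Y1 (lam xi + ln t) = phi t xi /\
       Y2 (lam xi + ln t) = (RtoC t * dphi t xi)%C) ->
    filterlim (fun s => p1 xi s (Y1 s) (Y2 s)) (Rbar_locally m_infty) (locally (l1 : C)) ->
    filterlim (fun s => p2 xi s (Y1 s) (Y2 s)) (Rbar_locally m_infty) (locally (l2 : C)) ->
    let php tau := varphi_p g N mP phi dphi tau xi in
    let phm tau := varphi_m g N mP phi dphi tau xi in
    (g <> RtoC 1 -> filterlim php (near0 d.+1 T l rho0 xi) (locally l1)) /\
    (g = RtoC 1 ->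
       filterlim (fun tau => php tau - RtoC (ln (zvar l tau xi)) * phm tau)%C
         (near0 d.+1 T l rho0 xi) (locally l1)) /\
    filterlim phm (near0 d.+1 T l rho0 xi) (locally (cexp (- (g - 1)) (lam xi) * l2)%C).
  move=> hval h1 h2 php phm; have [_ V] := AM xi.
  split; [|split].
  - move=> hg; apply: (limit_in_log_time _ _ _ _ _ (lam xi) _ _ _ _ h1) => t ht.
    have [e1 e2] := hval t ht; have [v1 _] := V phi dphi t (proj1 ht).
    by rewrite e1 e2; exact: v1.
  - move=> hg; apply: (limit_in_log_time _ _ _ _ _ (lam xi) _ _ _ _ h1) => t ht.
    have [e1 e2] := hval t ht; have [_ [v1 _]] := V phi dphi t (proj1 ht).
    by rewrite e1 e2; exact: v1.
  - have h3 : filterlim (fun t => cexp (g - 1) (lam xi) * phm t)%C (near0 d.+1 T l rho0 xi) (locally l2).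
      apply: (limit_in_log_time _ _ _ _ _ (lam xi) _ _ _ _ h2) => t ht.
      have [e1 e2] := hval t ht; have [_ [_ v1]] := V phi dphi t (proj1 ht).
      by rewrite e1 e2; exact: v1.
    have := Cfilterlim_scal _ (FF xi) _ (cexp (- (g - 1)) (lam xi)) _ h3.
    by apply: filterlim_ext => t; rewrite Cmult_assoc cexp_opp; ring.
have cc xi (z : C) : (cexp (g - 1) (lam xi) * (cexp (- (g - 1)) (lam xi) * z))%C = z.
  by rewrite Cmult_assoc (Cmult_comm (cexp _ _)) cexp_opp; ring.
have iT : (RtoC (/ T) * RtoC T)%C = RtoC 1 by rewrite -RtoC_mult Rinv_l //; lra.
split.
  exists K => phi0 phi1.
  have ex xi : exists Y : (R -> C) * (R -> C), Y.1 (lam xi + ln T) = phi0 xi /\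
      Y.2 (lam xi + ln T) = (RtoC T * phi1 xi)%C /\ forall S, Sol (q xi) g S Y.1 Y.2.
    have [Y1 [Y2 h]] := Sol_exists (q xi) g (lam xi + ln T) (phi0 xi) (RtoC T * phi1 xi)%C (qc xi).
    by exists (Y1, Y2).
  have [Y hY] := choose_function _ _ _ ex.
  have hK := K_solution_of_Sol T d.+1 l c g (fun xi => (Y xi).1) (fun xi => (Y xi).2)
    (fun xi => proj2 (proj2 (hY xi))).
  set phi := fun t xi => (Y xi).1 _ in hK; set dphi := fun t xi => Cmult _ _ in hK.
  have vT xi : phi T xi = phi0 xi /\ dphi T xi = phi1 xi.
    have [e1 [e2 _]] := hY xi; split; first exact: e1.
    by rewrite /dphi -/(lam xi) e2 Cmult_assoc iT; ring.
  exists phi, dphi; split=> //; split=> //; split.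
    move=> psi dpsi hpsi hval t xi ht.
    have [X1 [X2 [hX X]]] := Sol_of_K_solution T d.+1 l c g psi dpsi xi hT hpsi.
    have [f1 f2] := X T (conj hT (Rle_refl _)); have [g1 g2] := hval xi.
    have [e1 [e2 e3]] := hY xi.
    have [<- _] := X t ht.
    apply: (cauchy_unique (q xi) g (lam xi + ln T) _ _ _ _ (qc xi) hX (e3 _)) (lt xi t ht).
      by rewrite f1 g1 e1.
    by rewrite f2 g2 e2.
  have ex2 xi : exists L : C * C,
      filterlim (fun s => p1 xi s ((Y xi).1 s) ((Y xi).2 s)) (Rbar_locally m_infty) (locally L.1) /\
      filterlim (fun s => p2 xi s ((Y xi).1 s) ((Y xi).2 s)) (Rbar_locally m_infty) (locally L.2) /\
      within_factor K2 (Cmod L.1 ^ 2 + Cmod L.2 ^ 2) (normsq (Y xi).1 (Y xi).2 (ln rho2)).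
    have [[_ [_ A]] _] := AM xi.
    have [l1 [l2 h]] := A (lam xi + ln T) _ _ (sigS xi) (proj2 (proj2 (hY xi)) _).
    by exists (l1, l2).
  have [Lm hL] := choose_function _ _ _ ex2.
  exists (fun xi => (Lm xi).1), (fun xi => cexp (- (g - 1)) (lam xi) * (Lm xi).2)%C.
  have vals xi t : 0 < t <= T -> (Y xi).1 (lam xi + ln t) = phi t xi /\
      (Y xi).2 (lam xi + ln t) = (RtoC t * dphi t xi)%C.
    move=> [ht _]; split=> //; rewrite /dphi -/(lam xi) Cmult_assoc -RtoC_mult Rinv_r; last lra.
    by ring.
  split.
    by move=> xi; have [h1 [h2 _]] := hL xi; exact: (toT phi dphi xi _ _ _ _ (vals xi) h1 h2).
  move=> xi; have [h1 [h2 w]] := hL xi; have [e1 [e2 e3]] := hY xi; have [v1 v2] := vT xi.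
  have [] := DC xi _ _ (phi T xi) (dphi T xi) (Lm xi).1 (cexp (- (g - 1)) (lam xi) * (Lm xi).2)%C
    (e3 _) _ _ _ => //.
  - by rewrite v2.
  - by rewrite -/(lam xi) cc.
exists K => php0 phm0.
have ex xi : exists Y : (R -> C) * (R -> C), (forall S, Sol (q xi) g S Y.1 Y.2) /\
    filterlim (fun s => p1 xi s (Y.1 s) (Y.2 s)) (Rbar_locally m_infty) (locally (php0 xi)) /\
    filterlim (fun s => p2 xi s (Y.1 s) (Y.2 s)) (Rbar_locally m_infty)
      (locally (cexp (g - 1) (lam xi) * phm0 xi)%C).
  have [A _] := AM xi.
  have [Y1 [Y2 h]] := scattering_exists (q xi) g _ _ _ _ (php0 xi)
    (cexp (g - 1) (lam xi) * phm0 xi)%C (qc xi) A.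
  by exists (Y1, Y2).
have [Y hY] := choose_function _ _ _ ex.
have hK := K_solution_of_Sol T d.+1 l c g (fun xi => (Y xi).1) (fun xi => (Y xi).2)
  (fun xi => proj1 (hY xi)).
set phi := fun t xi => (Y xi).1 _ in hK; set dphi := fun t xi => Cmult _ _ in hK.
have vals xi t : 0 < t <= T -> (Y xi).1 (lam xi + ln t) = phi t xi /\
    (Y xi).2 (lam xi + ln t) = (RtoC t * dphi t xi)%C.
  move=> [ht _]; split=> //; rewrite /dphi -/(lam xi) Cmult_assoc -RtoC_mult Rinv_r; last lra.
  by ring.
exists phi, dphi; split=> //; split.
  move=> xi; have [_ [h1 h2]] := hY xi.
  have := toT phi dphi xi _ _ _ _ (vals xi) h1 h2.
  by rewrite Cmult_assoc cexp_opp Cmult_1_l.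
split.
  move=> psi dpsi hpsi hdata t xi ht.
  have [X1 [X2 [hX X]]] := Sol_of_K_solution T d.+1 l c g psi dpsi xi hT hpsi.
  have [A _] := AM xi; have [_ [_ A3]] := A.
  have [l1 [l2 [h1 [h2 _]]]] := A3 _ _ _ (sigS xi) hX.
  have [k1 [k2 k3]] := toT psi dpsi xi _ _ _ _ X h1 h2.
  have [j1 [j2 j3]] := hdata xi.
  have E1 : l1 = php0 xi.
    case: (Ceq_dec g (RtoC 1)) => hg.
      exact: Cfilterlim_unique _ (PF xi) _ _ _ (k2 hg) (j2 hg).
    exact: Cfilterlim_unique _ (PF xi) _ _ _ (k1 hg) (j1 hg).
  have E2 : l2 = (cexp (g - 1) (lam xi) * phm0 xi)%C.
    by rewrite -(Cfilterlim_unique _ (PF xi) _ _ _ k3 j3) cc.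
  have [e3 [e1 e2]] := hY xi; have [<- _] := X t ht.
  rewrite E1 in h1; rewrite E2 in h2.
  exact: (scattering_unique (q xi) g _ _ _ _ (lam xi + ln T) _ _ _ _ _ _ (qc xi) A (sigS xi) hX (e3 _) h1 h2 e1 e2 _ (lt xi t ht)).
move=> xi; have [e3 [h1 h2]] := hY xi; have [v1 v2] := vals xi T (conj hT (Rle_refl _)).
have [[_ [_ A3]] _] := AM xi.
have [l1 [l2 [k1 [k2 w]]]] := A3 _ _ _ (sigS xi) (e3 _).
have PM := minfty_proper.
rewrite (Cfilterlim_unique _ PM _ _ _ k1 h1) (Cfilterlim_unique _ PM _ _ _ k2 h2) in w.
by have [_] := DC xi _ _ (phi T xi) (dphi T xi) (php0 xi) (phm0 xi) (e3 _) v1 v2 w.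
Qed.
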